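(* Let $\mathcal{N}_{\mathcal{P}}(n,H)$ denote the maximum, over all $n$-vertex planar graphs $G$, of the number of copies of $H$ in $G$. Then, as $n\to\infty$, \begin{align*} \mathcal{N}_{\mathcal{P}}(n,C_5) &= 2n^2+O(n^{2-1/5}),\\ \mathcal{N}_{\mathcal{P}}(n,C_{2m+1}) &= 2m\Bigl(\frac{n}{m}\Bigr)^m+O(n^{m-1/5}) \quad\text{for } m\in\{3,4\},\\ \mathcal{N}_{\mathcal{P}}(n,C_{2m+1}) &\le 3m\Bigl(\frac{n}{m}\Bigr)^m+O(n^{m-1/5}) \quad\text{for every integer } m\ge 5, \end{align*} where the implicit constants in the $O$-terms depend only on $m$.
   Context: All graphs are finite and simple. $C_k$ denotes the cycle on $k$ vertices. For graphs $G,H$, a copy of $H$ in $G$ is an (unlabeled, not necessarily induced) subgraph of $G$ isomorphic to $H$; $\mathcal{N}(G,H)$ is the number of such copies, and $\mathcal{N}_{\mathcal{P}}(n,H)=\max\{\mathcal{N}(G,H): G \text{ an } n\text{-vertex planar graph}\}$. *)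

(* Defs.v *)
From HB Require Import structures.
From mathcomp Require Import all_boot all_order all_algebra.
From mathcomp Require Import all_classical all_reals.
From mathcomp Require Import topology normedtype exp.
From mathcomp Require Import Rstruct Rstruct_topology.
From Stdlib Require Import Rdefinitions.

Set Implicit Arguments.
Unset Strict Implicit.
Unset Printing Implicit Defensive.

Import Order.TTheory GRing.Theory Num.Theory.


Definition simple_graph (n : nat) (E : {set {set 'I_n}}) : bool :=
  [forall e in E, #|e| == 2].

Section Planar.
Local Open Scope classical_set_scope.
Definition planar (n : nat) (E : {set {set 'I_n}}) : Prop :=
  exists (p : 'I_n -> (R * R)%type) (c : {set 'I_n} -> R -> (R * R)%type),
    injective p /\
    (forall e, e \in E ->
       exists x y : 'I_n, [/\ x != y, e = [set x; y]%SET,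
         c e 0%R = p x, c e 1%R = p y &
         [/\ {within `[0%R, 1%R]%classic, continuous (c e)},
             {in `[0%R, 1%R]%classic &, injective (c e)} &
             forall t, (0 < t < 1)%R -> forall v, c e t <> p v]]) /\
    (forall e e', e \in E -> e' \in E -> e != e' ->
       forall t s, (0 < t < 1)%R -> (0 < s < 1)%R -> c e t <> c e' s).
End Planar.

Definition ncopies (n : nat) (E : {set {set 'I_n}}) (k : nat)
    (EH : {set {set 'I_k}}) : nat :=
  #|[set VE : {set 'I_n} * {set {set 'I_n}} |
      (VE.2 \subset E) &&
      [exists f : {ffun 'I_k -> 'I_n},
         [&& injectiveb f, VE.1 == (f @: [set: 'I_k])%SET &
             VE.2 == [set (f @: (e : {set 'I_k}))%SET | e in EH]%SET]]]|.

Definition cycle_edges (k : nat) : {set {set 'I_k}} :=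
  [set [set i; ordS i]%SET | i : 'I_k]%SET.

(* N_P(n, H): maximum number of copies of H over all n-vertex planar graphs
   (the empty graph is planar, so the maximum is over a nonempty family). *)
Definition NP (n k : nat) (EH : {set {set 'I_k}}) : nat :=
  \max_(E : {set {set 'I_n}} | simple_graph E && `[< planar E >])
     ncopies E EH.

(* Main.v *)
(* Upper bound. Measuring the winding of a drawn edge around a vertex by half-planes turns a
   planar drawing into an integer certificate, and an alternating sum of its equations modulo 4
   forbids K_{3,3} minors. Hence the graph is 14-degenerate and, writing n ~ r^5, all but O(r)
   vertices have degree below r^4 and at most two neighbours among the O(r) high-degree hubs.
   In the degenerate orientation a copy of C_{2m+1} with fewer than m sources has O(n^{m-1})
   choices, and so has, up to a factor r^4, one with m sources missing a hub. The remaining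
   copies follow a cyclic sequence of m hubs, or a path through m+1 of them, and are counted by
   products of a symmetric weight on pairs of hubs whose total is n + O(r^4). This homogeneous
   polynomial is maximised by a perturbation argument: thinning the heaviest edge of a maximiser
   bounds its value by a sum over walks grown from that edge.
   Lower bound. Join blow-up vertices, placed along the bisectors of disjoint cones, to the two
   hubs spanning their cone, and join consecutive vertices of a cone; a straight-line drawing
   shows planarity, and each choice of one vertex per cone, doubled in one cone, gives two
   copies. *)
Require Import Defs.
From mathcomp Require Import all_boot all_order all_algebra.

Set Implicit Arguments.
Unset Strict Implicit.
Unset Printing Implicit Defensive.

(** The exponent 1/5 is a balance. At degree threshold D there are O(n/D) hubs; copies that miss a
    hub cost a factor D, and vertices serving many pairs of hubs add O((n/D)^4) to the total weight,
    so D = n^(4/5). The obstacle is that one weight has to control two quantities: the common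
    neighbours of a pair of hubs, and the directed edges between their neighbourhoods, called
    ladders here. Bounding ladders by a larger multiple of common neighbours would spoil the leading
    term. Contracting edges inside the bundle of a pair shows that, averaged over the two
    directions, ladders are no more numerous than the vertices of the bundle, and a vertex outside a
    small exceptional set is charged to one bundle only. In the extremal problem for m hubs, AM-GM
    along a walk gives (m-1)^(1-m), which exceeds m^(1-m) by the factor (1 + 1/(m-1))^(m-1) <= 3:
    this is the 3 of the bound for large m. The factor 2 for m = 3 and 4 needs the short walk sums
    estimated sharply, with equality at the m-cycle of equal weights. *)

Module HalfPlaneFacts.
From mathcomp Require Import all_boot all_order all_algebra.

From mathcomp Require Import ring lra zify.
Import Order.TTheory GRing.Theory Num.Theory.
Local Open Scope ring_scope.

(** * Half-turns between plane vectors *)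

Section HalfPlaneWinding.
Variable K : realFieldType.
Implicit Types z w : (K * K)%type.

(** The half-plane is half-open: it keeps the positive horizontal axis and drops the negative one,
    so that exactly one of z and -z lies in it when z is nonzero. *)
Definition upper z : bool := (0 < z.2) || ((z.2 == 0) && (0 < z.1)).
Definition cross z w : K := z.1 * w.2 - z.2 * w.1.
Definition dotp z w : K := z.1 * w.1 + z.2 * w.2.
(** A signed crossing of the horizontal axis. Summed along vectors that move by small steps, it is
    the winding measured in half-turns, an integer obtained without angles. *)
Definition half_turn z w : int :=
  if upper z == upper w then 0 else if 0 < cross z w then 1 else -1.

Lemma upperN z : z != 0 -> upper (- z) = ~~ upper z.
Proof.
case: z => a b; rewrite /upper /= => nz.
have {}nz : (a != 0) || (b != 0).
  by move: nz; apply: contraNT; rewrite negb_or !negbK => /andP[/eqP-> /eqP->].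
case: (ltgtP b 0) nz => [b0|b0|->] nz /=; rewrite ?oppr_eq0.
- by rewrite oppr_gt0 b0.
- rewrite oppr_gt0 (lt_gtF b0) /= (gt_eqF b0) //.
rewrite oppr0 ltxx /= oppr_gt0; move: nz; rewrite orbF.
by rewrite eqxx /=; case: (ltgtP a 0).
Qed.

Lemma half_turnN z w : z != 0 -> w != 0 -> half_turn (- z) (- w) = half_turn z w.
Proof.
move=> z0 w0; rewrite /half_turn !upperN // /cross /= !mulrNN.
by case: (upper z) (upper w) => [] [].
Qed.

Lemma half_turn_parity z w :
  exists k : int, half_turn z w = (upper w)%:Z - (upper z)%:Z + 2 * k.
Proof.
rewrite /half_turn; case: (upper z) (upper w) => [] [] /=.
- by exists 0.
- by case: ifP => _; [exists 1 | exists 0].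
- by case: ifP => _; [exists 0 | exists (-1)].
- by exists 0.
Qed.

Lemma dotp_neq0 z w : 0 < dotp z w -> z != 0.
Proof.
by apply: contraTneq => ->; rewrite /dotp /= !mul0r addr0 ltxx.
Qed.

Lemma upper_cross_neq0 z w :
  0 < dotp z w -> upper z -> ~~ upper w -> cross z w != 0.
Proof.
case: z => a b; case: w => c d; rewrite /dotp /cross /upper /= => D Hz Hw.
apply/eqP => C.
move: Hw; rewrite negb_or negb_and -!leNgt => /andP[d0 Hw].
case/orP: Hz => [b0|/andP[/eqP b0 a0]].
- have E : d * (a * a + b * b) = b * (a * c + b * d).
    have -> : d * (a * a + b * b) = a * (a * d - b * c) + b * (a * c + b * d) by ring.
    by rewrite C mulr0 add0r.
  have : 0 < b * (a * c + b * d) by apply: mulr_gt0.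
  by rewrite -E; have := sqr_ge0 a; have := sqr_ge0 b; nra.
- subst b; have d00 : d = 0 by nra.
  by move: Hw; rewrite d00 eqxx /= leNgt => /negP; apply; nra.
Qed.

(** Cramer's rule: with k = cross z z', p = cross z w and q = cross z' w one has k w = p z' - q z.
    If p > 0 > q, the positive dot products force k > 0, and w becomes a positive combination of two
    vectors of the upper half-plane, which is a convex cone. *)
Lemma upper_cross_sign z z' w : 0 < dotp z z' -> 0 < dotp z w -> 0 < dotp z' w ->
  upper z -> upper z' -> ~~ upper w -> 0 < cross z w -> 0 < cross z' w.
Proof.
move=> D1 D2 D3 u1 u2 uw C.
have N := upper_cross_neq0 D3 u2 uw.
case: (ltgtP (cross z' w) 0) N => // C' _.
move: z z' w D1 D2 D3 u1 u2 uw C C' => [a b] [a' b'] [c d].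
rewrite /dotp /cross /upper /= => D1 D2 D3 u1 u2 uw C C'.
have E1 : c * (a * b' - b * a') = (a * d - b * c) * a' - (a' * d - b' * c) * a by ring.
have E2 : d * (a * b' - b * a') = (a * d - b * c) * b' - (a' * d - b' * c) * b by ring.
set k := (a * b' - b * a') in E1 E2.
set p := (a * d - b * c) in E1 E2 C.
set q := (a' * d - b' * c) in E1 E2 C'.
have b0 : 0 <= b by move: u1 => /orP[/ltW|/andP[/eqP-> _]].
have b0' : 0 <= b' by move: u2 => /orP[/ltW|/andP[/eqP-> _]].
have kp : 0 < k.
  have E : k * (a * c + b * d) = p * (a * a' + b * b') - q * (a * a + b * b).
    rewrite mulrDr !(mulrCA k) (mulrC k) (mulrC k) E1 E2; ring.
  have : 0 < k * (a * c + b * d).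
    rewrite E; have := mulr_gt0 C D1; have := sqr_ge0 a; have := sqr_ge0 b; nra.
  by rewrite pmulr_lgt0.
move: uw; rewrite negb_or negb_and -!leNgt => /andP[d0 uw].
have dk : d * k <= 0 by rewrite mulr_le0_ge0 // ltW.
have pb : 0 <= p * b' by rewrite mulr_ge0 // ltW.
have qb : 0 <= - q * b by rewrite mulr_ge0 // oppr_ge0 ltW.
have pb0 : p * b' = 0 by lra.
have qb0 : - q * b = 0 by lra.
have b'0 : b' = 0 by move/eqP: pb0; rewrite mulf_eq0 gt_eqF //= => /eqP.
have b00 : b = 0 by move/eqP: qb0; rewrite mulf_eq0 oppr_eq0 lt_eqF //= => /eqP.
have d00 : d = 0 by nra.
move: u1 u2 uw; rewrite b'0 b00 d00 eqxx ltxx /= => a0 a0' c0.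
by rewrite b00 d00 in D2; nra.
Qed.

Lemma dotpC z w : dotp z w = dotp w z.
Proof. by rewrite /dotp mulrC [X in _ + X]mulrC. Qed.

Lemma crossC z w : cross z w = - cross w z.
Proof. by rewrite /cross opprB [X in _ - X]mulrC [X in X - _]mulrC. Qed.

Lemma half_turn_opp z w : 0 < dotp z w -> half_turn w z = - half_turn z w.
Proof.
move=> D; rewrite /half_turn eq_sym; case: eqP => [_|/eqP ne]; first by rewrite oppr0.
have : cross z w != 0.
  case uz : (upper z); case uw : (upper w); rewrite ?uz ?uw // in ne.
  - by apply: upper_cross_neq0 => //; rewrite uw.
  - by rewrite crossC oppr_eq0; apply: upper_cross_neq0; rewrite ?uz 1?dotpC.
rewrite (crossC w z) oppr_gt0.
by case: ltgtP.
Qed.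

Lemma half_turn_same_side z z' w : 0 < dotp z z' -> 0 < dotp z w -> 0 < dotp z' w ->
  upper z = upper z' -> half_turn z w = half_turn z' w.
Proof.
move=> D1 D2 D3 E; rewrite /half_turn E.
case: eqP => // /eqP ne.
suff -> : (0 < cross z w) = (0 < cross z' w) by [].
case u : (upper z') ne => ne.
  have uw : ~~ upper w by case: (upper w) ne.
  by apply/idP/idP; apply: upper_cross_sign; rewrite ?u ?E // dotpC.
have nz := dotp_neq0 D2; have nz' := dotp_neq0 D3.
have nw : w != 0 by apply: (@dotp_neq0 _ z); rewrite dotpC.
have cN x y : cross (- x) (- y) = cross x y by rewrite /cross /= !mulrNN.
have dN x y : dotp (- x) (- y) = dotp x y by rewrite /dotp /= !mulrNN.
have uw : upper w by case: (upper w) ne.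
rewrite -(cN z) -(cN z').
by apply/idP/idP; apply: upper_cross_sign; rewrite ?dN ?upperN ?E ?u ?uw // dotpC.
Qed.

(** Three vectors pairwise less than a quarter-turn apart cannot surround the origin, so their
    signed crossings add up. Two of the three lie on the same side of the axis, which reduces every
    case to [half_turn_same_side] and antisymmetry. *)
Lemma half_turn_triangle z1 z2 z3 :
  0 < dotp z1 z2 -> 0 < dotp z2 z3 -> 0 < dotp z1 z3 ->
  half_turn z1 z2 + half_turn z2 z3 = half_turn z1 z3.
Proof.
move=> D12 D23 D13.
case e12 : (upper z1 == upper z2).
  by rewrite {1}/half_turn e12 add0r; apply/esym/half_turn_same_side => //; apply/eqP.
case e23 : (upper z2 == upper z3).
  rewrite [X in _ + X]/half_turn e23 addr0.
  have D21 : 0 < dotp z2 z1 by rewrite dotpC.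
  have D31 : 0 < dotp z3 z1 by rewrite dotpC.
  have D32 : 0 < dotp z3 z2 by rewrite dotpC.
  rewrite (half_turn_opp D21) (half_turn_opp D31); congr (- _).
  by apply: half_turn_same_side => //; apply/eqP.
have e13 : upper z1 = upper z3.
  by case: (upper z1) (upper z2) (upper z3) e12 e23 => [] [] [].
rewrite [RHS]/half_turn e13 eqxx (half_turn_same_side D13) //; last by rewrite dotpC.
by rewrite (half_turn_opp D23) addNr.
Qed.

End HalfPlaneWinding.
End HalfPlaneFacts.

(** * Uniform separation of disjoint arcs *)

Module ArcsFacts.
From mathcomp Require Import all_boot all_order all_algebra.
From mathcomp Require Import all_classical all_reals.
From mathcomp Require Import topology normedtype exp.
From mathcomp Require Import ring lra zify.
Delimit Scope nat_scope with N.
Import HalfPlaneFacts.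
Import Order.TTheory GRing.Theory Num.Theory.
Import numFieldNormedType.Exports.
Local Open Scope ring_scope.

Section ArcWinding.
Variable K : realType.

Definition arc_continuous (g : K -> (K * K)%type) : Prop :=
  forall t : K, 0 <= t <= 1 -> forall e : K, 0 < e -> exists2 d : K, 0 < d &
    forall s : K, 0 <= s <= 1 -> `|s - t| < d ->
      `|(g s).1 - (g t).1| < e /\ `|(g s).2 - (g t).2| < e.

Lemma within_arc_continuous (g : K -> (K * K)%type) :
  ({within `[0%R, 1%R]%classic, continuous g})%classic -> arc_continuous g.
Proof.
move=> cg t t01 e e0.
have At : (`[0%R, 1%R]%classic : set K) t by rewrite /= in_itv /=.
have : within `[0%R, 1%R]%classic (nbhs t) (g @^-1` ball (g t) e)%classic.
  by rewrite (nbhs_subspace_in At); exact: (cg t _ (nbhsx_ballx (g t) e e0)).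
rewrite /within /= nearE.
case/nbhs_ballP => d /= d0 Hd; exists d => // s s01 st.
have [] : ball (g t) e (g s).
  apply: Hd; last by rewrite /= in_itv /=.
  by rewrite /ball /= distrC.
by rewrite /ball /= => H1 H2; split; rewrite distrC.
Qed.

Lemma cst_arc_continuous z : arc_continuous (fun=> z).
Proof.
by move=> t _ e e0; exists 1 => // s _ _; rewrite !subrr normr0.
Qed.

(** The eighth keeps each coordinate off by at most a quarter of the larger of |a| and |b|. The
    product belonging to the larger coordinate is then at least 9/16 of its square and outweighs the
    other product, whatever its sign. *)
Lemma close_dotp_gt0 (a b x y x' y' e : K) : (a != 0) || (b != 0) ->
  e = (`|a| + `|b|) / 8 ->
  `|x - a| < e -> `|y - b| < e -> `|x' - a| < e -> `|y' - b| < e ->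
  0 < x * x' + y * y'.
Proof.
move=> ab eE; rewrite !ltr_norml => /andP[x1 x2] /andP[y1 y2] /andP[x3 x4] /andP[y3 y4].
wlog ab' : a b x y x' y' eE x1 x2 x3 x4 y1 y2 y3 y4 ab / `|b| <= `|a|.
  move=> H; case: (leP `|b| `|a|) => [|/ltW] h; first by apply: (H a b x y x' y').
  rewrite addrC; apply: (H b a y x y' x') => //; rewrite 1?orbC //.
  by rewrite [`|b| + _]addrC.
have a0 : 0 < `|a|.
  rewrite normr_gt0; apply/eqP => a0; move: ab ab'; rewrite a0 normr0 eqxx /=.
  by rewrite -normr_gt0 ltNge => /negP.
have e1 : e <= `|a| / 4 by lra.
have P1 : `|a| * `|a| * (9 / 16) <= x * x'.
  by case: (ler0P a) e1 a0 => h e1 a0; nra.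
have P2 : - (`|a| * `|a| * (1 / 2)) <= y * y'.
  have h1 : `|y' - y| <= 2 * e by rewrite ler_norml; lra.
  have : - (e * e) <= y * y'.
    have : 0 <= (y + y') ^+ 2 by exact: sqr_ge0.
    have : (y' - y) ^+ 2 <= (2 * e) ^+ 2.
      by rewrite -real_normK ?num_real // ler_pXn2r // ?nnegrE ?normr_ge0 //; lra.
    rewrite !expr2; lra.
  have a2 : 0 <= `|a| * `|a| by apply: mulr_ge0.
  have : e * e <= `|a| / 4 * (`|a| / 4) by apply: ler_pM; lra.
  by move: a2; set u := `|a|; lra.
have : 0 < `|a| * `|a| by exact: mulr_gt0.
lra.
Qed.

Lemma distB_lt (x x' y y' e : K) : `|x - x'| < e / 2 -> `|y - y'| < e / 2 ->
  `|(x - y) - (x' - y')| < e.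
Proof.
move=> h1 h2; have -> : x - y - (x' - y') = (x - x') - (y - y') by ring.
by apply: le_lt_trans (ler_normB _ _) _; rewrite [e]splitr ltrD.
Qed.

Lemma distD_lt (x y z e : K) : `|x - y| < e / 2 -> `|y - z| < e / 2 -> `|x - z| < e.
Proof.
move=> h1 h2; rewrite -(subrKA y).
by apply: le_lt_trans (ler_normD _ _) _; rewrite [e]splitr ltrD.
Qed.

(** The difference g t - g' s does not vanish on the compact unit square, so a fine enough mesh
    makes it turn by less than a quarter-turn between neighbouring grid points. Compactness is used
    in its near-covering form along the filter of large N. *)
Lemma uniformly_close (g g' : K -> (K * K)%type) :
  arc_continuous g -> arc_continuous g' ->
  (forall t s : K, 0 <= t <= 1 -> 0 <= s <= 1 -> g t != g' s) ->
  exists N0 : nat, forall N : nat, (N0 <= N)%N -> forall t s t' s' : K,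
    0 <= t <= 1 -> 0 <= s <= 1 -> 0 <= t' <= 1 -> 0 <= s' <= 1 ->
    `|t' - t| <= N.+1%:R^-1 -> `|s' - s| <= N.+1%:R^-1 ->
    0 < dotp (g t - g' s) (g t' - g' s').
Proof.
move=> cg cg' ne.
pose I01 : set K := `[0, 1]%classic.
have cpt : compact (I01 `*` I01)%classic by apply: compact_setX; exact: segment_compact.
pose P (N : nat) (x : K * K) : Prop := 0 <= x.1 <= 1 -> 0 <= x.2 <= 1 ->
  forall t' s' : K, 0 <= t' <= 1 -> 0 <= s' <= 1 ->
    `|t' - x.1| <= N.+1%:R^-1 -> `|s' - x.2| <= N.+1%:R^-1 ->
    0 < dotp (g x.1 - g' x.2) (g t' - g' s').
have [|N0 _ HN0] := (compact_near_coveringP _).1 cpt nat eventually P _.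
  move=> [t s] [/= t01 s01]; rewrite /I01 /= !in_itv /= in t01 s01.
  set a := (g t).1 - (g' s).1; set b := (g t).2 - (g' s).2.
  have ab : (a != 0) || (b != 0).
    rewrite -negb_and; apply: contraTN (ne _ _ t01 s01) => /andP[a0 b0].
    rewrite negbK; move: a0 b0; rewrite !subr_eq0 => a0 b0.
    by rewrite -pair_eqE /= a0 b0.
  set e := (`|a| + `|b|) / 8.
  have e0 : 0 < e / 2.
    have := normr_ge0 a; have := normr_ge0 b; rewrite /e.
    by case/orP: ab; rewrite -normr_gt0; lra.
  have [d d0 Hd] := cg t t01 _ e0.
  have [d' d'0 Hd'] := cg' s s01 _ e0.
  (* Half of the radius is spent on moving the base point, half on the mesh step. *)
  pose r := Num.min d d' / 2.
  have r0 : 0 < r by rewrite /r divr_gt0 // lt_min d0.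
  have [rd rd'] : r * 2 <= d /\ r * 2 <= d'.
    by rewrite /r divfK ?pnatr_eq0 // ge_min lexx ge_min lexx orbT.
  have [N1 HN1] : exists N1 : nat, forall N : nat, (N1 <= N)%N -> N.+1%:R^-1 < r.
    exists (Num.truncn (r^-1)) => N hN.
    rewrite -[ltRHS]invrK ltf_pV2 ?posrE ?invr_gt0 //.
    apply: lt_le_trans (truncnS_gt _) _.
    by rewrite ler_nat.
  exists (ball (t, s) r, [set N | (N1 <= N)%N])%classic => /=.
    split; first exact: nbhsx_ballx.
    by exists N1.
  move=> [[t1 s1] N] /= [[B1 B2] hN]; rewrite /P /=.
  rewrite /ball /= in B1 B2.
  move=> t101 s101 t' s' t'01 s'01 tt ss.
  have Nr := HN1 _ hN.
  rewrite distrC in B1; rewrite distrC in B2.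
  have tr := le_lt_trans tt Nr; have sr := le_lt_trans ss Nr.
  have rd2 : r <= d / 2 by rewrite ler_pdivlMr.
  have rd'2 : r <= d' / 2 by rewrite ler_pdivlMr.
  have dd : d / 2 <= d by rewrite ler_pdivrMr // ler_peMr ?ler1n // ltW.
  have dd' : d' / 2 <= d' by rewrite ler_pdivrMr // ler_peMr ?ler1n // ltW.
  have T0 := lt_le_trans B1 rd2; have S0 := lt_le_trans B2 rd'2.
  have T1 := lt_le_trans T0 dd; have S1 := lt_le_trans S0 dd'.
  have T2 := distD_lt (lt_le_trans tr rd2) T0.
  have S2 := distD_lt (lt_le_trans sr rd'2) S0.
  have [g1 g2] := Hd _ t101 T1; have [g3 g4] := Hd _ t'01 T2.
  have [h1 h2] := Hd' _ s101 S1; have [h3 h4] := Hd' _ s'01 S2.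
  rewrite /dotp /=; apply: (close_dotp_gt0 (e := e) ab) => //; rewrite /a /b.
  - exact: distB_lt.
  - exact: distB_lt.
  - exact: distB_lt.
  - exact: distB_lt.
exists N0 => N hN t s t' s' t01 s01 t'01 s'01 tt ss.
by apply: (HN0 N hN (t, s)).
Qed.

End ArcWinding.
End ArcsFacts.

(** * Turning numbers of sampled arcs *)

Module TurnsFacts.
From mathcomp Require Import all_boot all_order all_algebra.
From mathcomp Require Import ring lra zify.
Import HalfPlaneFacts.
Import Order.TTheory GRing.Theory Num.Theory.
Local Open Scope ring_scope.

Section Turns.
Variable K : realFieldType.

Definition sample (N : nat) (g : K -> (K * K)%type) (i : nat) := g (i%:R / N.+1%:R).

Definition turns (N : nat) (g : K -> (K * K)%type) (z : (K * K)%type) : int :=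
  \sum_(i < N.+1) half_turn (sample N g i - z) (sample N g i.+1 - z).

Lemma turns_parity N g z : exists k : int,
  turns N g z = (upper (g 1 - z))%:Z - (upper (g 0 - z))%:Z + 2 * k.
Proof.
have H (n : nat) : exists k : int,
    \sum_(i < n) half_turn (sample N g i - z) (sample N g i.+1 - z) =
    (upper (sample N g n - z))%:Z - (upper (sample N g 0%N - z))%:Z + 2 * k.
  elim: n => [|n [k IH]]; first by exists 0; rewrite big_ord0 subrr mulr0.
  have [l El] := half_turn_parity (sample N g n - z) (sample N g n.+1 - z).
  by exists (k + l); rewrite big_ord_recr /= IH El; ring.
have [k Hk] := H N.+1; exists k.
by rewrite /turns Hk /sample mul0r divff // pnatr_eq0.
Qed.

(** The map (t, s) -> g t - g' s has no zero on the square, so its turning along the boundary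
    vanishes; this is summed up cell by cell with [half_turn_triangle]. On the two sides run by g'
    the turning vector is g' s - g t, the opposite one, which has the same half-turns by
    [half_turnN]. *)
Lemma turns_square N (g g' : K -> (K * K)%type) :
  (forall t s t' s' : K,
    0 <= t <= 1 -> 0 <= s <= 1 -> 0 <= t' <= 1 -> 0 <= s' <= 1 ->
    `|t' - t| <= N.+1%:R^-1 -> `|s' - s| <= N.+1%:R^-1 ->
    0 < dotp (g t - g' s) (g t' - g' s')) ->
  turns N g (g' 0) + turns N g' (g 1) = turns N g' (g 0) + turns N g (g' 1).
Proof.
move=> close.
pose D (i j : nat) := sample N g i - sample N g' j.
have P (i i' j j' : nat) : (i <= N.+1)%N -> (j <= N.+1)%N -> (i' <= N.+1)%N -> (j' <= N.+1)%N ->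
    (i <= i' <= i.+1)%N -> (j <= j' <= j.+1)%N -> 0 < dotp (D i j) (D i' j').
  have n01 (n : nat) : (n <= N.+1)%N -> 0 <= (n%:R / N.+1%:R : K) <= 1.
    by move=> h; rewrite divr_ge0 ?ler0n //= ler_pdivrMr ?ltr0n // mul1r ler_nat.
  have nd (n n' : nat) : (n <= n' <= n.+1)%N -> `|n'%:R / N.+1%:R - n%:R / N.+1%:R| <= (N.+1%:R^-1 : K).
    case/andP=> h1 h2; rewrite -mulrBl -natrB // normrM [`|_^-1|]ger0_norm ?invr_ge0 ?ler0n //.
    rewrite -[leRHS]mul1r ler_wpM2r ?invr_ge0 ?ler0n // normr_nat.
    by rewrite -[leRHS]/(1%:R) ler_nat leq_subLR addn1.
  by move=> *; apply: close; auto.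
have cell (i j : nat) : (i < N.+1)%N -> (j < N.+1)%N ->
    half_turn (D i j) (D i.+1 j) + half_turn (D i.+1 j) (D i.+1 j.+1) =
    half_turn (D i j) (D i j.+1) + half_turn (D i j.+1) (D i.+1 j.+1).
  move=> hi hj; rewrite !half_turn_triangle //; apply: P; rewrite ?leqnn ?leqnSn //; exact: ltnW.
have row (j : nat) : (j < N.+1)%N ->
    \sum_(i < N.+1) half_turn (D i j) (D i.+1 j) + half_turn (D N.+1 j) (D N.+1 j.+1) =
    half_turn (D 0 j)%N (D 0 j.+1)%N + \sum_(i < N.+1) half_turn (D i j.+1) (D i.+1 j.+1).
  move=> hj.
  have H (n : nat) : (n <= N.+1)%N ->
      \sum_(i < n) half_turn (D i j) (D i.+1 j) + half_turn (D n j) (D n j.+1) =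
      half_turn (D 0 j)%N (D 0 j.+1)%N + \sum_(i < n) half_turn (D i j.+1) (D i.+1 j.+1).
    elim: n => [|n IH] hn; first by rewrite !big_ord0 add0r addr0.
    rewrite !big_ord_recr /= addrA -IH ?(ltnW hn) //.
    by rewrite -!addrA cell.
  exact: H.
have col (n : nat) : (n <= N.+1)%N ->
    \sum_(i < N.+1) half_turn (D i 0%N) (D i.+1 0%N) + \sum_(j < n) half_turn (D N.+1 j) (D N.+1 j.+1) =
    \sum_(j < n) half_turn (D 0 j)%N (D 0 j.+1)%N + \sum_(i < N.+1) half_turn (D i n) (D i.+1 n).
  elim: n => [|n IH] hn; first by rewrite !big_ord0 add0r addr0.
  rewrite !(@big_ord_recr _ _ _ n) /= addrA IH ?(ltnW hn) // -!addrA; congr (_ + _).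
  by rewrite row.
have nz (i j : nat) : (i <= N.+1)%N -> (j <= N.+1)%N -> D i j != 0.
  by move=> hi hj; apply: (dotp_neq0 (w := D i j)); apply: P; rewrite ?leqnn ?leqnSn.
have := col _ (leqnn N.+1).
have s0 h : sample N h 0%N = h 0 by rewrite /sample mul0r.
have s1 h : sample N h N.+1 = h 1 by rewrite /sample divff // pnatr_eq0.
have E (i : nat) : (i <= N.+1)%N -> \sum_(j < N.+1) half_turn (D i j) (D i j.+1) = turns N g' (sample N g i).
  move=> hi; apply: eq_bigr => j _.
  rewrite -half_turnN ?nz //; last exact: ltnW.
  by rewrite /D !opprB.
rewrite !E // s0 s1 /turns /D s0 s1 => <-.
by congr (_ + _).
Qed.

End Turns.
End TurnsFacts.

(** * Winding certificates exclude K_{3,3} minors *)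

Module MinorsFacts.
From mathcomp Require Import all_boot all_order all_algebra.
From mathcomp Require Import ring lra zify.
Import HalfPlaneFacts.
Import Order.TTheory GRing.Theory Num.Theory.

(** What remains of a drawing: [w x y v] stands for the half-turns of the edge from x to y around v,
    and [h x v] tells whether the vector from v to x lies in the upper half-plane. The last clause
    is the square equation of two disjoint edges. *)
Definition winding_certificate (T : eqType) (e : rel T) : Prop :=
  (exists (w : T -> T -> T -> int) (h : T -> T -> int),
  [/\ forall x y v, e x y -> w y x v = - w x y v,
      forall x y v, e x y -> v != x -> v != y ->
        exists k : int, w x y v = h y v - h x v + 2 * k,
      forall x v, x != v -> h x v + h v x = 1 &
      forall a b c d, e a b -> e c d -> uniq [:: a; b; c; d] ->
        w a b c - w a b d + w c d b - w c d a = 0])%R.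

Section Minors.
Variables (T : finType) (e : rel T).
Implicit Types (A B : {set T}) (x y v : T).

Definition restr (A : {set T}) : rel T := [rel x y | [&& x \in A, y \in A & e x y]].
Definition conn (A : {set T}) : Prop :=
  A != set0 /\ {in A &, forall x y, connect (restr A) x y}.
Definition adjS (A B : {set T}) : bool := [exists x in A, [exists y in B, e x y]].

Definition k33_minor_free : Prop := forall X Y : nat -> {set T},
  (forall i, i < 3 -> conn (X i)) -> (forall i, i < 3 -> conn (Y i)) ->
  (forall i j, i < 3 -> j < 3 -> i != j -> [disjoint X i & X j]) ->
  (forall i j, i < 3 -> j < 3 -> i != j -> [disjoint Y i & Y j]) ->
  (forall i j, i < 3 -> j < 3 -> [disjoint X i & Y j]) ->
  (forall i j, i < 3 -> j < 3 -> adjS (X i) (Y j)) -> False.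

Hypothesis e_sym : symmetric e.
Hypothesis e_irr : irreflexive e.

Lemma adjSP A B : reflect (exists x y, [/\ x \in A, y \in B & e x y]) (adjS A B).
Proof.
apply: (iffP exists_inP) => [[x xA /exists_inP[y yB xy]]|[x [y [xA yB xy]]]].
  by exists x, y.
by exists x => //; apply/exists_inP; exists y.
Qed.

Lemma adjS_sym A B : adjS A B = adjS B A.
Proof. by apply/adjSP/adjSP => -[x [y [h1 h2 h3]]]; exists y, x; rewrite e_sym. Qed.

Lemma adjSS A A' B B' : A \subset A' -> B \subset B' -> adjS A B -> adjS A' B'.
Proof.
move=> /subsetP sA /subsetP sB /adjSP[x [y [xA yB xy]]].
by apply/adjSP; exists x, y; split; auto.
Qed.

Lemma restrS A B x y : A \subset B -> connect (restr A) x y -> connect (restr B) x y.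
Proof.
move=> /subsetP AB; apply: connect_sub => a b /and3P[aA bA ab]; apply: connect1.
by rewrite /restr /= !AB.
Qed.

Lemma restr_sym A : connect_sym (restr A).
Proof.
by apply: sym_connect_sym => x y; rewrite /restr /= e_sym andbCA.
Qed.

Lemma conn1 x : conn [set x].
Proof.
split; first by apply/set0Pn; exists x; rewrite inE.
by move=> a b /set1P-> /set1P->.
Qed.

Lemma connU A B : conn A -> conn B -> adjS A B -> conn (A :|: B).
Proof.
move=> [A0 cA] [_ cB] /adjSP[a [b [aA bB ab]]]; split.
  by apply/set0Pn; exists a; rewrite inE aA.
have base : connect (restr (A :|: B)) a b.
  by apply: connect1; rewrite /restr /= !inE aA bB ab orbT.
have toa x : x \in A :|: B -> connect (restr (A :|: B)) x a.
  case/setUP => xX; first by apply: restrS (cA _ _ xX aA); exact: subsetUl.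
  rewrite restr_sym; apply: connect_trans base _.
  by apply: restrS (cB _ _ bB xX); exact: subsetUr.
by move=> x y /toa hx /toa hy; apply: connect_trans hx _; rewrite restr_sym.
Qed.

Lemma restr_path A x p : path (restr A) x p -> x \in A -> path e x p /\ {subset x :: p <= A}.
Proof.
elim: p x => [|y p IH] x /=; first by move=> _ xA; split=> // z; rewrite inE => /eqP->.
case/andP=> /and3P[_ yA xy] /IH/(_ yA)[h1 h2] xA; split; first by rewrite xy.
by move=> z; rewrite inE => /orP[/eqP->//|]; apply: h2.
Qed.

Section Certificate.
Local Open Scope ring_scope.
Variables (w : T -> T -> T -> int) (h : T -> T -> int).
Hypothesis w_parity : forall x y v, e x y -> v != x -> v != y ->
  exists k : int, w x y v = h y v - h x v + 2 * k.
Hypothesis h_anti : forall x v, x != v -> h x v + h v x = 1.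
Hypothesis w_square : forall a b c d, e a b -> e c d -> uniq [:: a; b; c; d] ->
  w a b c - w a b d + w c d b - w c d a = 0.

Fixpoint walk_turns x p v : int :=
  if p is y :: p' then w x y v + walk_turns y p' v else 0.

Lemma walk_turns_parity x p v : path e x p -> v \notin x :: p ->
  exists k : int, walk_turns x p v = h (last x p) v - h x v + 2 * k.
Proof.
elim: p x => [|y p IH] x /=; first by exists 0; rewrite subrr mulr0.
case/andP=> xy yp; rewrite !inE !negb_or => /and3P[vx vy vp].
have [|k Hk] := IH _ yp; first by rewrite inE negb_or vy vp.
have [l Hl] := w_parity xy vx vy.
by exists (k + l); rewrite Hk Hl; ring.
Qed.

Lemma walk_turns_edge a b c q : e a b -> path e c q ->
  a \notin c :: q -> b \notin c :: q ->
  w a b c - w a b (last c q) + walk_turns c q b - walk_turns c q a = 0.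
Proof.
elim: q c => [|d q IH] c ab /=; first by rewrite !subrr.
case/andP=> cd dq; rewrite !inE !negb_or => /and3P[ac ad aq] /and3P[bc bd bq].
have := IH d ab dq; rewrite !inE !negb_or ad aq bd bq => /(_ isT isT).
have nab : a != b by apply: contraTneq ab => ->; rewrite e_irr.
have ncd : c != d by apply: contraTneq cd => ->; rewrite e_irr.
have := w_square ab cd; rewrite /= !inE !negb_or nab ac ad bc bd ncd => /(_ isT).
by move=> S I; rewrite -[RHS](addr0 0) -{1}S -I; ring.
Qed.

(** The square equation is additive in each of its two edges, so it passes to walks by induction on
    one of them and then on the other. Only disjointness of the two walks matters; a walk may repeat
    its own vertices. *)
Lemma walk_turns_square a p c q : path e a p -> path e c q ->
  (forall x, x \in a :: p -> x \notin c :: q) ->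
  walk_turns a p c - walk_turns a p (last c q) +
  walk_turns c q (last a p) - walk_turns c q a = 0.
Proof.
elim: p a => [|b p IH] a /=; first by rewrite !subrr add0r subrr.
case/andP=> ab bp cq dis.
have := IH b bp cq; set W := walk_turns.
have db x : x \in b :: p -> x \notin c :: q.
  by move=> xp; apply: dis; rewrite inE xp orbT.
move=> /(_ db).
have := walk_turns_edge ab cq (dis a _) (dis b _); rewrite !inE !eqxx /= orbT => /(_ isT isT).
rewrite -/W; lia.
Qed.

Lemma k33_walks_parity (x y : nat -> T) (p : nat -> nat -> seq T) :
  (forall i j, (i < 3)%N -> (j < 3)%N -> path e (x i) (p i j)) ->
  (forall i j, (i < 3)%N -> (j < 3)%N -> last (x i) (p i j) = y j) ->
  (forall i j l, (i < 3)%N -> (j < 3)%N -> (l < 3)%N -> l != i -> x l \notin x i :: p i j) ->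
  (forall i j l, (i < 3)%N -> (j < 3)%N -> (l < 3)%N -> l != j -> y l \notin x i :: p i j) ->
  (forall i j i' j', (i < 3)%N -> (j < 3)%N -> (i' < 3)%N -> (j' < 3)%N -> i != i' -> j != j' ->
     forall v, v \in x i :: p i j -> v \notin x i' :: p i' j') -> False.
Proof.
move=> Hp Hl Hx Hy Hd.
pose W i j v := walk_turns (x i) (p i j) v.
have sq i j i' j' : (i < 3)%N -> (j < 3)%N -> (i' < 3)%N -> (j' < 3)%N ->
    i != i' -> j != j' ->
    W i j (x i') - W i j (y j') + W i' j' (y j) - W i' j' (x i) = 0.
  move=> h1 h2 h3 h4 h5 h6.
  have := walk_turns_square (Hp i j h1 h2) (Hp i' j' h3 h4) (Hd i j i' j' h1 h2 h3 h4 h5 h6).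
  by rewrite !Hl.
(* Summed over the three pairs i < i' and all ordered pairs of distinct j, j', each [W i j (x l)]
   gets coefficient 2 or -2 and each [W i j (y l)] gets 2i - 2. These are even, so modulo 4 the
   unknown multiples of 2 inside W disappear. Of the h-terms, those mixing x and y or two y's
   cancel, while each of the three pairs [x i], [x l] contributes h + h = 1 once for each of three
   j. The sum is 2 modulo 4 and cannot be 0. *)
pose S (i i' : nat) := \sum_(jj <- [:: (0, 1); (0, 2); (1, 0); (1, 2); (2, 0); (2, 1)]%N)
  (W i jj.1 (x i') - W i jj.1 (y jj.2) + W i' jj.2 (y jj.1) - W i' jj.2 (x i)).
have S0 i i' : (i < 3)%N -> (i' < 3)%N -> i != i' -> S i i' = 0.
  by move=> h1 h2 h3; rewrite /S !big_cons big_nil /= !sq // !addr0.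
have {S0} : S 0%N 1%N + S 0%N 2%N + S 1%N 2%N = 0 by rewrite !S0.
rewrite /S !big_cons !big_nil /=.
have px i j l : (i < 3)%N -> (j < 3)%N -> (l < 3)%N -> l != i ->
    exists k : int, W i j (x l) = h (y j) (x l) - h (x i) (x l) + 2 * k.
  by move=> h1 h2 h3 h4; rewrite -(Hl i j h1 h2); apply: walk_turns_parity; auto.
have py i j l : (i < 3)%N -> (j < 3)%N -> (l < 3)%N -> l != j ->
    exists k : int, W i j (y l) = h (y j) (y l) - h (x i) (y l) + 2 * k.
  by move=> h1 h2 h3 h4; rewrite -(Hl i j h1 h2); apply: walk_turns_parity; auto.
have Ex i l (hi : (i < 3)%N) (hl : (l < 3)%N) (li : l != i) :
    [/\ exists k : int, W i 0%N (x l) = h (y 0%N) (x l) - h (x i) (x l) + 2 * k,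
        exists k : int, W i 1%N (x l) = h (y 1%N) (x l) - h (x i) (x l) + 2 * k &
        exists k : int, W i 2%N (x l) = h (y 2%N) (x l) - h (x i) (x l) + 2 * k].
  by split; apply: px.
have Ey j l (hj : (j < 3)%N) (hl : (l < 3)%N) (lj : l != j) :
    [/\ exists k : int, W 0%N j (y l) = h (y j) (y l) - h (x 0%N) (y l) + 2 * k,
        exists k : int, W 1%N j (y l) = h (y j) (y l) - h (x 1%N) (y l) + 2 * k &
        exists k : int, W 2%N j (y l) = h (y j) (y l) - h (x 2%N) (y l) + 2 * k].
  by split; apply: py.
have [[? ->] [? ->] [? ->]] := Ex 0 1 isT isT isT.
have [[? ->] [? ->] [? ->]] := Ex 0 2 isT isT isT.
have [[? ->] [? ->] [? ->]] := Ex 1 0 isT isT isT.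
have [[? ->] [? ->] [? ->]] := Ex 1 2 isT isT isT.
have [[? ->] [? ->] [? ->]] := Ex 2 0 isT isT isT.
have [[? ->] [? ->] [? ->]] := Ex 2 1 isT isT isT.
have [[? ->] [? ->] [? ->]] := Ey 0 1 isT isT isT.
have [[? ->] [? ->] [? ->]] := Ey 0 2 isT isT isT.
have [[? ->] [? ->] [? ->]] := Ey 1 0 isT isT isT.
have [[? ->] [? ->] [? ->]] := Ey 1 2 isT isT isT.
have [[? ->] [? ->] [? ->]] := Ey 2 0 isT isT isT.
have [[? ->] [? ->] [? ->]] := Ey 2 1 isT isT isT.
have nxx i l : (i < 3)%N -> (l < 3)%N -> l != i -> x i != x l.
  by move=> h1 h2 h3; have := Hx i 0%N l h1 isT h2 h3; rewrite inE negb_or eq_sym => /andP[].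
have nxy i j : (i < 3)%N -> (j < 3)%N -> x i != y j.
  move=> h1 h2; have [j' [h3 h4]] : exists j', (j' < 3)%N /\ j != j'.
    by case: j h2 => [|j] h2; [exists 1%N | exists 0%N].
  by have := Hy i j' j h1 h3 h2 h4; rewrite inE negb_or eq_sym => /andP[].
have := h_anti (nxx 0 1 isT isT isT); have := h_anti (nxx 0 2 isT isT isT).
have := h_anti (nxx 1 2 isT isT isT).
have := h_anti (nxy 0 0 isT isT); have := h_anti (nxy 0 1 isT isT); have := h_anti (nxy 0 2 isT isT).
have := h_anti (nxy 1 0 isT isT); have := h_anti (nxy 1 1 isT isT); have := h_anti (nxy 1 2 isT isT).
have := h_anti (nxy 2 0 isT isT); have := h_anti (nxy 2 1 isT isT); have := h_anti (nxy 2 2 isT isT).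
lia.
Qed.
End Certificate.

(** The walk [p i j] is taken inside the union of [X i] and [Y j]. Walks whose indices differ on
    both sides are therefore disjoint, and representatives of other branch sets stay off it, as the
    parity argument requires. *)
Lemma certificate_k33_minor_free : winding_certificate e -> k33_minor_free.
Proof.
move=> [w [h [_ w_par h_anti w_sq]]] X Y cX cY dX dY dXY aXY.
have repr (Z : nat -> {set T}) : (forall i, i < 3 -> conn (Z i)) ->
    exists z : nat -> T, forall i, i < 3 -> z i \in Z i.
  move=> cZ; have [z0 _] : exists z, z \in Z 0 by apply/set0Pn; case: (cZ 0).
  exists (fun i => odflt z0 [pick z in Z i]) => i hi.
  case: pickP => //= Z0; case: (cZ i hi) => /set0Pn[z]; by rewrite Z0.
have [x Hx] := repr X cX; have [y Hy] := repr Y cY.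
have walk i j : i < 3 -> j < 3 -> exists p,
    [/\ path e (x i) p, last (x i) p = y j & {subset x i :: p <= X i :|: Y j}].
  move=> hi hj; have [_ /(_ (x i) (y j))] := connU (cX i hi) (cY j hj) (aXY i j hi hj).
  rewrite !inE Hx // Hy // orbT => /(_ isT isT)/connectP[p pp ->].
  by have [] := restr_path pp; rewrite ?inE ?Hx // => h1 h2; exists p.
have [p Hp] : exists p : nat -> nat -> seq T, forall i j, i < 3 -> j < 3 ->
    [/\ path e (x i) (p i j), last (x i) (p i j) = y j &
        {subset x i :: p i j <= X i :|: Y j}].
  have [p Hp] : exists p : 'I_3 -> 'I_3 -> seq T, forall i j : 'I_3,
      [/\ path e (x i) (p i j), last (x i) (p i j) = y j &
        {subset x i :: p i j <= X i :|: Y j}].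
    have H (i : 'I_3) : exists q : 'I_3 -> seq T, forall j : 'I_3,
        [/\ path e (x i) (q j), last (x i) (q j) = y j &
          {subset x i :: q j <= X i :|: Y j}].
      apply: (@fin_all_exists 'I_3 (fun=> seq T) (fun j q => [/\ path e (x i) q,
        last (x i) q = y j & {subset x i :: q <= X i :|: Y j}])) => j.
      exact: walk.
    by have [p Hp] := @fin_all_exists 'I_3 (fun=> 'I_3 -> seq T) _ H; exists p.
  exists (fun i j => p (inord i) (inord j)) => i j hi hj.
  by have := Hp (inord i) (inord j); rewrite !inordK.
have out (Z Z' : {set T}) v : [disjoint Z & Z'] -> v \in Z -> v \notin Z'.
  by move=> d vZ; rewrite (disjointFr d vZ).
apply: (k33_walks_parity w_par h_anti w_sq (x := x) (y := y) (p := p)).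
- by move=> i j hi hj; case: (Hp i j hi hj).
- by move=> i j hi hj; case: (Hp i j hi hj).
- move=> i j l hi hj hl li; have [_ _ sub] := Hp i j hi hj.
  apply/negP => /sub; rewrite inE (negbTE (out _ _ _ (dX _ _ hl hi li) (Hx l hl))).
  by rewrite (negbTE (out _ _ _ (dXY _ _ hl hj) (Hx l hl))).
- move=> i j l hi hj hl lj; have [_ _ sub] := Hp i j hi hj.
  apply/negP => /sub; rewrite inE (negbTE (out _ _ _ (dY _ _ hl hj lj) (Hy l hl))) orbF.
  by apply/negP; apply: out (Hy l hl); rewrite disjoint_sym dXY.
- move=> i j i' j' hi hj hi' hj' ii jj v; have [_ _ sub] := Hp i j hi hj.
  have [_ _ sub'] := Hp i' j' hi' hj'.
  move=> /sub/setUP vU; apply/negP => /sub'/setUP vU'.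
  case: vU => h1; case: vU' => h2.
  + by move: h2; apply/negP/out/h1/dX.
  + by move: h2; apply/negP/out/h1/dXY.
  + by move: h1; apply/negP/out/h2/dXY.
  + by move: h2; apply/negP/out/h1/dY.
Qed.

End Minors.
End MinorsFacts.

(** * Edge density of K_{3,3}-minor-free graphs and a degenerate order *)

Module DegeneracyFacts.
From mathcomp Require Import all_boot all_order all_algebra.
From mathcomp Require Import ring lra zify.
Import HalfPlaneFacts MinorsFacts.

Section EdgeCount.
Variable T : finType.
Implicit Types (r : rel T) (V : {set T}) (x y : T).

Lemma card_ind_set (P : {set T} -> Prop) :
  (forall V, (forall V' : {set T}, #|V'| < #|V| -> P V') -> P V) -> forall V, P V.
Proof.
move=> H V; have [n] := ubnP #|V|; elim: n V => // n IH V lt.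
by apply: H => V' lt'; apply: IH; apply: leq_trans lt' lt.
Qed.

Definition degin r V x : nat := \sum_(y in V) r x y.
Definition edges2 r V : nat := \sum_(x in V) degin r V x.

Lemma edges2D1 r V x : symmetric r -> irreflexive r -> x \in V ->
  edges2 r V = edges2 r (V :\ x) + 2 * degin r (V :\ x) x.
Proof.
move=> sr ir xV; rewrite /edges2 (big_setD1 x) //=.
rewrite {1}/degin (big_setD1 x) //= ir add0n.
have -> : \sum_(y in V :\ x) degin r V y =
    \sum_(y in V :\ x) (r x y + degin r (V :\ x) y).
  by apply: eq_bigr => y _; rewrite /degin (big_setD1 x) //= sr.
rewrite big_split /= /degin; lia.
Qed.

Lemma eq_edges2 r r' V : {in V &, r =2 r'} -> edges2 r V = edges2 r' V.
Proof. by move=> E; apply: eq_bigr => x xV; apply: eq_bigr => y yV; rewrite E. Qed.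

Lemma leq_degin r V x : degin r V x <= #|V|.
Proof. by rewrite -sum1_card; apply: leq_sum => y _; exact: leq_b1. Qed.

Lemma card_degin r V x : #|[set y in V | r x y]| = degin r V x.
Proof.
rewrite -sum1_card /degin big_mkcond [RHS]big_mkcond; apply: eq_bigr => y _.
by rewrite inE; case: (y \in V) (r x y) => [] [].
Qed.

End EdgeCount.

Section K33.
Variables (T : finType) (e : rel T).
Hypothesis e_sym : symmetric e.
Hypothesis e_irr : irreflexive e.
Hypothesis e_k33 : k33_minor_free e.
Implicit Types (A B U V Z : {set T}) (x y z : T) (phi : T -> {set T}).

(** Three of the sets [Z i] against [U1], [U2], [U3] would be the branch sets of a K_{3,3}. Most
    counting bounds below are instances of this with suitably chosen branch sets. *)
Lemma common_neighbours_le2 (I : finType) (F : {set I}) (Z : I -> {set T}) U1 U2 U3 :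
  [/\ conn e U1, conn e U2 & conn e U3] ->
  [/\ [disjoint U1 & U2], [disjoint U1 & U3] & [disjoint U2 & U3]] ->
  (forall i, i \in F -> conn e (Z i)) ->
  (forall i, i \in F -> [/\ [disjoint U1 & Z i], [disjoint U2 & Z i] & [disjoint U3 & Z i]]) ->
  (forall i, i \in F -> [/\ adjS e U1 (Z i), adjS e U2 (Z i) & adjS e U3 (Z i)]) ->
  {in F &, forall i j, i != j -> [disjoint Z i & Z j]} ->
  #|F| <= 2.
Proof.
move=> [c1 c2 c3] [d12 d13 d23] cZ dZ aZ dZZ; rewrite leqNgt; apply/negP => /card_gt2P.
move=> [i1 [i2 [i3 [[F1 F2 F3] [n12 n23 n31]]]]].
apply: (e_k33 (X := nth set0 [:: U1; U2; U3]) (Y := nth set0 [:: Z i1; Z i2; Z i3])).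
- by case=> [|[|[|]]].
- by case=> [|[|[|]]] //= _; apply: cZ.
- by case=> [|[|[|i]]] //; case=> [|[|[|j]]] //= *; rewrite disjoint_sym.
- case=> [|[|[|i]]] //; case=> [|[|[|j]]] //= *; apply: dZZ => //; by rewrite eq_sym.
- by case=> [|[|[|i]]] //; case=> [|[|[|j]]] //= _ _;
    [case: (dZ _ F1)|case: (dZ _ F2)|case: (dZ _ F3)|case: (dZ _ F1)|case: (dZ _ F2)|
     case: (dZ _ F3)|case: (dZ _ F1)|case: (dZ _ F2)|case: (dZ _ F3)].
- by case=> [|[|[|i]]] //; case=> [|[|[|j]]] //= _ _;
    [case: (aZ _ F1)|case: (aZ _ F2)|case: (aZ _ F3)|case: (aZ _ F1)|case: (aZ _ F2)|
     case: (aZ _ F3)|case: (aZ _ F1)|case: (aZ _ F2)|case: (aZ _ F3)].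
Qed.

(** A minor is kept as a set of labels with branch sets in the original graph, so that a contraction
    merely changes [phi] and the hypothesis on minors is never transported. *)
Definition model V phi : Prop :=
  {in V, forall x, conn e (phi x)} /\
  {in V &, forall x y, x != y -> [disjoint phi x & phi y]}.

Definition radj phi : rel T := [rel x y | (x != y) && adjS e (phi x) (phi y)].

Definition merge phi x y : T -> {set T} :=
  fun z => if z == x then phi x :|: phi y else phi z.

Lemma radj_sym phi : symmetric (radj phi).
Proof. by move=> x y; rewrite /radj /= eq_sym adjS_sym. Qed.

Lemma radj_irr phi : irreflexive (radj phi).
Proof. by move=> x; rewrite /radj /= eqxx. Qed.

Lemma modelS V V' phi : V' \subset V -> model V phi -> model V' phi.
Proof.
move=> /subsetP s [h1 h2]; split; first by move=> x /s; apply: h1.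
by move=> x y /s xV /s yV; apply: h2.
Qed.

Lemma disjointU Z A B : [disjoint Z & A :|: B] = [disjoint Z & A] && [disjoint Z & B].
Proof. by rewrite -!setI_eq0 setIUr setU_eq0. Qed.

Lemma adjSU A B Z : adjS e (A :|: B) Z = adjS e A Z || adjS e B Z.
Proof.
apply/adjSP/orP => [[x [y [/setUP[xA|xB] yZ xy]]]|[/adjSP|/adjSP] [x [y [xA yZ xy]]]].
- by left; apply/adjSP; exists x, y.
- by right; apply/adjSP; exists x, y.
- by exists x, y; rewrite inE xA.
- by exists x, y; rewrite inE xA orbT.
Qed.

Lemma model_merge V phi x y : x \in V -> y \in V -> model V phi -> radj phi x y ->
  model (V :\ y) (merge phi x y).
Proof.
move=> xV yV [cV dV] /andP[xy axy]; split.
  move=> z; rewrite !inE => /andP[zy zV]; rewrite /merge; case: eqP => _; last exact: cV.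
  by apply: connU => //; apply: cV.
move=> a b; rewrite !inE => /andP[ay aV] /andP[yb bV] ab; rewrite /merge.
case: (eqVneq a x) => [ax|ax]; case: (eqVneq b x) => [bx|bx].
- by rewrite ax bx eqxx in ab.
- by rewrite disjoint_sym disjointU !dV.
- by rewrite disjointU !dV.
- exact: dV.
Qed.

(** Contracting xy loses that edge and one further edge for each common neighbour; [edges2] counts
    every edge from both ends, hence the factor 2. *)
Lemma edges2_merge V phi x y : x \in V -> y \in V -> radj phi x y ->
  edges2 (radj phi) V <= edges2 (radj (merge phi x y)) (V :\ y) +
    2 * (#|[set z in V | radj phi x z && radj phi y z]|).+1.
Proof.
move=> xV yV xy; have nxy : x != y by case/andP: xy.
have xVy : x \in V :\ y by rewrite !inE nxy.
have rs := @radj_sym phi; have ri := @radj_irr phi.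
rewrite (edges2D1 rs ri yV) (edges2D1 rs ri xVy).
rewrite (edges2D1 (@radj_sym (merge phi x y)) (@radj_irr _) xVy).
set W := V :\ y :\ x.
have -> : edges2 (radj (merge phi x y)) W = edges2 (radj phi) W.
  apply: eq_edges2 => a b; rewrite !inE => /and3P[ax _ _] /and3P[bx _ _].
  by rewrite /radj /= /merge (negbTE ax) (negbTE bx).
have -> : degin (radj phi) (V :\ y) y = 1 + degin (radj phi) W y.
  by rewrite /degin (big_setD1 x) //= [radj phi y x]rs xy.
have H : degin (radj phi) W x + degin (radj phi) W y <=
    degin (radj (merge phi x y)) W x + #|[set z in V | radj phi x z && radj phi y z]|.
  rewrite /degin -big_split /=.
  apply: (@leq_trans (\sum_(z in W) (radj (merge phi x y) x z + (radj phi x z && radj phi y z)))).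
    apply: leq_sum => z; rewrite !inE => /and3P[zx zy zV].
    have -> : radj (merge phi x y) x z = radj phi x z || radj phi y z.
      rewrite /radj /= /merge eqxx (negbTE zx) adjSU eq_sym zx [y == z]eq_sym zy //.
    by case: (radj phi x z) (radj phi y z) => [] [].
  rewrite big_split /= leq_add2l -sum1_card big_mkcond [X in _ <= X]big_mkcond /=.
  apply: leq_sum => z _; rewrite !inE.
  by case: (z == x) (z == y) (z \in V) => [] [] [] //=; case: (_ && _).
lia.
Qed.

(** With Z adjacent to everything, an edge with three common neighbours would form a K_{3,3} from Z,
    its two ends and these neighbours. So every contraction loses at most 3 edges, which is 6 in the
    doubled count. *)
Lemma edges2_apex V phi Z : model V phi -> conn e Z ->
  {in V, forall x, [disjoint Z & phi x]} -> {in V, forall x, adjS e Z (phi x)} ->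
  edges2 (radj phi) V <= 6 * #|V|.
Proof.
elim/card_ind_set: V phi => V IH phi mV cZ dZ aZ.
have [/existsP[x /existsP[y /and4P[xV yV xy cn]]]|] := boolP [exists x, exists y,
  [&& x \in V, y \in V, radj phi x y & #|[set z in V | radj phi x z && radj phi y z]| <= 2]].
  have nxy : x != y by case/andP: xy.
  have lt : #|V :\ y| < #|V| by rewrite [X in _ < X](cardsD1 y) yV.
  have := IH _ lt (merge phi x y) (model_merge xV yV mV xy) cZ.
  have h1 : {in V :\ y, forall z, [disjoint Z & merge phi x y z]}.
    move=> z; rewrite !inE => /andP[_ zV]; rewrite /merge; case: eqP => _; last exact: dZ.
    by rewrite disjointU !dZ.
  have h2 : {in V :\ y, forall z, adjS e Z (merge phi x y z)}.
    move=> z; rewrite !inE => /andP[_ zV]; rewrite /merge; case: eqP => _; last exact: aZ.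
    by rewrite adjS_sym // adjSU adjS_sym // aZ.
  move=> /(_ h1 h2); have := edges2_merge xV yV xy.
  rewrite [#|V|](cardsD1 y) yV; lia.
move=> noe; suff -> : edges2 (radj phi) V = 0 by [].
apply: big1 => x xV; apply: big1 => y yV; apply/eqP; rewrite eqb0; apply/negP => xy.
move/existsP: noe; apply; exists x; apply/existsP; exists y; rewrite xV yV xy /=.
have nxy : x != y by case/andP: xy.
have [cV dV] := mV.
apply: (@common_neighbours_le2 _ _ phi Z (phi x) (phi y)).
- by split=> //; apply: cV.
- by split; [apply: dZ|apply: dZ|apply: dV].
- by move=> z; rewrite inE => /andP[zV _]; apply: cV.
- move=> z; rewrite inE => /and3P[zV /andP[xz _] /andP[yz _]].
  by split; [apply: dZ|apply: dV|apply: dV].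
- move=> z; rewrite inE => /and3P[zV /andP[_ xz] /andP[_ yz]].
  by split=> //; apply: aZ.
- by move=> a b; rewrite !inE => /andP[aV _] /andP[bV _]; apply: dV.
Qed.

(** If there is an edge at all, some edge has at most 6 common neighbours, and contracting it costs
    at most 7 edges. Otherwise the minor induced on the neighbourhood of a vertex x would have all
    degrees at least 7, against [edges2_apex] with [phi x] as the apex. *)
Lemma edges2_model V phi : model V phi -> edges2 (radj phi) V <= 14 * #|V|.
Proof.
elim/card_ind_set: V phi => V IH phi mV.
have [/existsP[x /existsP[y /and4P[xV yV xy cn]]]|] := boolP [exists x, exists y,
  [&& x \in V, y \in V, radj phi x y & #|[set z in V | radj phi x z && radj phi y z]| <= 6]].
  have lt : #|V :\ y| < #|V| by rewrite [X in _ < X](cardsD1 y) yV.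
  have := IH _ lt (merge phi x y) (model_merge xV yV mV xy).
  have := edges2_merge xV yV xy.
  rewrite [#|V|](cardsD1 y) yV; lia.
move=> noe; suff -> : edges2 (radj phi) V = 0 by [].
apply: big1 => x xV; apply: big1 => y yV; apply/eqP; rewrite eqb0; apply/negP => xy.
have [cV dV] := mV.
pose N := [set z in V | radj phi x z].
have yN : y \in N by rewrite inE yV.
have NV : N \subset V by apply/subsetP => z; rewrite inE => /andP[].
have : edges2 (radj phi) N <= 6 * #|N|.
  apply: (@edges2_apex N phi (phi x)); first exact: modelS mV.
  - exact: cV.
  - by move=> z; rewrite inE => /and3P[zV xz _]; apply: dV.
  - by move=> z; rewrite inE => /and3P[].
apply/negP; rewrite -ltnNge.
apply: (@leq_trans (\sum_(z in N) 7)).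
  have N0 : 0 < #|N| by apply/card_gt0P; exists y.
  by rewrite sum_nat_const; lia.
apply: leq_sum => z; rewrite inE => /andP[zV xz]; rewrite -card_degin.
move/existsPn: noe => /(_ x)/existsPn/(_ z); rewrite xV zV xz /= -ltnNge => h.
apply: leq_trans h _; apply: subset_leq_card; apply/subsetP => a.
by rewrite !inE => /and3P[-> -> ->].
Qed.

Lemma model_set1 V : model V (fun x => [set x]).
Proof.
split=> [x _|x y _ _ xy]; first exact: conn1.
by rewrite disjoints1 inE.
Qed.

Lemma adjS1 x y : adjS e [set x] [set y] = e x y.
Proof.
apply/adjSP/idP => [[a [b [/set1P-> /set1P->]]]//|xy].
by exists x, y; rewrite !inE.
Qed.

Lemma radj_set1 : radj (fun x => [set x]) =2 e.
Proof.
move=> x y; rewrite /radj /= adjS1; case: eqP => //= ->; by rewrite e_irr.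
Qed.

Lemma edges2_le V : edges2 e V <= 14 * #|V|.
Proof.
rewrite -(eq_edges2 (r := radj (fun x => [set x]))); first exact/edges2_model/model_set1.
by move=> x y _ _; exact: radj_set1.
Qed.

Lemma low_degree r V : edges2 r V <= 14 * #|V| -> V != set0 ->
  exists2 x, x \in V & degin r V x <= 14.
Proof.
move=> le V0; apply/exists_inP; apply: contraTT le => /exists_inPn H.
rewrite -ltnNge mulnC -sum_nat_const.
have /set0Pn[x xV] := V0.
rewrite /edges2 (big_setD1 x) //= [X in _ < X](big_setD1 x) //=.
rewrite -addSn leq_add //; first by rewrite ltnNge H.
by apply: leq_sum => y; rewrite inE => /andP[_ yV]; apply: ltnW; rewrite ltnNge H.
Qed.

(** Greedy removal of a vertex of degree at most 14: it receives rank 0 and the ranks of the others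
    are shifted up, so its neighbours of higher rank are exactly those still present. *)
Lemma degenerate_rank : exists rk : T -> nat, injective rk /\
  forall x, #|[set y | e x y && (rk x < rk y)]| <= 14.
Proof.
suff [rk [inj out]] : exists rk : T -> nat, {in setT &, injective rk} /\
    {in setT, forall x, #|[set y in setT | e x y && (rk x < rk y)]| <= 14}.
  exists rk; split=> [x y|x]; first by apply: inj.
  by apply: leq_trans (out x _) => //; rewrite subset_leq_card //; apply/subsetP => y; rewrite !inE.
elim/card_ind_set: [set: T] => V IH.
have [->|V0] := eqVneq V set0.
  by exists (fun=> 0); split=> [x y|x]; rewrite inE.
have [x xV dx] := low_degree (edges2_le V) V0.
have lt : #|V :\ x| < #|V| by rewrite [X in _ < X](cardsD1 x) xV.
have [rk [inj out]] := IH _ lt.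
exists (fun y => if y == x then 0 else (rk y).+1); split.
  move=> a b aV bV; case: (eqVneq a x) => [->|ax]; case: (eqVneq b x) => [->|bx] //.
  by case=> ab; apply: inj => //; rewrite !inE ?ax ?bx.
move=> a aV; case: (eqVneq a x) => [->|ax].
  apply: leq_trans dx; rewrite -card_degin subset_leq_card //.
  by apply/subsetP => y; rewrite !inE => /and3P[-> ->].
apply: leq_trans (out a _); last by rewrite !inE ax.
apply: subset_leq_card; apply/subsetP => y; rewrite !inE.
by case: (eqVneq y x) => [->|yx] /=; rewrite ?ltn0 ?andbF.
Qed.

End K33.
End DegeneracyFacts.

(** * Few vertices have three neighbours in a given set *)

Module AttachmentFacts.
From mathcomp Require Import all_boot all_order all_algebra.
From mathcomp Require Import ring lra zify.
Import HalfPlaneFacts MinorsFacts DegeneracyFacts.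

Section Attached.
Variables (T : finType) (e : rel T).
Hypothesis e_sym : symmetric e.
Hypothesis e_irr : irreflexive e.
Hypothesis e_k33 : k33_minor_free e.
Implicit Types (A B U V W Z : {set T}) (x y z w b : T) (phi : T -> {set T}).

Definition touched phi B w := [set b in B | adjS e (phi b) [set w]].

Lemma leq_degin_sub (r r' : rel T) V x :
  (forall y, y \in V -> r x y -> r' x y) -> degin r V x <= degin r' V x.
Proof.
move=> H; apply: leq_sum => y yV; have := H y yV.
by case: (r x y) => // ->.
Qed.

Lemma attached_to_triangles B phi W : model e B phi ->
  (forall w b, w \in W -> b \in B -> w \notin phi b) ->
  (forall w, w \in W -> 2 < #|touched phi B w|) ->
  (forall w, w \in W -> {in touched phi B w &, forall b b', b != b' -> radj e phi b b'}) ->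
  #|W| <= 392 * #|B|.
Proof.
elim/card_ind_set: B phi W => B IH phi W mB out ge3 tri.
have [B0|B0] := eqVneq B set0.
  have [->|/set0Pn[w /ge3]] := eqVneq W set0; first by rewrite cards0.
  by case/card_gt2P=> b [? [? [[]]]]; rewrite inE B0 inE.
have [b bB db] := low_degree (edges2_model e_sym e_k33 mB) B0.
have [cB dB] := mB.
pose N := [set b' in B | radj e phi b b'].
have N14 : #|N| <= 14 by rewrite card_degin.
pose Wb := [set w in W | adjS e (phi b) [set w]].
have Wb_le : #|Wb| <= 392.
  pose P w b' b'' := [&& b' != b'', adjS e (phi b') [set w] & adjS e (phi b'') [set w]].
  apply: (@leq_trans (\sum_(w in Wb) \sum_(b' in N) \sum_(b'' in N) P w b' b'')).
    rewrite -sum1_card; apply: leq_sum => w; rewrite inE => /andP[wW wb].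
    have bt : b \in touched phi B w by rewrite inE bB.
    have : 1 < #|touched phi B w :\ b|.
      by have := ge3 w wW; rewrite (cardsD1 b) bt.
    case/card_gt1P => b1 [b2 []]; rewrite !inE => /and3P[n1 b1B a1] /and3P[n2 b2B a2] n12.
    have bN b' : b' != b -> b' \in B -> adjS e (phi b') [set w] -> b' \in N.
      move=> n bB' a; rewrite inE bB'; apply: (tri w) => //; last by rewrite eq_sym.
      by rewrite inE bB'.
    rewrite (big_setD1 b1) ?bN //=.
    by rewrite (big_setD1 b2) ?bN //= /P n12 a1 a2.
  rewrite exchange_big /=.
  apply: (@leq_trans (\sum_(b' in N) \sum_(b'' in N) 2)).
    apply: leq_sum => b'; rewrite inE => /and3P[b'B n' _].
    rewrite exchange_big /=; apply: leq_sum => b''; rewrite inE => /and3P[b''B n'' _].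
    have [->|n] := eqVneq b' b''; first by rewrite big1 // => w _; rewrite /P eqxx.
    apply: (@leq_trans #|[set w in Wb | P w b' b'']|).
      rewrite -sum1_card big_mkcond [X in _ <= X]big_mkcond; apply: leq_sum => w _.
      by rewrite inE; case: (w \in Wb) (P _ _ _) => [] [].
    apply: (@common_neighbours_le2 _ _ e_k33 _ _ (fun w => [set w]) (phi b) (phi b') (phi b'')).
    - by split; apply: cB.
    - by split; apply: dB.
    - by move=> w _; apply: conn1.
    - move=> w; rewrite inE => /andP[]; rewrite inE => /andP[wW _] _.
      by split; rewrite disjoint_sym disjoints1; apply: out.
    - by move=> w; rewrite !inE => /and3P[/andP[_ a] _ /andP[]].
    - by move=> w w' _ _ ww'; rewrite disjoints1 inE.
  rewrite !sum_nat_const; have := leq_mul N14 N14; lia.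
have lt : #|B :\ b| < #|B| by rewrite [X in _ < X](cardsD1 b) bB.
have : #|W :\: Wb| <= 392 * #|B :\ b|.
  have tE w : w \in W :\: Wb -> touched phi (B :\ b) w = touched phi B w.
    rewrite !inE => /andP[+ wW]; rewrite wW /= => na; apply/setP => b'; rewrite !inE.
    by case: eqP => [->|_] /=; rewrite ?(negbTE na) ?andbF.
  apply: (IH _ lt phi).
  - by apply: modelS mB; exact: subD1set.
  - by move=> w b'; rewrite !inE => /andP[_ wW] /andP[_ ?]; apply: out.
  - by move=> w wW; rewrite tE //; apply: ge3; move: wW; rewrite inE => /andP[].
  - by move=> w wW; rewrite tE //; apply: tri; move: wW; rewrite inE => /andP[].
rewrite [#|B|](cardsD1 b) bB; have := cardsID Wb W.
have : #|W :&: Wb| <= #|Wb| by rewrite subset_leq_card // subsetIr.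
lia.
Qed.

(** A potential argument. While some w touches nonadjacent [b1] and [b2], absorbing w into the
    branch set of [b1] creates a new edge: the doubled edge count gains at least 2 when W loses one
    vertex. When no such w is left, all touched sets are cliques, and 2 * 392 + 14 = 798. *)
Lemma attached_le B phi W : model e B phi ->
  (forall w b, w \in W -> b \in B -> w \notin phi b) ->
  (forall w, w \in W -> 2 < #|touched phi B w|) ->
  2 * #|W| + edges2 (radj e phi) B <= 798 * #|B|.
Proof.
move: W B phi; elim/card_ind_set => W IH B phi mB out ge3.
have [cB dB] := mB.
have [/exists_inP[w wW /exists_inP[b1 t1 /exists_inP[b2 t2 /andP[n12 nr]]]]|tri] :=
  boolP [exists w in W, [exists b1 in touched phi B w, [exists b2 in touched phi B w,
     (b1 != b2) && ~~ radj e phi b1 b2]]]; last first.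
  have : #|W| <= 392 * #|B|.
    apply: (attached_to_triangles mB) => // w wW b b' bt b't n.
    apply: contraNT tri => nr; apply/exists_inP; exists w => //.
    by apply/exists_inP; exists b => //; apply/exists_inP; exists b' => //; rewrite n nr.
  by have := edges2_model e_sym e_k33 mB; lia.
move: t1 t2; rewrite !inE => /andP[b1B a1] /andP[b2B a2].
pose phi' b := if b == b1 then phi b1 :|: [set w] else phi b.
have sub b : phi b \subset phi' b.
  by rewrite /phi'; case: eqP => [->|_] //; exact: subsetUl.
have lt : #|W :\ w| < #|W| by rewrite [X in _ < X](cardsD1 w) wW.
have mB' : model e B phi'.
  split=> [b bB|b b' bB b'B bb']; rewrite /phi'.
    by case: eqP => _; [apply: connU => //; [apply: cB|apply: conn1]|apply: cB].
  case: (eqVneq b b1) => [E|_]; case: (eqVneq b' b1) => [E'|_].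
  - by rewrite E E' eqxx in bb'.
  - by rewrite disjoint_sym disjointU dB 1?eq_sym -?E // disjoint_sym disjoints1 out.
  - by rewrite disjointU dB -?E' // disjoint_sym disjoints1 out.
  - exact: dB.
have := IH _ lt B phi' mB'.
have h1 : forall w' b, w' \in W :\ w -> b \in B -> w' \notin phi' b.
  move=> w' b; rewrite !inE => /andP[n w'W] bB; rewrite /phi'; case: eqP => _; last exact: out.
  by rewrite !inE negb_or out.
have h2 : forall w', w' \in W :\ w -> 2 < #|touched phi' B w'|.
  move=> w'; rewrite !inE => /andP[n w'W]; apply: leq_trans (ge3 w' w'W) _.
  apply: subset_leq_card; apply/subsetP => b; rewrite !inE => /andP[-> a] /=.
  by apply: adjSS a.
move=> /(_ h1 h2).
have rs := @radj_sym _ _ e_sym; have ri := @radj_irr _ e.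
rewrite (edges2D1 (rs phi) (ri phi) b1B) (edges2D1 (rs phi') (ri phi') b1B).
have -> : edges2 (radj e phi') (B :\ b1) = edges2 (radj e phi) (B :\ b1).
  apply: eq_edges2 => x y; rewrite !inE => /andP[xb _] /andP[yb _].
  by rewrite /radj /= /phi' (negbTE xb) (negbTE yb).
have : degin (radj e phi) (B :\ b1) b1 < degin (radj e phi') (B :\ b1) b1.
  have b2D : b2 \in B :\ b1 by rewrite !inE eq_sym n12.
  rewrite /degin (big_setD1 b2) //= [X in _ < X](big_setD1 b2) //=.
  rewrite (negbTE nr) add0n.
  have -> : radj e phi' b1 b2.
    rewrite /radj /= n12 /phi' eqxx eq_sym (negbTE n12) adjSU.
    by rewrite [X in _ || X]adjS_sym // a2 orbT.
  rewrite ltnS; apply: leq_degin_sub => y _ /andP[n a]; rewrite /radj /= n.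
  exact: adjSS a.
rewrite [#|W|](cardsD1 w) wW; lia.
Qed.

Lemma three_neighbours_le B :
  #|[set x | (x \notin B) && (2 < #|[set b in B | e x b]|)]| <= 399 * #|B|.
Proof.
set W := [set _ | _].
have := @attached_le B (fun b => [set b]) W (model_set1 e B).
have h1 : forall w b, w \in W -> b \in B -> w \notin [set b].
  by move=> w b; rewrite !inE => /andP[wB _] bB; apply: contraNneq wB => ->.
have h2 : forall w, w \in W -> 2 < #|touched (fun b => [set b]) B w|.
  move=> w; rewrite inE => /andP[_ h]; apply: leq_trans h _.
  apply: subset_leq_card; apply/subsetP => b; rewrite !inE => /andP[-> wb].
  by rewrite adjS1 e_sym.
by move=> /(_ h1 h2); lia.
Qed.

End Attached.
End AttachmentFacts.

(** * The bundle of vertices hanging on a pair of hubs *)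

Module BundlesFacts.
From mathcomp Require Import all_boot all_order all_algebra.
From mathcomp Require Import ring lra zify.
Import HalfPlaneFacts MinorsFacts DegeneracyFacts AttachmentFacts.

Section Bundles.
Variables (T : finType) (e : rel T).
Hypothesis e_sym : symmetric e.
Hypothesis e_irr : irreflexive e.
Hypothesis e_k33 : k33_minor_free e.
Implicit Types (A B P Q U V W Z : {set T}) (x y z w u v p q : T) (phi : T -> {set T}).

Definition edges_between (r : rel T) P Q : nat := \sum_(x in P) \sum_(y in Q) r x y.

Lemma eq_edges_between (r r' : rel T) P Q :
  (forall x y, x \in P -> y \in Q -> r x y = r' x y) -> edges_between r P Q = edges_between r' P Q.
Proof. by move=> H; apply: eq_bigr => x xP; apply: eq_bigr => y yQ; rewrite H. Qed.

Lemma edges_between_sym (r : rel T) P Q : symmetric r ->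
  edges_between r P Q = edges_between r Q P.
Proof.
move=> sr; rewrite /edges_between exchange_big.
by apply: eq_bigr => x _; apply: eq_bigr => y _; rewrite sr.
Qed.

Lemma edges_betweenU1l (r : rel T) x P Q : x \notin P ->
  edges_between r (x |: P) Q = degin r Q x + edges_between r P Q.
Proof. by move=> xP; rewrite /edges_between big_setU1. Qed.

Lemma edges_betweenU1r (r : rel T) y P Q : symmetric r -> y \notin Q ->
  edges_between r P (y |: Q) = degin r P y + edges_between r P Q.
Proof.
by move=> sr yQ; rewrite edges_between_sym // edges_betweenU1l // [in RHS]edges_between_sym.
Qed.

(** For hubs u and v, the set A holds vertices joined to both, P those joined to u and Q those
    joined to v. An edge inside A is counted twice since it leads from u to v in both directions;
    the other edges lead across in one way only. *)
Definition bundle_weight (r : rel T) A P Q : nat :=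
  edges_between r A A + edges_between r A Q + edges_between r P A + edges_between r P Q.

Lemma degin_bundle_le2 phi A V u v x : model e V phi -> u != v -> A \subset V -> x \in V ->
  {in V, forall x, u \notin phi x /\ v \notin phi x} ->
  {in A, forall x, adjS e [set u] (phi x) && adjS e [set v] (phi x)} ->
  degin (radj e phi) A x <= 2.
Proof.
move=> [cV dV] uv /subsetP AV xV out touch; rewrite -card_degin.
have o z : z \in V -> [disjoint [set u] & phi z] /\ [disjoint [set v] & phi z].
  by move=> /out[uz vz]; rewrite !disjoints1.
apply: (@common_neighbours_le2 _ _ e_k33 _ _ phi [set u] [set v] (phi x)).
- by split; [apply: conn1|apply: conn1|apply: cV].
- by have [? ?] := o x xV; split=> //; rewrite disjoints1 inE.
- by move=> z; rewrite inE => /andP[/AV zV _]; apply: cV.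
- move=> z; rewrite inE => /and3P[/AV zV xz _]; have [? ?] := o z zV; split=> //; exact: dV.
- by move=> z; rewrite inE => /and3P[/touch/andP[? ?] _ ?].
- by move=> a b; rewrite !inE => /andP[/AV aV _] /andP[/AV bV _]; apply: dV.
Qed.

(** Induction by contracting an edge between P and Q. The new branch set touches both hubs and moves
    to A, where its edges count at least as much as those of its two parts did; only the contracted
    edge is lost, while the right side drops by 2. Once P and Q are not joined, each vertex has at
    most 2 neighbours in A, since three of them would form a K_{3,3} with u, v and that vertex. *)
Lemma bundle_weight_le phi A P Q u v : model e (A :|: P :|: Q) phi -> u != v ->
  [disjoint A & P] -> [disjoint A & Q] -> [disjoint P & Q] ->
  {in A :|: P :|: Q, forall x, u \notin phi x /\ v \notin phi x} ->
  {in A, forall x, adjS e [set u] (phi x) && adjS e [set v] (phi x)} ->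
  {in P, forall x, adjS e [set u] (phi x)} ->
  {in Q, forall x, adjS e [set v] (phi x)} ->
  bundle_weight (radj e phi) A P Q <= 2 * (#|A| + #|P| + #|Q|).
Proof.
move: P A Q phi; elim/card_ind_set => P IH A Q phi mV uv dAP dAQ dPQ out tA tP tQ.
have rs ph := @radj_sym _ _ e_sym ph.
have [/exists_inP[p pP /exists_inP[q qQ pq]]|none] :=
  boolP [exists p in P, [exists q in Q, radj e phi p q]]; last first.
  have E0 : edges_between (radj e phi) P Q = 0.
    apply: big1 => p pP; apply: big1 => q qQ; apply/eqP; rewrite eqb0.
    by apply: contra none => pq; apply/exists_inP; exists p => //; apply/exists_inP; exists q.
  have H (X : {set T}) : X \subset A :|: P :|: Q -> edges_between (radj e phi) X A <= 2 * #|X|.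
    move=> /subsetP sX; rewrite mulnC -sum_nat_const; apply: leq_sum => x xX.
    apply: (degin_bundle_le2 mV uv) => //; last exact: sX.
    by rewrite -setUA subsetUl.
  rewrite /bundle_weight E0 addn0 (edges_between_sym A Q (rs phi)).
  have := H A; have := H P; have := H Q.
  rewrite subsetUr -setUA subsetUl setUCA subsetUl => /(_ isT) h1 /(_ isT) h2 /(_ isT) h3.
  lia.
have npq : p != q by case/andP: pq.
have pA : p \notin A by rewrite (disjointFl dAP pP).
have qA : q \notin A by rewrite (disjointFl dAQ qQ).
have pQ : p \notin Q by rewrite (disjointFr dPQ pP).
have qP : q \notin P by rewrite (disjointFl dPQ qQ).
have lt : #|P :\ p| < #|P| by rewrite [X in _ < X](cardsD1 p) pP.
have pV : p \in A :|: P :|: Q by rewrite !inE pP orbT.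
have qV : q \in A :|: P :|: Q by rewrite !inE qQ orbT.
pose phi' := merge phi p q.
have EV : (p |: A) :|: (P :\ p) :|: (Q :\ q) = (A :|: P :|: Q) :\ q.
  apply/setP => z; rewrite !inE; case: (eqVneq z p) => [->|zp] /=.
    by rewrite npq pP orbT.
  case: (eqVneq z q) => [->|zq] //=; by rewrite (negbTE qA) (negbTE qP).
have off z : z != p -> phi' z = phi z by rewrite /phi' /merge => /negbTE->.
have on : phi' p = phi p :|: phi q by rewrite /phi' /merge eqxx.
have := IH _ lt (p |: A) (Q :\ q) phi'.
rewrite EV => /(_ (model_merge e_sym pV qV mV pq) uv).
have h1 : [disjoint p |: A & P :\ p].
  rewrite disjoint_sym disjointU disjoint_sym disjoints1 !inE eqxx /= disjoint_sym.
  by apply: disjointWr dAP; exact: subD1set.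
have h2 : [disjoint p |: A & Q :\ q].
  rewrite disjoint_sym disjointU disjoint_sym disjoints1 !inE (negbTE pQ) andbF /= disjoint_sym.
  by apply: disjointWr dAQ; exact: subD1set.
have h3 : [disjoint P :\ p & Q :\ q].
  by apply: disjointWl (subD1set _ _) _; apply: disjointWr dPQ; exact: subD1set.
have h4 : {in (A :|: P :|: Q) :\ q, forall x, u \notin phi' x /\ v \notin phi' x}.
  move=> z /setD1P[zq zV]; case: (eqVneq z p) => [->|zp]; last by rewrite off //; apply: out.
  have [? ?] := out p pV; have [? ?] := out q qV.
  by rewrite on !inE !negb_or; split; apply/andP.
have h5 : {in p |: A, forall x, adjS e [set u] (phi' x) && adjS e [set v] (phi' x)}.
  move=> z /setU1P[->|zA]; last by rewrite off ?tA //; apply: contraNneq pA => <-.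
  rewrite on; apply/andP; split.
    by apply: adjSS (tP p pP); rewrite ?subsetUl.
  by apply: adjSS (tQ q qQ); rewrite ?subsetUr.
have h6 : {in P :\ p, forall x, adjS e [set u] (phi' x)}.
  by move=> z /setD1P[zp zP]; rewrite off // tP.
have h7 : {in Q :\ q, forall x, adjS e [set v] (phi' x)}.
  move=> z /setD1P[zp zQ]; rewrite off ?tQ //; by apply: contraNneq pQ => <-.
move=> /(_ h1 h2 h3 h4 h5 h6 h7).
have -> : #|p |: A| = #|A|.+1 by rewrite cardsU1 pA.
rewrite [#|P|](cardsD1 p) pP [#|Q|](cardsD1 q) qQ.
suff : bundle_weight (radj e phi) A P Q <=
       (bundle_weight (radj e phi') (p |: A) (P :\ p) (Q :\ q)).+1.
  move: (bundle_weight _ _ _ _) (bundle_weight _ _ _ _) #|A| #|_ :\ _| #|_ :\ _| => a b c d n.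
  by clear; lia.
rewrite -{1}(setD1K pP) -{1}(setD1K qQ).
set P' := P :\ p; set Q' := Q :\ q.
have pP' : p \notin P' by rewrite !inE eqxx.
have qQ' : q \notin Q' by rewrite !inE eqxx.
have qP' : q \notin P' by rewrite !inE negb_and qP orbT.
have pQ' : p \notin Q' by rewrite !inE negb_and pQ orbT.
rewrite /bundle_weight !(edges_betweenU1l, edges_betweenU1r) //; try exact: radj_sym.
have rE x y : x != p -> y != p -> radj e phi' x y = radj e phi x y.
  by move=> xp yp; rewrite /radj /= !off.
have ne (X : {set T}) z y : z \notin X -> y \in X -> y != z by move=> zX yX; apply: contraNneq zX => <-.
have -> : edges_between (radj e phi') A A = edges_between (radj e phi) A A.
  by apply: eq_edges_between => x y xX yX; rewrite rE //; apply: ne pA _.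
have -> : edges_between (radj e phi') A Q' = edges_between (radj e phi) A Q'.
  by apply: eq_edges_between => x y xX yX; rewrite rE //; [apply: ne pA _|apply: ne pQ' _].
have -> : edges_between (radj e phi') P' A = edges_between (radj e phi) P' A.
  by apply: eq_edges_between => x y xX yX; rewrite rE //; [apply: ne pP' _|apply: ne pA _].
have -> : edges_between (radj e phi') P' Q' = edges_between (radj e phi) P' Q'.
  by apply: eq_edges_between => x y xX yX; rewrite rE //; [apply: ne pP' _|apply: ne pQ' _].
have r1 (X : {set T}) : p \notin X -> q \notin X -> degin (radj e phi) X p <= degin (radj e phi') X p.
  move=> pX qX; apply: leq_degin_sub => y yX /andP[_ a].
  rewrite /radj /= eq_sym (ne X) //= on (off y) ?(ne X) // adjSU //.
  by rewrite a.
have r2 (X : {set T}) : p \notin X -> q \notin X -> degin (radj e phi) X q <= degin (radj e phi') X p.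
  move=> pX qX; apply: leq_sum => y yX.
  case r : (radj e phi q y) => //; move/andP: r => [_ a].
  by rewrite /radj /= eq_sym (ne X) //= on (off y) ?(ne X) // adjSU // a orbT.
have e1 : degin (radj e phi) (q |: Q') p = 1 + degin (radj e phi) Q' p.
  by rewrite /degin big_setU1 //= pq.
have e2 : degin (radj e phi') (p |: A) p = degin (radj e phi') A p.
  by rewrite /degin big_setU1 //= radj_irr.
rewrite ?e1 ?e2.
have := r1 A pA qA; have := r2 A pA qA; have := r1 Q' pQ' qQ'; have := r2 P' pP' qP'.
do ?move: (degin _ _ _) => ?; do ?move: (edges_between _ _ _) => ?; clear; lia.
Qed.
End Bundles.
End BundlesFacts.

(** * Exceptional vertices attached to three hubs *)

Module FewNeighboursFacts.
From mathcomp Require Import all_boot all_order all_algebra.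
From mathcomp Require Import ring lra zify.
Import HalfPlaneFacts MinorsFacts DegeneracyFacts AttachmentFacts BundlesFacts.

Section Counting.
Variables (T T' : finType).
Implicit Types (R X B : {set T}) (x y z : T).

Lemma leq_card_triples X B (R : T -> T -> T -> {set T}) k :
  (forall x, x \in X -> exists u v w, [/\ u \in B, v \in B, w \in B & x \in R u v w]) ->
  (forall u v w, u \in B -> v \in B -> w \in B -> #|R u v w| <= k) ->
  #|X| <= k * #|B| ^ 3.
Proof.
move=> HX HR.
apply: (@leq_trans (\sum_(u in B) \sum_(v in B) \sum_(w in B) #|R u v w|)); last first.
  apply: (@leq_trans (\sum_(u in B) \sum_(v in B) \sum_(w in B) k)).
    by do 3 (apply: leq_sum => ? ?); apply: HR.
  by rewrite !sum_nat_const !expnS expn0 muln1 !mulnA mulnC !mulnA.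
apply: (@leq_trans #|\bigcup_(u in B) \bigcup_(v in B) \bigcup_(w in B) R u v w|).
  apply: subset_leq_card; apply/subsetP => x /HX[u [v [w [uB vB wB xR]]]].
  by apply/bigcupP; exists u => //; apply/bigcupP; exists v => //; apply/bigcupP; exists w.
have cup (F : T -> {set T}) : #|\bigcup_(u in B) F u| <= \sum_(u in B) #|F u|.
  elim/big_rec2: _ => [|u X' n _ IH]; first by rewrite cards0.
  by apply: leq_trans (leq_card_setU _ _) _; rewrite leq_add2l.
apply: leq_trans (cup _) _; apply: leq_sum => u _.
apply: leq_trans (cup _) _; apply: leq_sum => v _.
exact: cup.
Qed.

Lemma leq_card_fibres (f : T -> T') R k :
  (forall y : T', #|[set x in R | f x == y]| <= k) -> #|R| <= k * #|f @: R|.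
Proof.
move=> H; rewrite -sum1_card (partition_big_imset f) /= mulnC -sum_nat_const.
apply: leq_sum => y _; apply: leq_trans (H y).
by rewrite -sum1_card; apply/eq_leq/eq_bigl => x; rewrite inE.
Qed.

Lemma greedy3 R (conf : rel T) k : (forall x, x \in R -> conf x x) ->
  (forall x, x \in R -> #|[set y in R | conf x y]| <= k) -> 2 * k < #|R| ->
  exists x y z, [/\ x \in R, y \in R & z \in R] /\
    [/\ ~~ conf x y, ~~ conf x z & ~~ conf y z].
Proof.
move=> cR Hk lt.
have ex X : #|X| < #|R| -> exists2 z, z \in R & z \notin X.
  move=> h; apply/subsetPn; apply: contraL h => /subset_leq_card; by rewrite -leqNgt.
have [x xR _] : exists2 z, z \in R & z \notin set0 by apply: ex; rewrite cards0; lia.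
have hx := Hk x xR.
have [y yR] := ex [set y in R | conf x y] ltac:(lia).
rewrite inE yR /= => xy; have hy := Hk y yR.
have [z zR] := ex ([set z in R | conf x z] :|: [set z in R | conf y z])
  ltac:(apply: leq_ltn_trans (leq_card_setU _ _) _; lia).
rewrite !inE zR /= negb_or => /andP[xz yz].
by exists x, y, z.
Qed.
End Counting.

Section Exceptional.
Variables (T : finType) (e : rel T).
Hypothesis e_sym : symmetric e.
Hypothesis e_irr : irreflexive e.
Hypothesis e_k33 : k33_minor_free e.
Implicit Types (A P Q R U V W Z : {set T}) (x y z w u v p q : T).

(** Only members with different f-values need disjoint branch sets, since one representative of each
    of three values already gives the K_{3,3}. *)
Lemma image_common_le2 (I J : finType) (R : {set I}) (f : I -> J) (Z : I -> {set T}) U1 U2 U3 :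
  [/\ conn e U1, conn e U2 & conn e U3] ->
  [/\ [disjoint U1 & U2], [disjoint U1 & U3] & [disjoint U2 & U3]] ->
  (forall i, i \in R -> conn e (Z i)) ->
  (forall i, i \in R -> [/\ [disjoint U1 & Z i], [disjoint U2 & Z i] & [disjoint U3 & Z i]]) ->
  (forall i, i \in R -> [/\ adjS e U1 (Z i), adjS e U2 (Z i) & adjS e U3 (Z i)]) ->
  {in R &, forall i j, f i != f j -> [disjoint Z i & Z j]} ->
  #|f @: R| <= 2.
Proof.
move=> cU dU cZ dZ aZ dZZ; rewrite leqNgt; apply/negP => /card_gt2P.
move=> [_ [_ [_ [[/imsetP[x xR ->] /imsetP[y yR ->] /imsetP[z zR ->]] [xy yz zx]]]]].
pose F := [set x; y; z].
have FR i : i \in F -> i \in R by rewrite !inE -orbA => /or3P[]/eqP->.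
have Ff : {in F &, forall i j, i != j -> f i != f j}.
  move=> i j; rewrite !inE -!orbA => /or3P[]/eqP-> /or3P[]/eqP->; rewrite ?eqxx // => _ //;
    by rewrite eq_sym.
have : #|F| <= 2.
  apply: (@common_neighbours_le2 _ _ e_k33 _ _ Z U1 U2 U3) => //.
  - by move=> i /FR; apply: cZ.
  - by move=> i /FR; apply: dZ.
  - by move=> i /FR; apply: aZ.
  - by move=> i j iF jF ij; apply: dZZ; rewrite ?FR // Ff.
rewrite /F setUC cardsU1 !inE negb_or cards2.
have -> : z != x by apply: contraNneq zx => ->.
have -> : z != y by apply: contraNneq yz => ->.
by have -> : x != y by apply: contraNneq xy => ->.
Qed.

Lemma disjoint1 x y : x != y -> [disjoint [set x] & [set y]].
Proof. by rewrite disjoints1 inE. Qed.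

Lemma adjS1l x y Z : y \in Z -> e x y -> adjS e [set x] Z.
Proof. by move=> yZ xy; apply/adjSP; exists x, y; rewrite inE. Qed.

Lemma conn2 x y : e x y -> conn e [set x; y].
Proof. by move=> xy; apply: connU; rewrite ?adjS1 //; exact: conn1. Qed.

Variables (B0 B1 : {set T}).
Hypothesis sB01 : B0 \subset B1.
Definition nbrs (B : {set T}) x := [set b in B | e x b].

Lemma nbrs_le2_fibre p q w R : p != q -> p != w -> q != w ->
  (forall x, x \in R -> [/\ e p x, e q x & e w x]) -> #|R| <= 2.
Proof.
move=> pq pw qw H.
apply: (@common_neighbours_le2 _ _ e_k33 _ _ (fun x => [set x]) [set p] [set q] [set w]).
- by split; apply: conn1.
- by split; apply: disjoint1.
- by move=> x _; apply: conn1.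
- move=> x /H[a b c]; split; apply: disjoint1.
  + by apply: contraTneq a => ->; rewrite e_irr.
  + by apply: contraTneq b => ->; rewrite e_irr.
  + by apply: contraTneq c => ->; rewrite e_irr.
- by move=> x /H[a b c]; rewrite !adjS1.
- by move=> x y _ _; apply: disjoint1.
Qed.

Lemma many_nbrs_le : #|[set x | (x \notin B1) && (2 < #|nbrs B1 x|)]| <= 2 * #|B1| ^ 3.
Proof.
pose R u v w := if [&& u != v, v != w & w != u] then [set x | [&& e u x, e v x & e w x]] else set0.
apply: (leq_card_triples (R := R)).
  move=> x; rewrite inE => /andP[_ /card_gt2P[u [v [w [[]]]]]].
  rewrite !inE => /andP[uB xu] /andP[vB xv] /andP[wB xw] [uv vw wu].
  by exists u, v, w; rewrite uB vB wB /R uv vw wu inE e_sym xu e_sym xv e_sym.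
move=> u v w _ _ _; rewrite /R; case: ifP => [/and3P[uv vw wu]|_]; last by rewrite cards0.
apply: (nbrs_le2_fibre (p := u) (q := v) (w := w)) => //; first by rewrite eq_sym.
by move=> x; rewrite inE => /and3P[].
Qed.

Definition exc2 p q v := [set x | [&& x \notin B1, nbrs B1 x == [set p; q] &
  [exists w, [&& w \notin B1, e x w & e w v]]]].

(** Let [f x] be a chosen neighbour of x outside [B1] that is joined to v. At most 2 vertices share
    a value w, by K_{3,3}-freeness with p, q, w. At most 2 values occur, because the sets made of x
    and [f x] touch p, q and v; they are disjoint since v is joined to every [f x] but to no x. *)
Lemma exc2_le p q v : p \in B1 -> q \in B1 -> v \in B1 -> p != q -> v \notin [set p; q] ->
  #|exc2 p q v| <= 4.
Proof.
move=> pB qB vB pq; rewrite !inE negb_or => /andP[vp vq].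
pose f x := odflt x [pick w | [&& w \notin B1, e x w & e w v]].
have fP x : x \in exc2 p q v -> [/\ f x \notin B1, e x (f x) & e (f x) v].
  rewrite inE => /and3P[_ _ /existsP[w Hw]]; rewrite /f.
  by case: pickP => [w' /and3P[]|/(_ w)]; rewrite ?Hw.
have xP x : x \in exc2 p q v -> [/\ x \notin B1, e p x, e q x & ~~ e v x].
  rewrite inE => /and3P[xB /eqP N _]; split=> //.
  - by have := set21 p q; rewrite -N inE e_sym => /andP[].
  - by have := set22 p q; rewrite -N inE e_sym => /andP[].
  - have : v \notin [set p; q] by rewrite !inE negb_or vp.
    by rewrite -N inE vB e_sym.
have nB b x : b \in B1 -> x \notin B1 -> b != x by move=> bB; apply: contraNneq => <-.
apply: (@leq_trans (2 * #|f @: exc2 p q v|)).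
  apply: leq_card_fibres => w.
  have [->|/set0Pn[x0]] := eqVneq [set x in exc2 p q v | f x == w] set0; first by rewrite cards0.
  rewrite inE => /andP[x0E /eqP fx0]; have [wB _ _] := fP _ x0E; rewrite fx0 in wB.
  apply: (nbrs_le2_fibre (p := p) (q := q) (w := w)) => //; try exact: nB.
  move=> x; rewrite inE => /andP[xE /eqP fx]; have [_ ? ? _] := xP x xE.
  by have [_ xf _] := fP x xE; rewrite -fx e_sym; split=> //; rewrite e_sym.
rewrite (leq_mul (n1 := 2) (n2 := 2)) //.
apply: (image_common_le2 (Z := fun x => [set x; f x]) (U1 := [set p]) (U2 := [set q]) (U3 := [set v])).
- by split; apply: conn1.
- by split; apply: disjoint1 => //; rewrite eq_sym.
- by move=> x /fP[_ ? _]; apply: conn2.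
- move=> x xE; have [xB _ _ _] := xP x xE; have [fB _ _] := fP x xE.
  by split; rewrite disjoints1 !inE negb_or !nB.
- move=> x xE; have [_ px qx _] := xP x xE; have [_ _ fv] := fP x xE.
  split; [apply: adjS1l px|apply: adjS1l qx|apply: (adjS1l (y := f x))];
    rewrite ?inE ?eqxx ?orbT //; by rewrite e_sym.
- move=> x y xE yE fxy; have [_ _ _ vx] := xP x xE; have [_ _ _ vy] := xP y yE.
  have [_ _ fxv] := fP x xE; have [_ _ fyv] := fP y yE.
  rewrite disjointU ![[disjoint [set _; _] & _]]disjoint_sym !disjoints1 !inE !negb_or.
  rewrite [f y == f x]eq_sym fxy andbT.
  have -> : y != x by apply: contraNneq fxy => ->.
  have -> : f y != x by apply: contraTneq fyv => ->; rewrite e_sym.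
  by rewrite /= andbT; apply: contraTneq fxv => <-; rewrite e_sym.
Qed.

Definition exc3 u v v' := [set x | [&& x \notin B1, nbrs B0 x == [set u] &
  [exists c : T * T, [&& c.1 != c.2, c.1 \notin B1, c.2 \notin B1, e x c.1 & e x c.2] &&
     (e c.1 v && e c.2 v')]]].

(** Let [P x] and [Q x] be the chosen neighbours joined to v and v'. At most 2 vertices share both
    values, and at most 4 share one. So a vertex conflicts with at most 4 * 4 members, and 33
    members would contain three whose paths [P x], x, [Q x] are pairwise disjoint, a K_{3,3} with u,
    v, v'. *)
Lemma exc3_le u v v' : u \in B0 -> v \in B0 -> v' \in B0 -> u != v -> u != v' -> v != v' ->
  #|exc3 u v v'| <= 32.
Proof.
move=> uB vB v'B uv uv' vv'.
pose f x := odflt (x, x) [pick c : T * T | [&& c.1 != c.2, c.1 \notin B1, c.2 \notin B1, e x c.1 & e x c.2] &&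
     (e c.1 v && e c.2 v')].
pose P x := (f x).1; pose Q x := (f x).2.
have fP x : x \in exc3 u v v' ->
    [/\ P x != Q x, P x \notin B1 /\ Q x \notin B1, e x (P x) /\ e x (Q x), e (P x) v & e (Q x) v'].
  rewrite inE => /and3P[_ _ /existsP[c Hc]]; rewrite /P /Q /f.
  case: pickP => [c' /andP[/and5P[? ? ? ? ?] /andP[? ?]] //|/(_ c)]; by rewrite Hc.
have xP x : x \in exc3 u v v' -> [/\ x \notin B1, e u x, ~~ e v x & ~~ e v' x].
  rewrite inE => /and3P[xB /eqP N _]; split=> //.
  - by have := set11 u; rewrite -N inE e_sym => /andP[].
  - have : v \notin [set u] by rewrite inE eq_sym.
    by rewrite -N inE vB e_sym.
  - have : v' \notin [set u] by rewrite inE eq_sym.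
    by rewrite -N inE v'B e_sym.
have inB1 b : b \in B0 -> b \in B1 by apply: (subsetP sB01).
have nB b x : b \in B0 -> x \notin B1 -> b != x by move=> /inB1 bB; apply: contraNneq => <-.
have xp x y : x \in exc3 u v v' -> y \in exc3 u v v' -> (x != P y) /\ (x != Q y).
  move=> xE yE; have [_ _ vx v'x] := xP x xE; have [_ _ _ pv qv] := fP y yE.
  by split; [apply: contraNneq vx => -> | apply: contraNneq v'x => ->]; rewrite e_sym.
set R := exc3 u v v' in fP xP xp *; clearbody R.
have fib2 c d : #|[set x in R | (P x == c) && (Q x == d)]| <= 2.
  have [->|/set0Pn[x0]] := eqVneq [set x in R | (P x == c) && (Q x == d)] set0; first by rewrite cards0.
  rewrite inE => /and3P[x0E /eqP Ec /eqP Ed]; have [cd [cB dB] _ _ _] := fP x0 x0E.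
  rewrite Ec Ed in cd cB dB.
  apply: (nbrs_le2_fibre (p := u) (q := c) (w := d)) => //; try exact: nB.
  move=> x; rewrite inE => /and3P[xE /eqP <- /eqP <-]; have [_ ? _ _] := xP x xE.
  by have [_ _ [? ?] _ _] := fP x xE; split=> //; rewrite e_sym.
have fibP c : #|[set x in R | P x == c]| <= 4.
  set Rc := [set x in R | _].
  have RcR x : x \in Rc -> x \in R /\ P x = c by rewrite inE => /andP[? /eqP].
  have [->|/set0Pn[x0 /RcR[x0E E0]]] := eqVneq Rc set0; first by rewrite cards0.
  have [_ [cB _] _ cv _] := fP x0 x0E; rewrite E0 in cB cv.
  apply: (@leq_trans (2 * #|Q @: Rc|)).
    apply: leq_card_fibres => d; apply: leq_trans (fib2 c d).
    by apply: subset_leq_card; apply/subsetP => x /setIdP[/RcR[xR Px] Qx]; apply/setIdP; rewrite Px eqxx.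
  rewrite (leq_mul (n1 := 2) (n2 := 2)) //.
  (* All these x have [P x] = c, so c is glued to its hub v in one branch set, which x then touches
     through c; this leaves x and [Q x] as disjoint branch sets for different values of [Q x]. *)
  apply: (image_common_le2 (Z := fun x => [set x; Q x]) (U1 := [set u]) (U2 := [set v; c]) (U3 := [set v'])).
  - by split; [apply: conn1|apply: conn2; rewrite e_sym|apply: conn1].
  - split; rewrite ?disjoints1 ?[[disjoint [set _; _] & _]]disjoint_sym ?disjoints1 !inE ?negb_or.
    + by rewrite uv nB.
    + by [].
    + by rewrite eq_sym vv' nB.
  - by move=> x /RcR[/fP[_ _ [_ ?] _ _] _]; apply: conn2.
  - move=> x /RcR[xE Px]; have [xB _ _ _] := xP x xE; have [PQ [_ QB] _ _ _] := fP x xE.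
    split; rewrite ?disjoints1 ?disjointU ?[[disjoint [set _; _] & _]]disjoint_sym ?disjoints1 !inE ?negb_or.
    + by rewrite !nB.
    + have [h _] := xp x x xE xE; rewrite Px in h PQ.
      by rewrite [x == v]eq_sym [Q x == v]eq_sym (nB v x) // (nB v (Q x)) // h eq_sym PQ.
    + by rewrite !nB.
  - move=> x /RcR[xE Px]; have [_ ux _ _] := xP x xE; have [_ _ [xPx xQx] _ qv] := fP x xE.
    split; [apply: adjS1l ux| |apply: (adjS1l (y := Q x)); rewrite 1?e_sym];
      rewrite ?inE ?eqxx ?orbT //.
    by apply/adjSP; exists c, x; rewrite !inE !eqxx orbT -Px e_sym.
  - move=> x y /RcR[xE Px] /RcR[yE Py] Qxy.
    rewrite disjointU ![[disjoint [set _; _] & _]]disjoint_sym !disjoints1 !inE !negb_or.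
    rewrite [Q y == Q x]eq_sym Qxy andbT.
    have -> : y != x by apply: contraNneq Qxy => ->.
    have [_ ->] := xp y x yE xE; rewrite eq_sym.
    by have [_ ->] := xp x y xE yE.
have fibQ c : #|[set x in R | Q x == c]| <= 4.
  set Rc := [set x in R | _].
  have RcR x : x \in Rc -> x \in R /\ Q x = c by rewrite inE => /andP[? /eqP].
  have [->|/set0Pn[x0 /RcR[x0E E0]]] := eqVneq Rc set0; first by rewrite cards0.
  have [_ [_ cB] _ _ cv] := fP x0 x0E; rewrite E0 in cB cv.
  apply: (@leq_trans (2 * #|P @: Rc|)).
    apply: leq_card_fibres => d; apply: leq_trans (fib2 d c).
    by apply: subset_leq_card; apply/subsetP => x /setIdP[/RcR[xR Qx] Px]; apply/setIdP; rewrite Qx eqxx Px.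
  rewrite (leq_mul (n1 := 2) (n2 := 2)) //.
  apply: (image_common_le2 (Z := fun x => [set x; P x]) (U1 := [set u]) (U2 := [set v'; c]) (U3 := [set v])).
  - by split; [apply: conn1|apply: conn2; rewrite e_sym|apply: conn1].
  - split; rewrite ?disjoints1 ?[[disjoint [set _; _] & _]]disjoint_sym ?disjoints1 !inE ?negb_or.
    + by rewrite uv' nB.
    + by [].
    + by rewrite vv' nB.
  - by move=> x /RcR[/fP[_ _ [? _] _ _] _]; apply: conn2.
  - move=> x /RcR[xE Qx]; have [xB _ _ _] := xP x xE; have [PQ [PB _] _ _ _] := fP x xE.
    split; rewrite ?disjoints1 ?disjointU ?[[disjoint [set _; _] & _]]disjoint_sym ?disjoints1 !inE ?negb_or.
    + by rewrite !nB.
    + have [_ h] := xp x x xE xE; rewrite Qx in h PQ.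
      by rewrite [x == v']eq_sym [P x == v']eq_sym (nB v' x) // (nB v' (P x)) // h PQ.
    + by rewrite !nB.
  - move=> x /RcR[xE Qx]; have [_ ux _ _] := xP x xE; have [_ _ [xPx xQx] pv _] := fP x xE.
    split; [apply: adjS1l ux| |apply: (adjS1l (y := P x)); rewrite 1?e_sym];
      rewrite ?inE ?eqxx ?orbT //.
    by apply/adjSP; exists c, x; rewrite !inE !eqxx orbT -Qx e_sym.
  - move=> x y /RcR[xE Qx] /RcR[yE Qy] Pxy.
    rewrite disjointU ![[disjoint [set _; _] & _]]disjoint_sym !disjoints1 !inE !negb_or.
    rewrite [P y == P x]eq_sym Pxy andbT.
    have -> : y != x by apply: contraNneq Pxy => ->.
    have [-> _] := xp y x yE xE; rewrite eq_sym.
    by have [-> _] := xp x y xE yE.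
pose conf x y := [|| P y == P x, P y == Q x, Q y == P x | Q y == Q x].
rewrite leqNgt; apply/negP => gt32.
have [||x [y [z [[xR yR zR] [xy xz yz]]]]] := greedy3 (R := R) (conf := conf) (k := 16) _ _ gt32.
- by move=> x _; rewrite /conf eqxx.
- move=> x _.
  apply: (@leq_trans #|([set y in R | P y == P x] :|: [set y in R | P y == Q x]) :|:
     ([set y in R | Q y == P x] :|: [set y in R | Q y == Q x])|).
    apply: subset_leq_card; apply/subsetP => y; rewrite !inE /conf.
    by case: (y \in R) => //=; rewrite !orbA.
  apply: leq_trans (leq_card_setU _ _) _.
  have := leq_of_leqif (leq_card_setU [set y in R | P y == P x] [set y in R | P y == Q x]).
  have := leq_of_leqif (leq_card_setU [set y in R | Q y == P x] [set y in R | Q y == Q x]).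
  have := fibP (P x); have := fibP (Q x); have := fibQ (P x); have := fibQ (Q x); lia.
pose F := [set x; y; z].
have FR i : i \in F -> i \in R by rewrite !inE -orbA => /or3P[]/eqP->.
have cs i j : conf i j = conf j i.
  rewrite /conf [P i == P j]eq_sym [P i == Q j]eq_sym [Q i == P j]eq_sym [Q i == Q j]eq_sym.
  by congr (_ || _); rewrite orbCA.
have cR i : conf i i by rewrite /conf eqxx.
have Fc : {in F &, forall i j, i != j -> ~~ conf i j}.
  move=> i j; rewrite !inE -!orbA => /or3P[]/eqP-> /or3P[]/eqP->; rewrite ?eqxx // => _ //;
    by rewrite cs.
have : #|F| <= 2.
  apply: (@common_neighbours_le2 _ _ e_k33 _ _ (fun x => [set P x; x; Q x]) [set u] [set v] [set v']).
  - by split; apply: conn1.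
  - by split; apply: disjoint1.
  - move=> i /FR iR; have [_ _ [xPx xQx] _ _] := fP i iR.
    apply: connU => //; [by apply: conn2; rewrite e_sym|exact: conn1|].
    by apply/adjSP; exists i, (Q i); rewrite !inE eqxx orbT.
  - move=> i /FR iR; have [xB _ _ _] := xP i iR; have [_ [PB QB] _ _ _] := fP i iR.
    by split; rewrite disjoints1 !inE !negb_or !nB.
  - move=> i /FR iR; have [_ ux _ _] := xP i iR; have [_ _ _ pv qv] := fP i iR.
    split; [apply: (adjS1l (y := i))|apply: (adjS1l (y := P i))|apply: (adjS1l (y := Q i))];
      rewrite ?inE ?eqxx ?orbT // e_sym //.
  - move=> i j iF jF ij; have := Fc i j iF jF ij; have iR := FR i iF; have jR := FR j jF.
    rewrite /conf !negb_or => /and4P[h1 h2 h3 h4].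
    have [a1 a2] := xp i j iR jR; have [a3 a4] := xp j i jR iR.
    rewrite -setI_eq0; apply/eqP/setP => t; rewrite !inE; apply/negP.
    by move=> /andP[/orP[/orP[]|]/eqP-> /orP[/orP[]|]/eqP E]; move: h1 h2 h3 h4 a1 a2 a3 a4 ij;
      rewrite ?E ?eqxx //= -?E ?eqxx.
rewrite /F setUC cardsU1 !inE negb_or cards2.
have ne i j : ~~ conf i j -> i != j by apply: contraNneq => ->.
by rewrite !(eq_sym z) (ne _ _ xz) (ne _ _ yz) (ne _ _ xy).
Qed.

End Exceptional.
End FewNeighboursFacts.

(** * A symmetric weight on pairs of hubs *)

Module WeightsFacts.
From mathcomp Require Import all_boot all_order all_algebra.
From mathcomp Require Import ring lra zify.
Import HalfPlaneFacts MinorsFacts DegeneracyFacts AttachmentFacts BundlesFacts FewNeighboursFacts.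

Lemma card_pairs (T : finType) (b : T -> T -> bool) :
  \sum_u \sum_v (b u v : nat) = #|[set c : T * T | b c.1 c.2]|.
Proof.
rewrite pair_bigA /= -sum1_card [RHS]big_mkcond /=.
by apply: eq_bigr => c _; rewrite inE; case: (b _ _).
Qed.

Lemma card_offdiag_le2 (T : finType) (N : {set T}) (X : {set T * T}) : #|N| <= 2 ->
  (forall c, c \in X -> [/\ c.1 \in N, c.2 \in N & c.1 != c.2]) -> #|X| <= 2.
Proof.
move=> N2 HX.
apply: (@leq_trans (\sum_(u in N) \sum_(v in N :\ u) 1)).
  rewrite pair_big_dep /= sum1dep_card; apply: subset_leq_card; apply/subsetP => c /HX[h1 h2 h3].
  by rewrite !inE h1 h2 eq_sym h3.
apply: (@leq_trans (\sum_(u in N) (#|N| - 1))).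
  by apply: leq_sum => u uN; rewrite sum1_card [#|N|](cardsD1 u) uN addKn.
by rewrite sum_nat_const; case: #|N| N2 => [|[|[|]]].
Qed.

Section Weights.
Variables (T : finType) (e : rel T).
Hypothesis e_sym : symmetric e.
Hypothesis e_irr : irreflexive e.
Hypothesis e_k33 : k33_minor_free e.
Variable rk : T -> nat.
Definition orient : rel T := [rel x y | e x y && (rk x < rk y)].
Hypothesis out14 : forall x, #|[set y | orient x y]| <= 14.
Variables (B0 B1 : {set T}).
Hypothesis sB01 : B0 \subset B1.
Hypothesis few0 : forall x, x \notin B1 -> #|nbrs e B0 x| <= 2.
Implicit Types (A P Q R U V W Z : {set T}) (x y z w u v p q s : T).
Local Notation o := orient.
Local Notation N0 := (nbrs e B0).
Local Notation N1 := (nbrs e B1).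

Definition good := [set x | (x \notin B1) && (#|N1 x| <= 2)].
Definition codeg u v := #|[set x in good | e x u && e x v]|.
(** The place of a copy where two consecutive vertices are both outside the hubs: a directed edge
    from s to w, with s hanging on u and w on v. *)
Definition ladders u v := \sum_(s in good) \sum_(w | w \notin B1) [&& o s w, e s u & e w v].

(** Short for distinct: two different members of [B0]. Nothing metric is meant. *)
Definition dist u v := [&& u \in B0, v \in B0 & u != v].
Definition typeA x u v := [&& dist u v, x \notin B1 & N0 x == [set u; v]].
Definition typeP x u v := [&& dist u v, x \notin B1, N0 x == [set u] &
  [exists y, [&& y \notin B1, e x y, e y v & N0 y \subset [set u; v]]]].
Definition typeE x u v w := [&& w \notin B1, dist u v, x \in good, o x w &
  [&& e x u, e w v & ~~ (N0 x :|: N0 w \subset [set u; v])]].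
Definition typeM x u v := [&& u \in B1, v \in B1, u != v, ~~ dist u v &
  [&& x \in good, e x u & e x v]].

(** The coefficients 2 on types A and P, the latter in both orders, reproduce the bound of
    [bundle_weight_le], with P and Q the vertices of type P for (u, v) and (v, u). Type E pays one
    for each ladder that sees a hub besides u and v. Type M pays for common neighbours of pairs not
    both in [B0]. Ordered pairs are used throughout, so each unordered pair enters the total
    twice. *)
Definition weight u v := \sum_x (2 * typeA x u v + 2 * (typeP x u v + typeP x v u) +
  (\sum_w typeE x u v w + \sum_w typeE x v u w) + 2 * typeM x u v).

Lemma distC u v : dist u v = dist v u.
Proof. by rewrite /dist andbCA eq_sym. Qed.
Lemma typeAC x u v : typeA x u v = typeA x v u.
Proof. by rewrite /typeA distC [[set u; v]]setUC. Qed.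
Lemma typeMC x u v : typeM x u v = typeM x v u.
Proof. by rewrite /typeM distC [u == v]eq_sym andbCA [e x u && e x v]andbC. Qed.

Lemma weightC u v : weight u v = weight v u.
Proof. by apply: eq_bigr => x _; rewrite typeAC typeMC; lia. Qed.

Lemma dist_irr u : dist u u = false.
Proof. by rewrite /dist eqxx !andbF. Qed.

Lemma weight_diag u : weight u u = 0.
Proof.
apply: big1 => x _; rewrite /typeA /typeP /typeM dist_irr eqxx !andbF /=.
by rewrite big1 // => w _; rewrite /typeE dist_irr andbF.
Qed.

Lemma in_nbrs B x u : (u \in nbrs e B x) = (u \in B) && e x u.
Proof. by rewrite inE. Qed.

Lemma N01 x : N0 x \subset N1 x.
Proof.
by apply/subsetP => u; rewrite !in_nbrs => /andP[/(subsetP sB01)-> ->].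
Qed.

Lemma good_notB x : x \in good -> x \notin B1.
Proof. by rewrite inE => /andP[]. Qed.

(** Between two members of [B0], a good common neighbour can see no third one, so it is of type A;
    every other pair in [B1] is covered by type M. *)
Lemma codeg_weight u v : u \in B1 -> v \in B1 -> u != v -> 2 * codeg u v <= weight u v.
Proof.
move=> uB vB uv; rewrite /codeg -sum1_card big_mkcond big_distrr /=.
apply: leq_sum => x _; rewrite inE; case xg : (x \in good) => //=.
case: (boolP (e x u && e x v)) => // /andP[xu xv].
case: (boolP (dist u v)) => [d|d]; last first.
  have -> : typeM x u v by rewrite /typeM uB vB uv d xg xu xv.
  by rewrite leq_addl.
have -> : typeA x u v.
  rewrite /typeA d (good_notB xg) /= eq_sym.
  case/and3P: d => uB0 vB0 _; rewrite eqEcard cards2 uv few0 ?good_notB // andbT.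
  by apply/subsetP => t; rewrite !inE => /orP[]/eqP->; rewrite ?uB0 ?vB0.
by rewrite -!addnA leq_addr.
Qed.

(** A ladder whose two vertices see only u and v inside [B0] is an edge of the bundle, from A or P
    to A or Q; the remaining ladders are paid by type E. Adding the two directions, o s w + o w s is
    at most the adjacency of s and w, and [bundle_weight_le] applies with singleton branch sets. *)
Lemma ladders_weight u v : dist u v -> ladders u v + ladders v u <= weight u v.
Proof.
move=> d; have [uB0 vB0 uv] := and3P d.
pose A := [set x | typeA x u v]; pose P := [set x | typeP x u v]; pose Q := [set x | typeP x v u].
have key a b : dist a b -> ladders a b <= \sum_x \sum_w typeE x a b w +
    \sum_(s in [set x | typeA x a b] :|: [set x | typeP x a b])
    \sum_(w in [set x | typeA x a b] :|: [set x | typeP x b a]) o s w.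
  move=> dab; have [aB bB ab] := and3P dab.
  rewrite /ladders big_mkcond [X in _ <= _ + X]big_mkcond -big_split /=; apply: leq_sum => s _.
  case sg : (s \in good) => //; have sB := good_notB sg.
  rewrite big_mkcond /=.
  apply: (@leq_trans (\sum_w (typeE s a b w +
     [&& s \in [set x | typeA x a b] :|: [set x | typeP x a b],
         w \in [set x | typeA x a b] :|: [set x | typeP x b a] & o s w]))).
    apply: leq_sum => w _; case: (boolP (w \in B1)) => //= wB.
    case: (boolP [&& o s w, e s a & e w b]) => // /and3P[osw sa wb].
    rewrite /typeE wB dab sg osw sa wb /=.
    case: (boolP (N0 s :|: N0 w \subset [set a; b])) => //=; rewrite subUset => /andP[ss sw].
    have sw_e : e s w by case/andP: osw.
    have aN : a \in N0 s by rewrite in_nbrs aB.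
    have bN : b \in N0 w by rewrite in_nbrs bB.
    have -> : s \in [set x | typeA x a b] :|: [set x | typeP x a b].
      rewrite !inE /typeA /typeP dab sB /=.
      case: (boolP (b \in N0 s)) => bs.
        have -> // : N0 s == [set a; b].
        by rewrite eqEsubset ss subUset !sub1set aN bs.
      have -> : N0 s == [set a].
        rewrite eqEsubset sub1set aN andbT; apply/subsetP => t tN.
        have := subsetP ss t tN; rewrite !inE => /orP[->//|/eqP tb].
        by rewrite tb (negbTE bs) in tN.
      by apply/orP; right; apply/existsP; exists w; rewrite wB sw_e wb sw.
    have -> // : w \in [set x | typeA x a b] :|: [set x | typeP x b a].
    rewrite !inE /typeA /typeP [dist b a]distC dab wB /=.
    case: (boolP (a \in N0 w)) => aw.
      have -> // : N0 w == [set a; b].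
      by rewrite eqEsubset sw subUset !sub1set aw bN.
    have -> : N0 w == [set b].
      rewrite eqEsubset sub1set bN andbT; apply/subsetP => t tN.
      have := subsetP sw t tN; rewrite !inE => /orP[/eqP ta|->//].
      by rewrite ta (negbTE aw) in tN.
    apply/orP; right; apply/existsP; exists s.
    by rewrite sB e_sym sw_e sa setUC ss.
  rewrite big_split /= leq_add2l; case: ifP => [sA|_]; last by rewrite big1.
  by rewrite [X in _ <= X]big_mkcond; apply: leq_sum => w _; case: (w \in _).
have k1 := key _ _ d; have d' : dist v u by rewrite distC.
have k2 := key _ _ d'.
have EA : [set x | typeA x v u] = A by apply/setP => x; rewrite !inE typeAC.
rewrite EA -/A -/P -/Q in k1 k2.
have EW : weight u v = 2 * (#|A| + #|P| + #|Q|) +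
    (\sum_x \sum_w typeE x u v w + \sum_x \sum_w typeE x v u w) + 2 * \sum_x typeM x u v.
  have c (b : T -> bool) : #|[set x | b x]| = \sum_x (b x : nat).
    by rewrite -sum1_card big_mkcond; apply: eq_bigr => x _; rewrite inE; case: (b x).
  rewrite /weight !big_split /= !big1_eq -!c -/A -/P -/Q.
  move: (\sum_x \sum_w _) (\sum_x \sum_w _) #|A| #|P| #|Q| #|_|; clear; lia.
have kb : \sum_(s in A :|: P) \sum_(w in A :|: Q) o s w +
          \sum_(s in A :|: Q) \sum_(w in A :|: P) o s w <= 2 * (#|A| + #|P| + #|Q|).
  have dPA : [disjoint A & P].
    rewrite -setI_eq0; apply/eqP/setP => x; rewrite !inE; apply/negP.
    move=> /andP[/and3P[_ _ /eqP h] /and4P[_ _ /eqP h' _]].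
    have := cards2 u v; by rewrite -h h' cards1 uv.
  have dQA : [disjoint A & Q].
    rewrite -setI_eq0; apply/eqP/setP => x; rewrite !inE; apply/negP.
    move=> /andP[/and3P[_ _ /eqP h] /and4P[_ _ /eqP h' _]].
    have := cards2 u v; by rewrite -h h' cards1 uv.
  have dPQ : [disjoint P & Q].
    rewrite -setI_eq0; apply/eqP/setP => x; rewrite !inE; apply/negP.
    move=> /andP[/and4P[_ _ /eqP h _] /and4P[_ _ /eqP h' _]].
    have := set11 u; by rewrite -h h' inE (negbTE uv).
  have inA x : x \in A -> [/\ x \notin B1, e x u & e x v].
    rewrite inE => /and3P[_ xB /eqP h]; split=> //.
      by have := set21 u v; rewrite -h in_nbrs => /andP[].
    by have := set22 u v; rewrite -h in_nbrs => /andP[].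
  have inP x : x \in P -> x \notin B1 /\ e x u.
    rewrite inE => /and4P[_ xB /eqP h _]; split=> //.
    by have := set11 u; rewrite -h in_nbrs => /andP[].
  have inQ x : x \in Q -> x \notin B1 /\ e x v.
    rewrite inE => /and4P[_ xB /eqP h _]; split=> //.
    by have := set11 v; rewrite -h in_nbrs => /andP[].
  have /= := @bundle_weight_le T e e_sym e_k33 (fun x => [set x]) A P Q u v
    (model_set1 e _) uv dPA dQA dPQ.
  have h1 : {in A :|: P :|: Q, forall x, u \notin [set x] /\ v \notin [set x]}.
    move=> x xV; have xB : x \notin B1.
      by move: xV => /setUP[/setUP[/inA[]|/inP[]]|/inQ[]].
    rewrite !inE; split; apply: contraNneq xB => <-; exact: (subsetP sB01).
  have h2 : {in A, forall x, adjS e [set u] [set x] && adjS e [set v] [set x]}.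
    by move=> x /inA[_ ? ?]; rewrite !adjS1; apply/andP; split; rewrite e_sym.
  have h3 : {in P, forall x, adjS e [set u] [set x]}.
    by move=> x /inP[_ ?]; rewrite adjS1 e_sym.
  have h4 : {in Q, forall x, adjS e [set v] [set x]}.
    by move=> x /inQ[_ ?]; rewrite adjS1 e_sym.
  move=> /(_ h1 h2 h3 h4); apply: leq_trans.
  rewrite [X in _ + X]exchange_big -big_split /=.
  have U (X Y : {set T}) (F : T -> nat) :
      \sum_(s in X :|: Y) F s <= \sum_(s in X) F s + \sum_(s in Y) F s.
    rewrite big_mkcond [\sum_(s in X) _]big_mkcond [\sum_(s in Y) _]big_mkcond -big_split /=.
    by apply: leq_sum => s _; rewrite inE; case: (s \in X) (s \in Y) => [] []; rewrite ?addn0 ?leq_addr.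
  apply: (@leq_trans (\sum_(s in A :|: P) \sum_(w in A :|: Q) radj e (fun x => [set x]) s w)).
    apply: leq_sum => s _; rewrite -big_split; apply: leq_sum => w _ /=.
    rewrite radj_set1 // /o /= [e w s]e_sym.
    by case: (e s w) => //=; case: ltngtP.
  apply: leq_trans (U _ _ _) _; rewrite /bundle_weight -!addnA addnA leq_add //.
    by rewrite /edges_between -big_split; apply: leq_sum => s _; apply: U.
  by rewrite /edges_between -big_split; apply: leq_sum => s _; apply: U.
rewrite EW; move: k1 k2 kb; clear.
move: (\sum_x \sum_w typeE x u v w) (\sum_x \sum_w typeE x v u w) (\sum_x _) (ladders _ _) (ladders _ _).
move: (\sum_(_ in _) _) (\sum_(_ in _) _) #|A| #|P| #|Q|; lia.
Qed.

End Weights.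
End WeightsFacts.

(** * The total weight, vertex by vertex *)

Module TotalWeightFacts.
From mathcomp Require Import all_boot all_order all_algebra.
From mathcomp Require Import ring lra zify.
Import HalfPlaneFacts MinorsFacts DegeneracyFacts AttachmentFacts BundlesFacts FewNeighboursFacts WeightsFacts.

Lemma card_triples (T : finType) (b : T -> T -> T -> bool) :
  \sum_u \sum_v \sum_w (b u v w : nat) = #|[set c : T * (T * T) | b c.1 c.2.1 c.2.2]|.
Proof.
under eq_bigr => u _ do rewrite pair_bigA /=.
rewrite pair_bigA /= -sum1_card [RHS]big_mkcond /=.
by apply: eq_bigr => c _; rewrite inE; case: (b _ _ _).
Qed.

Section WeightSum.
Variables (T : finType) (e : rel T).
Hypothesis e_sym : symmetric e.
Hypothesis e_irr : irreflexive e.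
Hypothesis e_k33 : k33_minor_free e.
Variable rk : T -> nat.
Hypothesis out14 : forall x, #|[set y | orient e rk x y]| <= 14.
Variables (B0 B1 : {set T}).
Hypothesis sB01 : B0 \subset B1.
Hypothesis few0 : forall x, x \notin B1 -> #|nbrs e B0 x| <= 2.
Implicit Types (A P Q R U V W Z : {set T}) (x y z w u v p q s : T).
Local Notation o := (orient e rk).
Local Notation N0 := (nbrs e B0).
Local Notation N1 := (nbrs e B1).
Local Notation good := (good e B1).
Local Notation dist := (dist B0).
Local Notation typeA := (typeA e B0 B1).
Local Notation typeP := (typeP e B0 B1).
Local Notation typeE := (typeE e rk B0 B1).
Local Notation typeM := (typeM e B0 B1).

(** The charges read the double sum of weights from the side of a vertex: how often x enters over
    all ordered pairs of hubs. *)
Definition chargeA x := #|[set c : T * T | typeA x c.1 c.2]|.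
Definition chargeP x := #|[set c : T * T | typeP x c.1 c.2]|.
Definition chargeM x := #|[set c : T * T | typeM x c.1 c.2]|.
Definition chargeE x := #|[set c : T * (T * T) | typeE x c.1 c.2.1 c.2.2]|.

Lemma weight_sum : \sum_u \sum_v weight e rk B0 B1 u v =
  \sum_x (2 * chargeA x + 4 * chargeP x + 2 * chargeE x + 2 * chargeM x).
Proof.
rewrite /weight.
under eq_bigr => u _ do rewrite exchange_big.
rewrite exchange_big; apply: eq_bigr => x _.
have D n (F : T -> T -> nat) : \sum_u \sum_v n * F u v = n * \sum_u \sum_v F u v.
  by rewrite big_distrr; apply: eq_bigr => u _; rewrite big_distrr.
have S (F G : T -> T -> nat) : \sum_u \sum_v (F u v + G u v) =
    \sum_u \sum_v F u v + \sum_u \sum_v G u v.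
  by rewrite -big_split; apply: eq_bigr => u _; rewrite -big_split.
rewrite (S (fun u v => _ + _ + _)) (S (fun u v => _ + _)) (S (fun u v => 2 * _)).
rewrite !D !S.
have -> : \sum_u \sum_v (typeP x v u : nat) = chargeP x by rewrite exchange_big card_pairs.
have -> : \sum_u \sum_v \sum_w (typeE x v u w : nat) = chargeE x.
  by rewrite exchange_big card_triples.
have -> : \sum_u \sum_v (typeP x u v : nat) = chargeP x by rewrite card_pairs.
have -> : \sum_u \sum_v \sum_w (typeE x u v w : nat) = chargeE x by rewrite card_triples.
have -> : \sum_u \sum_v (typeA x u v : nat) = chargeA x by rewrite card_pairs.
have -> : \sum_u \sum_v (typeM x u v : nat) = chargeM x by rewrite card_pairs.
by move: (chargeA x) (chargeP x) (chargeE x) (chargeM x); clear; lia.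
Qed.

Lemma typeA_nbrs x u v : typeA x u v -> [/\ x \notin B1, u \in N0 x, v \in N0 x, u != v & dist u v].
Proof. by case/and3P=> /[dup] d /and3P[_ _ uv] xB /eqP->; rewrite !inE !eqxx orbT. Qed.

Lemma typeM_nbrs x u v : typeM x u v -> [/\ x \in good, u \in N1 x, v \in N1 x, u != v & ~~ dist u v].
Proof. by case/and5P=> uB vB uv d /and3P[xg xu xv]; rewrite !in_nbrs uB vB. Qed.

Lemma typeP_nbrs x u v : typeP x u v -> [/\ x \notin B1, N0 x = [set u], u != v &
  exists y, [/\ y \notin B1, e x y, v \in N0 y & N0 y \subset [set u; v]]].
Proof.
case/and4P=> /and3P[uB vB uv] xB /eqP N /existsP[y /and4P[yB xy yv Ny]]; split=> //.
by exists y; rewrite in_nbrs vB.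
Qed.

Lemma typeE_nbrs x u v w : typeE x u v w -> [/\ [/\ w \notin B1, x \in good & u != v],
  u \in N0 x, v \in N0 w, o x w & ~~ (N0 x :|: N0 w \subset [set u; v])].
Proof.
by case/and5P=> wB /and3P[uB vB uv] xg xw /and3P[xu wv H]; rewrite !in_nbrs uB vB.
Qed.

Lemma set2_card2 (N : {set T}) u v : #|N| <= 2 -> u \in N -> v \in N -> u != v -> N = [set u; v].
Proof.
move=> N2 uN vN uv; apply/eqP; rewrite eq_sym eqEcard cards2 uv N2 andbT.
by rewrite subUset !sub1set uN.
Qed.

(** The ways in which a vertex could be charged to several pairs: more than two neighbours in [B1];
    exactly two of them and a neighbour leading to another hub; one hub neighbour and two paths of
    length two to different further hubs. *)
Definition exceptional :=
  ([set x | (x \notin B1) && (2 < #|N1 x|)] :|: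
   [set x | [&& x \notin B1, #|N1 x| == 2 &
     [exists w, [&& w \notin B1, e x w & ~~ (N0 w \subset N1 x)]]]]) :|:
  [set x | [&& x \notin B1, #|N0 x| == 1 &
     [exists c : T * T, [&& c.1 != c.2, c.1 \notin B1, c.2 \notin B1, e x c.1 & e x c.2] &&
       [exists d : T * T, [&& d.1 != d.2, d.1 \notin N0 x, d.2 \notin N0 x,
          d.1 \in N0 c.1 & d.2 \in N0 c.2]]]]].

(** Each kind is covered by sets indexed by triples from [B1], of size at most 2 by [many_nbrs_le],
    4 by [exc2_le] and 32 by [exc3_le]. *)
Lemma exceptional_le : #|exceptional| <= 38 * #|B1| ^ 3.
Proof.
apply: leq_trans (leq_card_setU _ _) _.
apply: (@leq_trans ((2 + 4) * #|B1| ^ 3 + 32 * #|B1| ^ 3)); last by rewrite -mulnDl.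
apply: leq_add; last first.
  apply: (leq_card_triples (R := fun u v v' =>
    if [&& u \in B0, v \in B0, v' \in B0, u != v, u != v' & v != v'] then exc3 e B0 B1 u v v' else set0)).
    move=> x; rewrite inE => /and3P[xB /cards1P[u N] /existsP[c /andP[Hc /existsP[d]]]].
    rewrite N !inE => /and5P[dd du du' /andP[dB cd] /andP[dB' cd']].
    have uB : u \in B0 by have := set11 u; rewrite -N in_nbrs => /andP[].
    exists u, d.1, d.2; rewrite !(subsetP sB01) // uB dB dB' ![u == _]eq_sym du du' dd /=.
    split=> //; rewrite inE xB N eqxx; apply/existsP; exists c; by rewrite Hc cd cd'.
  move=> u v v' _ _ _; case: ifP => [/and5P[uB vB vB' uv /andP[uv' vv']]|_]; last by rewrite cards0.
  exact: exc3_le.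
apply: leq_trans (leq_card_setU _ _) _; rewrite mulnDl leq_add //; first exact: many_nbrs_le.
apply: (leq_card_triples (R := fun p q v =>
    if (p != q) && (v \notin [set p; q]) then exc2 e B1 p q v else set0)).
  move=> x; rewrite inE => /and3P[xB /cards2P[p [q [pq N]]] /existsP[w /and3P[wB xw /subsetPn[v vw vN]]]].
  have := set21 p q; have := set22 p q; rewrite -N !in_nbrs => /andP[qB _] /andP[pB _].
  move: vw; rewrite in_nbrs => /andP[vB wv].
  exists p, q, v; rewrite pB qB (subsetP sB01 _ vB) pq -N vN; split=> //.
  by rewrite inE xB N eqxx; apply/existsP; exists w; rewrite wB xw.
move=> p q v pB qB vB; case: ifP => [/andP[pq vpq]|_]; last by rewrite cards0.
exact: exc2_le.
Qed.

Lemma charge_A_le2 x : chargeA x <= 2.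
Proof.
case xB : (x \in B1).
  rewrite /chargeA (_ : [set c | _] = set0) ?cards0 //.
  by apply/setP => c; rewrite !inE; apply/negP => /typeA_nbrs[]; rewrite xB.
apply: (@card_offdiag_le2 _ (N0 x)); first by rewrite few0 ?xB.
by move=> c; rewrite inE => /typeA_nbrs[].
Qed.

Lemma charge_M_le2 x : chargeM x <= 2.
Proof.
case xg : (x \in good); last first.
  rewrite /chargeM (_ : [set c | _] = set0) ?cards0 //.
  by apply/setP => c; rewrite !inE; apply/negP => /typeM_nbrs[]; rewrite xg.
apply: (@card_offdiag_le2 _ (N1 x)); first by move: xg; rewrite inE => /andP[].
by move=> c; rewrite inE => /typeM_nbrs[].
Qed.

Lemma charge_AM_le2 x : #|N1 x| <= 2 -> chargeA x + chargeM x <= 2.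
Proof.
move=> N2; rewrite /chargeA /chargeM -cardsUI.
have -> : [set c | typeA x c.1 c.2] :&: [set c | typeM x c.1 c.2] = set0.
  apply/setP => c; rewrite !inE; apply/negP => /andP[/typeA_nbrs[_ _ _ _ d] /typeM_nbrs[_ _ _ _]].
  by rewrite d.
rewrite cards0 addn0; apply: (card_offdiag_le2 N2) => c /setUP[]; rewrite inE.
  by move=> /typeA_nbrs[_ h1 h2 h3 _]; split=> //; apply: (subsetP (N01 _ sB01 _)).
by move=> /typeM_nbrs[].
Qed.

Lemma charge_P_le x : chargeP x <= #|B1|.
Proof.
have [c0|/set0Pn[c]] := eqVneq [set c : T * T | typeP x c.1 c.2] set0.
  by rewrite /chargeP c0 cards0.
rewrite inE => /typeP_nbrs[_ N _ _].
apply: (@leq_trans #|setX [set c.1] B0|); last first.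
  by rewrite cardsX cards1 mul1n subset_leq_card.
apply: subset_leq_card; apply/subsetP => -[u v]; rewrite !inE /= => h.
have [_ Nu _ _] := typeP_nbrs h; move: h => /and4P[/and3P[_ -> _] _ _ _]; rewrite andbT.
by have := set11 u; rewrite -Nu N inE.
Qed.

(** The count is 2 * 14 * 2: a hub neighbour of x, an out-neighbour w of x, a hub neighbour of w. *)
Lemma charge_E_le x : chargeE x <= 56.
Proof.
case xg : (x \in good); last first.
  rewrite /chargeE (_ : [set c | _] = set0) ?cards0 //.
  by apply/setP => c; rewrite !inE; apply/negP => /typeE_nbrs[[_]]; rewrite xg.
have xB := good_notB xg.
rewrite /chargeE -card_triples.
apply: (@leq_trans (\sum_(u in N0 x) \sum_(w in [set y | o x y] :\: B1) \sum_(v in N0 w) 1)).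
  rewrite [X in _ <= X]big_mkcond; apply: leq_sum => u _.
  rewrite exchange_big /=; case uN : (u \in N0 x); last first.
    rewrite big1 // => w _; apply: big1 => v _; apply/eqP; rewrite eqb0; apply/negP.
    by case/typeE_nbrs=> _; rewrite uN.
  rewrite [X in _ <= X]big_mkcond; apply: leq_sum => w _; case wo : (w \in _ :\: _); last first.
    rewrite big1 // => v _; apply/eqP; rewrite eqb0; apply/negP.
    by case/typeE_nbrs=> -[wB _ _] _ _ xw _; rewrite !inE wB xw in wo.
  rewrite [X in _ <= X]big_mkcond; apply: leq_sum => v _; case tE : (typeE x u v w) => //.
  by have [_ _ -> _ _] := typeE_nbrs tE.
apply: (@leq_trans (\sum_(u in N0 x) \sum_(w in [set y | o x y] :\: B1) 2)).
  apply: leq_sum => u _; apply: leq_sum => w; rewrite !inE => /andP[wB _].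
  by rewrite sum1_card few0.
rewrite !sum_nat_const.
have h1 : #|[set y | o x y] :\: B1| <= 14.
  by apply: leq_trans (out14 x); rewrite subset_leq_card // subsetDl.
by have := few0 xB; have := leq_mul (few0 xB) h1; lia.
Qed.

(** The charges exclude one another. If x has two neighbours in [B1], its own neighbours see no new
    hub, so only types A and M remain, at most 2 in all. If x sees a single hub p, there is either
    at most one P-charge and no E-charge, or only E-charges, all through one [w0]; these are at most
    2 as [w0] sees at most two hubs. In every case the total is at most 4. *)
Lemma charge_regular x : x \notin exceptional ->
  2 * chargeA x + 4 * chargeP x + 2 * chargeE x + 2 * chargeM x <= 4.
Proof.
have z2 (P : T * T -> bool) : (forall c, ~ P c) -> #|[set c | P c]| = 0.
  by move=> H; apply/eqP; rewrite cards_eq0; apply/eqP/setP => c; rewrite !inE; apply/negP/H.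
have z3 (P : T * (T * T) -> bool) : (forall c, ~ P c) -> #|[set c | P c]| = 0.
  by move=> H; apply/eqP; rewrite cards_eq0; apply/eqP/setP => c; rewrite !inE; apply/negP/H.
case xB : (x \in B1).
  have -> : chargeA x = 0 by apply: z2 => c /typeA_nbrs[]; rewrite xB.
  have -> : chargeP x = 0 by apply: z2 => c /typeP_nbrs[]; rewrite xB.
  have -> : chargeE x = 0 by apply: z3 => c /typeE_nbrs[[_ /good_notB]]; rewrite xB.
  by have -> : chargeM x = 0 by apply: z2 => c /typeM_nbrs[/good_notB]; rewrite xB.
rewrite /exceptional !in_setU !negb_or => /andP[/andP[h1 h2] h3].
rewrite inE xB /= -leqNgt in h1.
have sN := N01 e sB01 x.
have AM := charge_AM_le2 h1.
have [N2|N2] := eqVneq #|N1 x| 2.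
  have key w : w \notin B1 -> e x w -> N0 w \subset N1 x.
    move=> wB xw; move: h2; rewrite inE xB N2 eqxx /= => /existsPn/(_ w).
    by rewrite wB xw negbK.
  have -> : chargeP x = 0.
    apply: z2 => c /typeP_nbrs[_ N uv [y [yB xy vy _]]].
    have := subsetP (key y yB xy) _ vy; move: vy; rewrite !in_nbrs => /andP[vB _] /andP[_ xv].
    have : c.2 \in N0 x by rewrite in_nbrs vB.
    by rewrite N inE eq_sym (negbTE uv).
  have -> : chargeE x = 0.
    apply: z3 => c /typeE_nbrs[[wB _ uv] ux vw /andP[xw _]] /negP; apply.
    rewrite -(set2_card2 h1 (subsetP sN _ ux) (subsetP (key _ wB xw) _ vw) uv).
    by rewrite subUset sN key.
  move: AM; move: (chargeA x) (chargeM x); clear; lia.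
have le1 : #|N1 x| <= 1 by move: h1 N2; case: #|N1 x| => [|[|[|]]].
have A0 : chargeA x = 0.
  apply: z2 => c /typeA_nbrs[_ u v uv _]; move: le1; rewrite leqNgt => /negP; apply.
  by apply/card_gt1P; exists c.1, c.2; split=> //; apply: (subsetP sN).
have M0 : chargeM x = 0.
  apply: z2 => c /typeM_nbrs[_ u v uv _]; move: le1; rewrite leqNgt => /negP; apply.
  by apply/card_gt1P; exists c.1, c.2.
rewrite A0 M0.
have [N01x|N01x] := eqVneq #|N0 x| 1; last first.
  have N00 : N0 x = set0.
    apply/eqP; rewrite -cards_eq0; have := leq_trans (subset_leq_card sN) le1.
    by case: #|N0 x| N01x => [|[|]].
  have -> : chargeP x = 0.
    by apply: z2 => c /typeP_nbrs[_ N _ _]; have := set11 c.1; rewrite -N N00 inE.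
  by have -> : chargeE x = 0 by apply: z3 => c /typeE_nbrs[_]; rewrite N00 inE.
have /cards1P[p Np] : #|N0 x| == 1 by rewrite N01x.
have key y w v v' : y \notin B1 -> w \notin B1 -> e x y -> e x w -> y != w ->
    v \in N0 y -> v' \in N0 w -> v != p -> v' != p -> v = v'.
  move=> yB wB xy xw yw vy vw vp v'p; apply/eqP; apply: contraT => vv'.
  move: h3; rewrite inE xB N01x eqxx /= => /existsPn/(_ (y, w)).
  rewrite /= yw yB wB xy xw /= => /existsPn/(_ (v, v')).
  by rewrite /= vv' vy vw Np !inE vp v'p.
have [E0|/set0Pn[[u0 [v0 w0]]]] := eqVneq [set c : T * (T * T) | typeE x c.1 c.2.1 c.2.2] set0.
  rewrite /chargeE E0 cards0.
  suff : chargeP x <= 1 by move: (chargeP x); clear; lia.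
  rewrite leqNgt; apply/negP => /card_gt1P[[u v] [[u' v'] []]].
  rewrite !inE /= => /typeP_nbrs[_ Nu uv [y [yB xy vy sy]]] /typeP_nbrs[_ Nu' uv' [y' [yB' xy' vy' sy']]] ne.
  have up : u = p by have := set11 u; rewrite -Nu Np inE => /eqP.
  have up' : u' = p by have := set11 u'; rewrite -Nu' Np inE => /eqP.
  subst u u'.
  have vv' : v != v' by apply: contraNneq ne => ->.
  have yy' : y != y'.
    apply: contraNneq vv' => yy'; have := subsetP sy v'; rewrite yy' => /(_ vy').
    by rewrite !inE [v' == p]eq_sym (negbTE uv') /= eq_sym.
  by move/negP: vv'; apply; apply/eqP; apply: (key y y'); rewrite // eq_sym.
rewrite inE /= => /typeE_nbrs[[wB0 _ uv0] u0x v0w /andP[xw0 _] ns0].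
have up : u0 = p by move: u0x; rewrite Np inE => /eqP.
subst u0.
have [v1 v1w v1n] : exists2 v1, v1 \in N0 w0 & v1 \notin [set p; v0].
  move: ns0; rewrite subUset Np sub1set !inE eqxx /= => /subsetPn[v1 v1w v1n].
  by exists v1.
move: v1n; rewrite !inE negb_or => /andP[v1p v10].
have pv0 : v0 != p by rewrite eq_sym.
(* Whatever v is, [w0] leads to a hub besides p and v. A second neighbour of x leading to v would
   then give two paths to different hubs, which a regular vertex does not have. *)
have other v : exists t, [/\ t \in N0 w0, t != p & t != v].
  case: (eqVneq v v0) => [->|vv0]; [by exists v1 | by exists v0; split; rewrite // eq_sym].
have P0 : chargeP x = 0.
  apply: z2 => -[u v] /= /typeP_nbrs[_ Nu uv [y [yB xy vy sy]]].
  have up : u = p by have := set11 u; rewrite -Nu Np inE => /eqP.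
  subst u.
  have [t [tw tp tv]] := other v.
  have yw : y != w0.
    apply: contraNneq tv => yw; have := subsetP sy t; rewrite yw => /(_ tw).
    by rewrite !inE (negbTE tp).
  by move/eqP: tv; apply; apply/esym; apply: (key y w0); rewrite // eq_sym.
suff : chargeE x <= 2 by rewrite P0; move: (chargeE x); clear; lia.
apply: (@leq_trans #|setX [set p] (setX (N0 w0) [set w0])|); last first.
  by rewrite !cardsX !cards1 mul1n muln1 few0.
apply: subset_leq_card; apply/subsetP => -[u [v w]]; rewrite !inE /=.
case/typeE_nbrs=> -[wB _ uv] ux vw /andP[xw _] ns.
have up : u = p by move: ux; rewrite Np inE => /eqP.
subst u; rewrite eqxx /=.
have ww : w = w0.
  apply/eqP; apply: contraT => ww; have [t [tw tp tv]] := other v.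
  by move/eqP: tv => []; apply/esym; apply: (key w w0); rewrite // eq_sym.
by move: vw; rewrite ww in_nbrs => /andP[-> ->]; rewrite eqxx.
Qed.

(** At an exceptional vertex the types A, E and M contribute at most 2 * 2 + 2 * 56 + 2 * 2 = 120,
    and type P at most four times the size of [B1]. *)
Lemma weight_sum_le : \sum_u \sum_v weight e rk B0 B1 u v <=
  4 * #|T| + (38 * #|B1| ^ 3) * (4 * #|B1| + 120).
Proof.
rewrite weight_sum.
apply: (@leq_trans (\sum_x (4 + (x \in exceptional) * (4 * #|B1| + 120)))).
  apply: leq_sum => x _; case: (boolP (x \in exceptional)) => xE; last first.
    by rewrite mul0n addn0 charge_regular.
  have := charge_A_le2 x; have := charge_P_le x; have := charge_E_le x; have := charge_M_le2 x.
  by move: (chargeA x) (chargeP x) (chargeE x) (chargeM x) #|B1|; clear; lia.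
rewrite big_split /= sum_nat_const -big_distrl /= mulnC leq_add2l leq_mul2r.
apply/orP; right; apply: leq_trans exceptional_le; rewrite -sum1_card [X in _ <= X]big_mkcond.
by apply: leq_sum => x _; case: (x \in _).
Qed.

End WeightSum.
End TotalWeightFacts.

(** * Oriented embeddings of the odd cycle with few sources *)

Module ClosedWalksFacts.
From mathcomp Require Import all_boot all_order all_algebra.
From mathcomp Require Import ring lra zify.
Import HalfPlaneFacts MinorsFacts DegeneracyFacts AttachmentFacts BundlesFacts FewNeighboursFacts WeightsFacts.
Import GRing.Theory.

Section Chain.
Variables (I T : finType).

(** The values are revealed in the order of s. The bound [N i] on the choices at i is required only
    after a prefix that some member f of F realises. *)
Lemma leq_card_chain (F : {set {ffun I -> T}}) (s : seq I) (N : I -> nat) :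
  {in F &, forall f g : {ffun I -> T}, {in s, f =1 g} -> f = g} ->
  (forall s1 i s2, s = s1 ++ i :: s2 -> {in F, forall f : {ffun I -> T},
    #|[set (g : {ffun I -> T}) i | g in F & all (fun j => g j == f j) s1]| <= N i}) ->
  #|F| <= \prod_(i <- s) N i.
Proof.
elim: s F => [|i s IH] F inj HN.
  rewrite big_nil leqNgt; apply/negP => /card_gt1P[f [g [fF gF]]].
  by move/eqP; apply; apply: inj.
have [->|/set0Pn[f fF]] := eqVneq F set0; first by rewrite cards0.
rewrite big_cons mulnC; apply: (@leq_trans (\prod_(i <- s) N i * #|(fun g : {ffun I -> T} => g i) @: F|)).
  apply: leq_card_fibres => y; apply: IH.
    move=> g h; rewrite !inE => /andP[gF /eqP gi] /andP[hF /eqP hi] gh; apply: inj => // j.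
    by rewrite inE => /orP[/eqP->|]; [rewrite gi hi|exact: gh].
  move=> s1 j s2 Es g; rewrite inE => /andP[gF /eqP gi].
  apply: leq_trans (HN (i :: s1) j s2 _ g gF); last by rewrite Es.
  apply: subset_leq_card; apply/subsetP => z /imsetP[h]; rewrite !inE => /andP[/andP[hF /eqP hi] a] ->.
  by apply/imsetP; exists h => //; rewrite inE hF /= hi gi eqxx.
rewrite leq_mul2l; apply/orP; right; apply: leq_trans (HN [::] i s erefl f fF).
apply: subset_leq_card; apply/subsetP => _ /imsetP[h hF ->].
by apply/imsetP; exists h => //; rewrite inE hF.
Qed.

Lemma leq_card_family (F : {set {ffun I -> T}}) (S : I -> {set T}) (N : I -> nat) :
  (forall f i, f \in F -> f i \in S i) -> (forall i, #|S i| <= N i) -> #|F| <= \prod_i N i.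
Proof.
move=> HF HS; rewrite -[index_enum I]/(index_enum I).
rewrite (_ : \prod_i N i = \prod_(i <- enum I) N i); last by rewrite big_enum.
apply: leq_card_chain => [f g _ _ fg|s1 i s2 _ f fF].
  by apply/ffunP => i; apply: fg; rewrite mem_enum.
apply: leq_trans (HS i); apply: subset_leq_card; apply/subsetP => z /imsetP[g].
by rewrite inE => /andP[gF _] ->; apply: HF.
Qed.
End Chain.

Section ClosedWalks.
Variables (T : finType) (e : rel T) (rk : T -> nat) (m' : nat).
Hypothesis e_sym : symmetric e.
Hypothesis rk_inj : injective rk.
Hypothesis out14 : forall x, #|[set y | orient e rk x y]| <= 14.
Local Notation o := (orient e rk).
Local Notation m := m'.+2.
Local Notation k := (m.*2.+1).
Implicit Types (f g : {ffun 'I_k -> T}) (i j : 'I_k).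

(** Positions on the cycle are elements of the ring Z/k, so that both neighbours are reached by
    adding or subtracting [pos 1], with wrap-around. *)
Definition pos (n : nat) : 'I_k := inZp n.

Lemma ordSE i : ordS i = (i + pos 1)%R.
Proof. by apply: val_inj; rewrite /= modnDmr addn1. Qed.

Lemma posS n : pos n.+1 = (pos n + pos 1)%R.
Proof. by apply: val_inj; rewrite /= modnDm addn1. Qed.

Lemma pos_val i : pos i = i.
Proof. by apply: val_inj; rewrite /= modn_small. Qed.

Lemma pos0 : pos 0 = 0%R.
Proof. by apply: val_inj; rewrite /= mod0n. Qed.

Lemma posk : pos k = 0%R.
Proof. by apply: val_inj; rewrite /= modnn. Qed.

Lemma val_pos n : n < k -> val (pos n) = n.
Proof. by move=> h; rewrite /= modn_small. Qed.

Lemma pos_inj a b : a < k -> b < k -> pos a = pos b -> a = b.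
Proof. by move=> ha hb h; rewrite -(val_pos ha) -(val_pos hb) h. Qed.

Definition embedding f := injectiveb f && [forall i, e (f i) (f (i + pos 1)%R)].
Definition sources f : {set 'I_k} :=
  [set i | o (f i) (f (i + pos 1)%R) && o (f i) (f (i - pos 1)%R)].

Lemma orient_total x y : e x y -> x != y -> o x y (+) o y x.
Proof.
move=> xy n; rewrite /orient /= [e y x]e_sym xy /=.
by case: ltngtP => // /rk_inj E; rewrite E eqxx in n.
Qed.

Lemma orient_asym x y : o x y -> ~~ o y x.
Proof. by case/andP=> _ h; rewrite /orient /= negb_and orbC -leqNgt ltnW. Qed.

Lemma pos1_neq0 : pos 1 != 0%R.
Proof. by apply/eqP => /(congr1 val); rewrite /= modn_small. Qed.

Lemma embedding_edge f i : embedding f -> o (f i) (f (i + pos 1)%R) (+) o (f (i + pos 1)%R) (f i).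
Proof.
case/andP=> /injectiveP finj /forallP fe; apply: orient_total (fe i) _.
by rewrite (inj_eq finj) -subr_eq0 opprD addrA subrr sub0r oppr_eq0 pos1_neq0.
Qed.

Lemma sources_next f i : i \in sources f -> (i + pos 1)%R \notin sources f.
Proof.
rewrite !inE => /andP[h _]; rewrite negb_and addrK; apply/orP; right.
exact: orient_asym.
Qed.

Lemma card_sources f : #|sources f| <= m.
Proof.
have d : [disjoint sources f & [set (i + pos 1)%R | i in sources f]].
  rewrite -setI_eq0; apply/eqP/setP => i; rewrite in_setI in_set0; apply/negP.
  by move=> /andP[iS /imsetP[j jS ij]]; have := sources_next jS; rewrite -ij iS.
have : #|sources f| + #|[set (i + pos 1)%R | i in sources f]| <= k.
  have := leq_card_setU (sources f) [set (i + pos 1)%R | i in sources f].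
  by move=> [_]; rewrite d => /eqP <-; apply: leq_trans (max_card _) _; rewrite card_ord.
rewrite card_imset; last exact: addIr.
by move: #|_| => c; clear; lia.
Qed.

Definition few_sources := [set f | embedding f && (#|sources f| < m)].

(** There are at most 2^k orientation patterns. Within one pattern, a vertex that is not a source is
    an out-neighbour of one of its two neighbours on the cycle, so it has 14 choices after that one;
    only the sources, at most m - 1 of them, are free. *)
Lemma card_few_sources : #|few_sources| <= 2 ^ k * (14 ^ k * #|T| ^ m.-1).
Proof.
pose tau (f : {ffun 'I_k -> T}) : {ffun 'I_k -> bool} := [ffun i => o (f i) (f (i + pos 1)%R)].
apply: (@leq_trans (14 ^ k * #|T| ^ m.-1 * #|tau @: few_sources|)); last first.
  rewrite mulnC leq_mul2r; apply/orP; right.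
  by apply: leq_trans (max_card _) _; rewrite card_ffun card_bool card_ord.
apply: leq_card_fibres => t.
set F := [set f in few_sources | _].
have [->|/set0Pn[g gF]] := eqVneq F set0; first by rewrite cards0.
have FP f : f \in F -> [/\ embedding f, #|sources f| < m & forall i, o (f i) (f (i + pos 1)%R) = t i].
  rewrite !inE => /andP[/andP[h1 h2] /eqP <-]; split=> // i; by rewrite ffunE.
have FQ f i : f \in F -> (i \in sources f) = t i && ~~ t (i - pos 1)%R.
  move=> /FP[ef _ ft]; rewrite inE ft; congr (_ && _).
  have := embedding_edge (i - pos 1)%R ef; rewrite subrK -(ft (i - pos 1)%R) subrK.
  by case: (o _ _) (o _ _) => [] [].
clearbody F; have [eg Qg tg] := FP g gF.
(* The order is by rank in one member g. The predecessor that this provides for i points to i in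
   every member of F, because the pattern is common to all of them. *)
pose s := sort (fun i j => rk (g i) <= rk (g j)) (enum 'I_k).
have s_all i : i \in s by rewrite mem_sort mem_enum.
have s_sorted : sorted (fun i j => rk (g i) <= rk (g j)) s.
  by apply: sort_sorted => i j; exact: leq_total.
apply: (@leq_trans (\prod_(i <- s) (if i \in sources g then #|T| else 14))).
  apply: leq_card_chain => [f h _ _ fh|s1 i s2 Es f fF]; first by apply/ffunP => i; apply: fh.
  case: ifP => iQ; first exact: max_card.
  have before j : rk (g j) < rk (g i) -> j \in s1.
    move=> lt; have := s_all j; rewrite Es mem_cat => /orP[//|].
    move: s_sorted; rewrite Es => /(cat_sorted2) [_].
    move=> /= p; rewrite inE => /orP[/eqP E|js2]; first by rewrite E ltnn in lt.
    have tr : transitive (fun i j => rk (g i) <= rk (g j)) by move=> a b c; exact: leq_trans.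
    by have /allP/(_ j js2) := order_path_min tr p; rewrite leqNgt lt.
  have [j [js1 out]] : exists j, j \in s1 /\ {in F, forall h : {ffun 'I_k -> T}, o (h j) (h i)}.
    move: iQ; rewrite (FQ g) // => /negbT; rewrite negb_and negbK.
    case/orP=> ti.
      have H : {in F, forall h : {ffun 'I_k -> T}, o (h (i + pos 1)%R) (h i)}.
        move=> h hF; have [eh _ ht] := FP h hF; have := embedding_edge i eh.
        by rewrite ht (negbTE ti).
      exists (i + pos 1)%R; split=> //; apply: before.
      by have := H g gF; rewrite /orient /= => /andP[].
    have H : {in F, forall h : {ffun 'I_k -> T}, o (h (i - pos 1)%R) (h i)}.
      by move=> h hF; have [_ _ /(_ (i - pos 1)%R)] := FP h hF; rewrite subrK ti.
    exists (i - pos 1)%R; split=> //; apply: before.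
    by have := H g gF; rewrite /orient /= => /andP[].
  apply: leq_trans (out14 (f j)); apply: subset_leq_card; apply/subsetP => z /imsetP[h].
  rewrite !inE => /andP[hF /allP a] ->; rewrite -(eqP (a j js1)); exact: out.
have -> : \prod_(i <- s) (if i \in sources g then #|T| else 14) =
    #|T| ^ #|sources g| * 14 ^ #|~: sources g|.
  rewrite (perm_big (enum 'I_k)) ?perm_sort // big_enum /= (bigID (mem (sources g))) /=.
  congr (_ * _).
    by rewrite (eq_bigr (fun=> #|T|)) ?prod_nat_const // => i ->.
  rewrite (eq_bigr (fun=> 14)) ?prod_nat_const //; last by move=> i /negbTE->.
  by congr (14 ^ _); apply: eq_card => i; rewrite in_setC.
have T0 : 0 < #|T| by apply/card_gt0P; exists (g 0%R).
rewrite mulnC leq_mul ?leq_pexp2l //.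
by apply: leq_trans (max_card _) _; rewrite card_ord.
Qed.

End ClosedWalks.
End ClosedWalksFacts.

(** * Normal form of cycles with m sources *)

Module CanonicalFacts.
From mathcomp Require Import all_boot all_order all_algebra.
From mathcomp Require Import ring lra zify.
Import HalfPlaneFacts MinorsFacts DegeneracyFacts AttachmentFacts BundlesFacts FewNeighboursFacts WeightsFacts ClosedWalksFacts.
Import GRing.Theory.

Lemma half_bounds n : n./2.*2 <= n <= n./2.*2.+1.
Proof. by rewrite -{2 3}[n]odd_double_half; case: (odd n); rewrite ?leqnn ?leqnSn. Qed.

Section Canonical.
Variables (T : finType) (e : rel T) (rk : T -> nat) (m' : nat).
Hypothesis e_sym : symmetric e.
Hypothesis rk_inj : injective rk.
Local Notation o := (orient e rk).
Local Notation m := m'.+2.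
Local Notation k := (m.*2.+1).
Local Notation pos := (@pos m').
Implicit Types (f g : {ffun 'I_k -> T}) (i : 'I_k) (j : 'I_m).

(** The normal form on positions 0, ..., 2m has sources at 0, 3, 5, ..., 2m - 1, a vertex passed
    through at 1, and sinks at 2, 4, ..., 2m. This is why the source with index 0 is irregular. *)
Definition sink_of g j : T := g (pos j.*2.+2).
Definition source_of g j : T := g (pos (if j == ord0 then 0 else j.*2.+1)).

Definition canonical g := [&& o (source_of g ord0) (g (pos 1)), o (g (pos 1)) (sink_of g ord0),
  [forall j, o (source_of g (ordS j)) (sink_of g j)] &
  [forall j, (j != ord0) ==> o (source_of g j) (sink_of g j)]].

Definition edge_image f : {set {set T}} := [set [set f i; f (i + pos 1)%R] | i : 'I_k].

(** The sign of d tells a rotation from a reflection. A reflection swaps the two neighbours of a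
    position, and being a source is symmetric in them. *)
Lemma reindex_walk f (phi : 'I_k -> 'I_k) (d : 'I_k) : injective phi ->
  d = pos 1 \/ d = (- pos 1)%R -> (forall i, phi (i + pos 1)%R = (phi i + d)%R) ->
  embedding e f -> let g := [ffun i => f (phi i)] in
  [/\ embedding e g, f @: [set: 'I_k] = g @: [set: 'I_k], edge_image f = edge_image g &
      forall i, (i \in sources e rk g) = (phi i \in sources e rk f)].
Proof.
move=> phi_inj dE phiS /andP[/injectiveP f_inj /forallP f_e] g.
have gE i : g i = f (phi i) by rewrite ffunE.
have [psi phiK psiK] : bijective phi by exact: injF_bij.
have phiP i : phi (i - pos 1)%R = (phi i - d)%R.
  by rewrite -[in RHS](subrK (pos 1) i) phiS addrK.
split.
- apply/andP; split; first by apply/injectiveP => i j; rewrite !gE => /f_inj/phi_inj.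
  apply/forallP => i; rewrite !gE phiS; case: dE => ->; first exact: f_e.
  by rewrite e_sym; have := f_e (phi i - pos 1)%R; rewrite subrK.
- apply/setP => x; apply/imsetP/imsetP => -[i _ ->]; first by exists (psi i); rewrite ?gE ?psiK.
  by exists (phi i); rewrite ?gE.
- apply/setP => x; apply/imsetP/imsetP => -[i _ ->].
    case: dE => dE.
      by exists (psi i); rewrite // !gE phiS psiK dE.
    exists (psi (i + pos 1)%R); rewrite // !gE phiS psiK dE addrK.
    by rewrite setUC.
  case: dE => dE; first by exists (phi i); rewrite // !gE phiS dE.
  by exists (phi i - pos 1)%R; rewrite // !gE phiS dE subrK setUC.
- move=> i; rewrite !inE !gE phiS phiP; case: dE => -> //.
  by rewrite opprK andbC.
Qed.

Lemma pos_double2S : pos m'.+1.*2.+2 = (- pos 1)%R.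
Proof.
apply/eqP; rewrite -addr_eq0 -posS; apply/eqP.
by have := posk m'; rewrite -[m'.+2.*2]/(m'.+1.*2.+2).
Qed.

(** The m blocks {0, 1, 2}, {3, 4}, ..., {2m - 1, 2m} contain at most one source each, hence exactly
    one. In the first block it is 0. In the last it cannot be 2m, which is next to 0; and 2j + 2 is
    excluded by the source 2j + 3 of the following block. *)
Lemma canonical_of_sources g : embedding e g -> #|sources e rk g| = m ->
  pos 1 \notin sources e rk g -> pos 2 \notin sources e rk g -> o (g (pos 1)) (g (pos 2)) ->
  canonical g.
Proof.
move=> eg Qm n1 n2 o12; set Q := sources e rk g in Qm n1 n2 *.
have nextQ i : i \in Q -> (i + pos 1)%R \notin Q by exact: sources_next.
have mk : m < k by rewrite ltnS -addnn leq_addr.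
(* The truncated predecessor puts position 0 into the first block too. *)
pose cl i : 'I_m := inord (nat_of_ord i).-1./2.
have cl_lt i : (nat_of_ord i).-1./2 < m.
  have := ltn_ord i; have := half_bounds (nat_of_ord i).-1; rewrite -!muln2.
  move: ((nat_of_ord i).-1./2) (nat_of_ord i) => h n; clear. lia.
have cl_inj : {in Q &, injective cl}.
  move=> i i' iQ iQ' /(congr1 val); rewrite /= !inordK //.
  wlog le : i i' iQ iQ' / nat_of_ord i <= nat_of_ord i'.
    by move=> H h; case: (leqP (nat_of_ord i) (nat_of_ord i')) => [|/ltnW] le; [apply: H|apply/esym/H].
  move=> E; apply/eqP; apply: contraT => ne.
  have ne' : nat_of_ord i != nat_of_ord i' by rewrite -val_eqE in ne.
  have i1 : nat_of_ord i != 1.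
    by apply: contraNneq n1 => v1; rewrite -v1 (pos_val i).
  have i2 : nat_of_ord i != 2.
    by apply: contraNneq n2 => v2; rewrite -v2 (pos_val i).
  have i'1 : nat_of_ord i' != 1.
    by apply: contraNneq n1 => v1; rewrite -v1 (pos_val i').
  have i'2 : nat_of_ord i' != 2.
    by apply: contraNneq n2 => v2; rewrite -v2 (pos_val i').
  have S : nat_of_ord i' = (nat_of_ord i).+1.
    have := half_bounds (nat_of_ord i).-1; have := half_bounds (nat_of_ord i').-1; rewrite -E -!muln2.
    move: le ne' i1 i2 i'1 i'2; move: ((nat_of_ord i).-1./2) (nat_of_ord i) (nat_of_ord i') => h a b; clear; lia.
  have /negP := nextQ i iQ; case; rewrite -(pos_val i) -posS.
  by have := pos_val i'; rewrite S => ->.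
have cl_onto j : exists2 i, i \in Q & cl i = j.
  have : #|cl @: Q| = m by rewrite card_in_imset.
  move=> cm; have /eqP E : cl @: Q == setT by rewrite eqEcard subsetT cardsT card_ord cm leqnn.
  have : j \in cl @: Q by rewrite E inE.
  by case/imsetP=> i iQ ->; exists i.
have cl_val i j : cl i = j -> (nat_of_ord i).-1./2 = j.
  by move=> /(congr1 val); rewrite /= inordK.
have not1 i : i \in Q -> nat_of_ord i != 1.
  by move=> iQ; apply: contraNneq n1 => v1; rewrite -v1 (pos_val i).
have not2 i : i \in Q -> nat_of_ord i != 2.
  by move=> iQ; apply: contraNneq n2 => v1; rewrite -v1 (pos_val i).
have Q0 : pos 0 \in Q.
  have [i iQ /cl_val /= ij] := cl_onto ord0; rewrite -(pos_val i) in iQ.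
  have := not1 _ iQ; have := not2 _ iQ; rewrite pos_val.
  move=> h2 h1; suff i0 : nat_of_ord i = 0 by rewrite i0 in iQ.
  have := half_bounds (nat_of_ord i).-1; rewrite ij -!muln2.
  by move: h1 h2; move: (nat_of_ord i) => a; clear; lia.
(* A descent from the last block, written as induction on the distance t to it. *)
have Qodd (t j : nat) : j + t = m'.+1 -> 0 < j -> pos j.*2.+1 \in Q.
  elim: t j => [|t IH] j jt j0.
    have jm : j < m by rewrite -(addn0 j) jt.
    have [i iQ /cl_val /= ij] := cl_onto (Ordinal jm).
    have := not1 _ iQ; have := not2 _ iQ => h2 h1.
    have [E|E] : nat_of_ord i = j.*2.+1 \/ nat_of_ord i = j.*2.+2.
      have := half_bounds (nat_of_ord i).-1; rewrite ij -!muln2.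
      by move: h1 h2 j0; move: (nat_of_ord i) => a; clear; lia.
      by rewrite -E pos_val.
    rewrite addn0 in jt; rewrite jt in E.
    have := nextQ i iQ; rewrite -(pos_val i) E pos_double2S addNr -(pos0 m').
    by rewrite Q0.
  have jm : j < m by rewrite -ltnS; move: jt; clear; lia.
  have [i iQ /cl_val /= ij] := cl_onto (Ordinal jm).
  have := not1 _ iQ; have := not2 _ iQ => h2 h1.
  have [E|E] : nat_of_ord i = j.*2.+1 \/ nat_of_ord i = j.*2.+2.
    have := half_bounds (nat_of_ord i).-1; rewrite ij -!muln2.
    by move: h1 h2 j0; move: (nat_of_ord i) => a; clear; lia.
    by rewrite -E pos_val.
  have := nextQ i iQ; rewrite -(pos_val i) E -posS.
  have H : pos (j.+1).*2.+1 \in Q by apply: IH; rewrite // addSnnS.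
  by rewrite (doubleS j) in H; rewrite H.
have Qo n : pos n \in Q -> o (g (pos n)) (g (pos n.+1)) /\ o (g (pos n)) (g (pos n - pos 1)%R).
  by rewrite /Q inE (posS _ n) => /andP.
have Qo' n : pos n.+1 \in Q -> o (g (pos n.+1)) (g (pos n)).
  by move=> /Qo[_]; rewrite (posS _ n) addrK.
have Qj j : j != ord0 -> pos j.*2.+1 \in Q.
  move=> j0; apply: (Qodd (m'.+1 - j)); first by rewrite subnKC // -ltnS ltn_ord.
  by rewrite lt0n; apply: contraNneq j0 => h; apply/eqP/val_inj.
apply/and4P; split.
- by have [] := Qo 0 Q0.
- by [].
- apply/forallP => j; rewrite /source_of /sink_of.
  case: (ltnP j m'.+1) => jm.
    have -> : (ordS j == ord0) = false.
      by apply/negbTE/negP => /eqP/(congr1 val); rewrite /= modn_small.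
    rewrite [val (ordS j)]/= modn_small //.
    apply: Qo'; have := Qj (ordS j); rewrite /= modn_small //; apply.
    by apply/negP => /eqP/(congr1 val); rewrite /= modn_small.
  have jE : val j = m'.+1 by apply/eqP; rewrite eqn_leq jm -ltnS ltn_ord.
  have -> : ordS j == ord0 by apply/eqP/val_inj; rewrite /= jE modnn.
  rewrite jE pos_double2S; have [_] := Qo 0 Q0.
  by rewrite pos0 sub0r.
- apply/forallP => j; apply/implyP => j0; rewrite /source_of (negbTE j0) /sink_of.
  by have [] := Qo _ (Qj j j0).
Qed.

(** The sources and their successors fill at most 2m of the 2m + 1 positions, so for some a neither
    a - 1 nor a is a source. The direction of the edge between them decides whether to rotate or to
    reflect. *)
Lemma canonical_exists f : embedding e f -> #|sources e rk f| = m -> exists g,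
  [/\ embedding e g, f @: [set: 'I_k] = g @: [set: 'I_k], edge_image f = edge_image g & canonical g].
Proof.
move=> ef Qm; set Q := sources e rk f in Qm *.
have [a aQ aQ'] : exists2 a, a \notin Q & (a - pos 1)%R \notin Q.
  have : #|Q :|: [set (i + pos 1)%R | i in Q]| < k.
    apply: leq_ltn_trans (leq_card_setU _ _) _.
    by rewrite card_imset ?Qm ?addnn //; exact: addIr.
  move=> lt; have /subsetPn[a _] : ~~ ([set: 'I_k] \subset Q :|: [set (i + pos 1)%R | i in Q]).
    by apply: contraL lt => /subset_leq_card; rewrite cardsT card_ord leqNgt.
  rewrite in_setU negb_or => /andP[aQ aQ']; exists a => //.
  by apply: contra aQ' => h; apply/imsetP; exists (a - pos 1)%R; rewrite ?subrK.
have card_pre (phi : 'I_k -> 'I_k) (S : {set 'I_k}) : injective phi ->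
    (forall i, (i \in S) = (phi i \in Q)) -> #|S| = m.
  move=> inj H; apply: etrans Qm.
  have [psi phiK psiK] := injF_bij inj.
  rewrite -(card_imset (mem S) inj); apply: eq_card => i.
  apply/imsetP/idP => [[i' iS ->]|iQ]; first by rewrite -H.
  by exists (psi i); rewrite ?psiK // H psiK.
have pos2 : pos 2 = (pos 1 + pos 1)%R by exact: posS.
have := embedding_edge e_sym rk_inj (a - pos 1)%R ef; rewrite subrK.
case oa : (o (f (a - pos 1)%R) (f a)) => /= oa'.
  pose phi i := (i + (a - pos 2))%R.
  have inj : injective phi by exact: addIr.
  have [|//|eg h1 h2 h3] := reindex_walk inj (d := pos 1) _ _ ef; first by left.
    by move=> i; rewrite /phi addrAC.
  have p1 : phi (pos 1) = (a - pos 1)%R by rewrite /phi pos2 opprD !addrA [(pos 1 + a)%R]addrC addrK.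
  have p2 : phi (pos 2) = a by rewrite /phi addrC subrK.
  exists [ffun i => f (phi i)]; split=> //; apply: canonical_of_sources => //.
  - exact: card_pre h3.
  - by rewrite h3 p1.
  - by rewrite h3 p2.
  - by rewrite !ffunE p1 p2.
pose phi i := (a + pos 1 - i)%R.
have inj : injective phi by move=> i i' /addrI/oppr_inj.
have [|//|eg h1 h2 h3] := reindex_walk inj (d := (- pos 1)%R) _ _ ef; first by right.
  by move=> i; rewrite /phi opprD addrA.
have p1 : phi (pos 1) = a by rewrite /phi addrK.
have p2 : phi (pos 2) = (a - pos 1)%R by rewrite /phi pos2 opprD addrA addrK.
exists [ffun i => f (phi i)]; split=> //; apply: canonical_of_sources => //.
- exact: card_pre h3.
- by rewrite h3 p1.
- by rewrite h3 p2.
- by rewrite !ffunE p1 p2.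
Qed.

End Canonical.
End CanonicalFacts.

(** * Counting canonical copies through their hubs *)

Module TriplesFacts.
From mathcomp Require Import all_boot all_order all_algebra.
From mathcomp Require Import ring lra zify.
Import HalfPlaneFacts MinorsFacts DegeneracyFacts AttachmentFacts BundlesFacts FewNeighboursFacts WeightsFacts ClosedWalksFacts CanonicalFacts.
Import GRing.Theory.

Lemma card_fibre_sum (S S' : finType) (h : S -> S') (X : {set S}) :
  #|X| = \sum_y #|[set x in X | h x == y]|.
Proof.
rewrite -sum1_card (partition_big h predT) //=.
by apply: eq_bigr => y _; rewrite -sum1_card; apply: eq_bigl => x; rewrite inE.
Qed.

Section Triples.
Variables (T : finType) (e : rel T) (rk : T -> nat) (m' : nat).
Hypothesis e_sym : symmetric e.
Hypothesis rk_inj : injective rk.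
Hypothesis out14 : forall x, #|[set y | orient e rk x y]| <= 14.
Local Notation o := (orient e rk).
Local Notation m := m'.+2.
Local Notation k := (m.*2.+1).
Local Notation pos := (@pos m').
Local Notation triple := ({ffun 'I_m -> T} * T * {ffun 'I_m -> T})%type.
Implicit Types (f g : {ffun 'I_k -> T}) (i : 'I_k) (j l : 'I_m) (c : triple)
  (s b : {ffun 'I_m -> T}) (w x y u v : T).

Definition sources_of c := c.1.1.
Definition pass_of c := c.1.2.
Definition sinks_of c := c.2.

(** A canonical embedding cut into sources, pass vertex and sinks. Besides the directed edges,
    distinctness is kept where it is used later: among the sinks and the pass vertex, which are to
    become the hubs of a cycle or a path. *)
Definition triples : {set triple} := [set c |
  [&& o (sources_of c ord0) (pass_of c), o (pass_of c) (sinks_of c ord0),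
      [forall j, o (sources_of c (ordS j)) (sinks_of c j)],
      [forall j, (j != ord0) ==> o (sources_of c j) (sinks_of c j)] &
      injectiveb (sinks_of c) && [forall j, sinks_of c j != pass_of c]]].

Lemma triplesP c : c \in triples -> [/\ o (sources_of c ord0) (pass_of c),
  o (pass_of c) (sinks_of c ord0), forall j, o (sources_of c (ordS j)) (sinks_of c j),
  forall j, j != ord0 -> o (sources_of c j) (sinks_of c j) &
  injective (sinks_of c) /\ forall j, sinks_of c j != pass_of c].
Proof.
rewrite inE => /and5P[-> -> /forallP h3 /forallP h4 /andP[/injectiveP h5 /forallP h6]].
by split=> // j; apply/implyP.
Qed.

Lemma card_canonical : #|[set g : {ffun 'I_k -> T} | embedding e g && canonical e rk g]| <= #|triples|.
Proof.
pose enc g : triple := ([ffun j => source_of g j], g (pos 1), [ffun j => sink_of g j]).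
have enc_inj : injective enc.
  move=> f g [/ffunP Es E1 /ffunP Eb]; apply/ffunP => i.
  have {Es} Es j : source_of f j = source_of g j by have := Es j; rewrite !ffunE.
  have {Eb} Eb j : sink_of f j = sink_of g j by have := Eb j; rewrite !ffunE.
  rewrite -(pos_val i); move: (ltn_ord i); case: (nat_of_ord i) => [|n] nk.
    by have := Es ord0; rewrite /source_of eqxx.
  have jm : n./2 < m.
    by have := half_bounds n; move: nk; rewrite -!muln2; move: (n./2) => h; clear; lia.
  have := odd_double_half n; case: (odd n) => /= nE.
    by have := Eb (Ordinal jm); rewrite /sink_of -[(Ordinal jm).*2.+2]/((1 + n./2.*2).+1) nE.
  rewrite add0n in nE.
  case: (eqVneq (Ordinal jm) ord0) => [j0|j0].
    have n0 : n./2 = 0 by rewrite -[n./2]/(nat_of_ord (Ordinal jm)) j0.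
    by rewrite -nE n0.
  by have := Es (Ordinal jm); rewrite /source_of (negbTE j0) /= nE.
rewrite -(card_imset _ enc_inj); apply: subset_leq_card; apply/subsetP => z /imsetP[g].
rewrite inE => /andP[/andP[/injectiveP g_inj _] /and4P[h1 h2 /forallP h3 /forallP h4]] ->.
have k1 : 1 < k by [].
rewrite inE /sources_of /pass_of /sinks_of /= !ffunE h1 h2 /=.
apply/and4P; split.
- by apply/forallP => j; rewrite !ffunE.
- by apply/forallP => j; rewrite !ffunE.
- apply/injectiveP => j l; rewrite !ffunE /sink_of => /g_inj/pos_inj E; apply: val_inj => /=.
  have b (j0 : 'I_m) : j0.*2.+2 < k by have := ltn_ord j0; rewrite -!muln2; clear; lia.
  by have := E (b j) (b l); rewrite -!muln2; clear; lia.
- apply/forallP => j; rewrite !ffunE; apply/negP => /eqP /g_inj/pos_inj E.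
  have b : j.*2.+2 < k by have := ltn_ord j; rewrite -!muln2; clear; lia.
  by have := E b k1.
Qed.

(** Every sink and the pass vertex are out-neighbours of something already known once the sources
    are fixed, so they cost a factor 14 each. *)
Lemma card_triples_sources (X : {set triple}) : X \subset triples ->
  #|X| <= 14 ^ m * (14 * #|sources_of @: X|).
Proof.
move=> /subsetP sX.
apply: (@leq_trans (14 ^ m * #|(fun c => c.1) @: X|)).
  apply: leq_card_fibres => -[s w].
  set F := [set c in X | _].
  have : {in F &, injective sinks_of}.
    by move=> [c1 c2] [c1' c2']; rewrite !inE => /andP[_ /eqP/= ->] /andP[_ /eqP/= ->] /= ->.
  move=> inj; rewrite -(card_in_imset inj).
  rewrite -[m in 14 ^ m](card_ord m) -prod_nat_const.
  apply: (leq_card_family (S := fun j => [set y | o (s (ordS j)) y])) => // b j.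
  case/imsetP=> c; rewrite !inE => /andP[cX /eqP cE] ->.
  by have [_ _ /(_ j) h _ _] := triplesP (sX c cX); rewrite /sources_of cE in h.
rewrite leq_mul2l; apply/orP; right.
apply: (@leq_trans (14 * #|(fun c : {ffun 'I_m -> T} * T => c.1) @: ((fun c : triple => c.1) @: X)|)).
  apply: leq_card_fibres => s; apply: leq_trans (out14 (s ord0)).
  set F := [set c in _ | _].
  have inj : {in F &, injective (fun c : {ffun 'I_m -> T} * T => c.2)}.
    by move=> [c1 c2] [c1' c2']; rewrite !inE => /andP[_ /eqP/= ->] /andP[_ /eqP/= ->] /= ->.
  rewrite -(card_in_imset inj); apply: subset_leq_card; apply/subsetP => y.
  case/imsetP=> c /setIdP[/imsetP[c' cX ->] /eqP cE] ->; rewrite inE -cE.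
  by have [] := triplesP (sX c' cX).
by rewrite leq_mul2l /= -imset_comp.
Qed.

Lemma card_ffun_off (l : 'I_m) (X : {set {ffun 'I_m -> T}}) N :
  (forall s, #|[set (s' : {ffun 'I_m -> T}) l | s' in X & [forall j, (j != l) ==> (s' j == s j)]]| <= N) ->
  #|X| <= N * #|T| ^ m.-1.
Proof.
move=> HN.
pose h s : {ffun 'I_m.-1 -> T} := [ffun j => s (lift l j)].
apply: (@leq_trans (N * #|h @: X|)); last first.
  by rewrite leq_mul2l (leq_trans (max_card _)) ?orbT // card_ffun card_ord.
apply: leq_card_fibres => t; set F := [set s in X | _].
have [->|/set0Pn[s0]] := eqVneq F set0; first by rewrite cards0.
rewrite inE => /andP[s0X /eqP h0].
have agree s j : s \in F -> j != l -> s j = s0 j.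
  rewrite inE => /andP[_ /eqP hs]; rewrite eq_sym => /unlift_some[j' -> _].
  by have := congr1 (fun q : {ffun 'I_m.-1 -> T} => q j') (etrans hs (esym h0)); rewrite !ffunE.
have inj : {in F &, injective (fun s => s l)}.
  move=> s s' sF s'F E; apply/ffunP => j; case: (eqVneq j l) => [->//|jl].
  by rewrite (agree s) // (agree s').
rewrite -(card_in_imset inj); apply: leq_trans (HN s0); apply: subset_leq_card.
apply/subsetP => _ /imsetP[s sF ->]; apply/imsetP; exists s => //.
rewrite inE; apply/andP; split; first by move: sF; rewrite inE => /andP[].
by apply/forallP => j; apply/implyP => jl; apply/eqP; apply: agree.
Qed.

(** Fix all sources except the one following j. The sink j is an out-neighbour of source j, or of
    the pass vertex when j = 0, so it has at most 14 + 14 * 14 = 210 candidates. Outside [B0] a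
    candidate has at most D neighbours, and the missing source is among them. *)
Lemma card_sink_outside (B0 : {set T}) D j :
  (forall x, x \notin B0 -> #|[set y | e x y]| <= D) ->
  #|[set c in triples | sinks_of c j \notin B0]| <=
  14 ^ m * (14 * (210 * D * #|T| ^ m.-1)).
Proof.
move=> HD; apply: leq_trans (card_triples_sources _) _.
  by apply/subsetP => c; rewrite inE => /andP[].
do 2 (rewrite leq_mul2l; apply/orP; right).
have Sj : ordS j != j.
  rewrite -val_eqE /=; case: (ltngtP j m'.+1) => jm.
  - by rewrite modn_small // neq_ltn ltnSn orbT.
  - by have := ltn_ord j; rewrite ltnNge jm.
  - by rewrite jm modnn.
apply: (card_ffun_off (l := ordS j)) => s.
pose C := [set y | o (s j) y] :|: \bigcup_(w in [set w | o (s ord0) w]) [set y | o w y].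
have C_le : #|C| <= 210.
  apply: leq_trans (leq_card_setU _ _) _; rewrite -[210]/(14 + 14 * 14) leq_add //.
  have cup (W : {set T}) : #|\bigcup_(w in W) [set y | o w y]| <= \sum_(w in W) 14.
    elim/big_rec2: _ => [|w n X _ IH]; first by rewrite cards0.
    by apply: leq_trans (leq_card_setU _ _) _; apply: leq_add.
  by apply: leq_trans (cup _) _; rewrite sum_nat_const leq_mul2r out14 orbT.
apply: (@leq_trans #|\bigcup_(b in C :\: B0) [set y | e b y]|).
  apply: subset_leq_card; apply/subsetP => z.
  case/imsetP=> s' /setIdP[/imsetP[c /setIdP[ct cB] ->] /forallP agr] ->.
  have [h1 h2 h3 h4 _] := triplesP ct.
  apply/bigcupP; exists (sinks_of c j); last first.
    by rewrite inE e_sym; have /andP[] := h3 j.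
  rewrite inE cB inE; case: (eqVneq j ord0) => j0; last first.
    have := h4 j j0; have := agr j; rewrite eq_sym Sj /= => /eqP ->.
    by rewrite inE => ->.
  apply/orP; right; apply/bigcupP; exists (pass_of c); rewrite inE ?j0 //.
  have := agr ord0; have := Sj; rewrite j0 eq_sym => -> /= /eqP <-.
  exact: h1.
have cup (W : {set T}) : (forall x, x \in W -> x \notin B0) ->
    #|\bigcup_(b in W) [set y | e b y]| <= \sum_(b in W) D.
  move=> HW; apply: (@leq_trans (\sum_(b in W) #|[set y | e b y]|)).
    elim/big_rec2: _ => [|w n X _ IH]; first by rewrite cards0.
    by apply: leq_trans (leq_card_setU _ _) _; rewrite leq_add2l.
  by apply: leq_sum => b /HW; apply: HD.
apply: leq_trans (cup _ _) _; first by move=> b; rewrite inE => /andP[].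
rewrite sum_nat_const leq_mul2r; apply/orP; right; apply: leq_trans C_le.
by rewrite subset_leq_card // subsetDl.
Qed.

Lemma card_source_in (Bad : {set T}) j :
  #|[set c in triples | sources_of c j \in Bad]| <=
  14 ^ m * (14 * (#|Bad| * #|T| ^ m.-1)).
Proof.
apply: leq_trans (card_triples_sources _) _.
  by apply/subsetP => c; rewrite inE => /andP[].
do 2 (rewrite leq_mul2l; apply/orP; right).
apply: (card_ffun_off (l := j)) => s; apply: subset_leq_card; apply/subsetP => z.
by case/imsetP=> s' /setIdP[/imsetP[c /setIdP[_ cB] ->] _] ->.
Qed.

Variables (B0 B1 : {set T}).
Local Notation good := (good e B1).

Definition last_ord : 'I_m := ord_max.
(** The factor at index 0 is left out: there the last and the first sink are linked through the pass
    vertex as well, which is treated separately. *)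
Definition chain_codeg b := \prod_(j < m | j != ord0) codeg e B1 (b (ord_pred j)) (b j).
Definition inside b := injectiveb b && [forall j, b j \in B0].

Definition main_triples := [set c in triples |
  [forall j, sinks_of c j \in B0] && [forall j, sources_of c j \in good]].

Lemma main_triplesP c : c \in main_triples -> [/\ c \in triples, inside (sinks_of c) &
  forall j, sources_of c j \in good].
Proof.
rewrite inE => /and3P[ct h1 /forallP h2]; split=> //; rewrite /inside h1 andbT.
by apply/injectiveP; have [_ _ _ _ []] := triplesP ct.
Qed.

Lemma codeg_source c j : c \in main_triples -> j != ord0 ->
  sources_of c j \in [set x in good | e x (sinks_of c (ord_pred j)) && e x (sinks_of c j)].
Proof.
move=> /main_triplesP[/triplesP[_ _ h3 h4 _] _ g] j0; rewrite inE g /=.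
have := h3 (ord_pred j); rewrite ord_predK => /andP[-> _].
by have /andP[-> _] := h4 j j0.
Qed.

Lemma last_source c : c \in main_triples -> e (sources_of c ord0) (sinks_of c last_ord).
Proof.
move=> /main_triplesP[/triplesP[_ _ h3 _ _] _ _].
have -> : ord0 = ordS last_ord by apply: val_inj; rewrite /= modnn.
by have /andP[] := h3 last_ord.
Qed.

(** Source 0 and the pass vertex, both outside [B1], form a ladder from the last sink to the first,
    while every other source is a common neighbour of two consecutive sinks. The hubs thus close up
    to a cycle. *)
Lemma card_type1 : #|[set c in main_triples | pass_of c \notin B1]| <=
  \sum_(b | inside b) ladders e rk B1 (b last_ord) (b ord0) * chain_codeg b.
Proof.
rewrite (card_fibre_sum sinks_of) [X in _ <= X]big_mkcond; apply: leq_sum => b _.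
set F := [set c in _ | _].
have FP c : c \in F -> [/\ c \in main_triples, pass_of c \notin B1 & sinks_of c = b].
  by case/setIdP=> /setIdP[h1 h2] /eqP h3.
clearbody F; case: (boolP (inside b)) => bi; last first.
  rewrite leqn0 cards_eq0; apply/eqP/setP => c; rewrite in_set0; apply/negP => /FP[cm _ cb].
  by move: bi; rewrite -cb; have [_ -> _] := main_triplesP cm.
rewrite (card_fibre_sum (fun c => (sources_of c ord0, pass_of c))) /ladders.
rewrite -(pair_bigA _ (fun x y => #|[set c in F | (sources_of c ord0, pass_of c) == (x, y)]|)) /=.
rewrite big_distrl [X in _ <= X]big_mkcond /=; apply: leq_sum => x _.
have emp x' y : (forall c, c \in F -> (sources_of c ord0, pass_of c) = (x', y) -> False) ->
    #|[set c in F | (sources_of c ord0, pass_of c) == (x', y)]| = 0.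
  move=> H; apply/eqP; rewrite cards_eq0; apply/eqP/setP => c; rewrite in_set0; apply/negP.
  by rewrite inE => /andP[cF /eqP]; apply: H.
case: ifP => xg; last first.
  apply/eq_leq/big1 => y _; apply: emp => c /FP[cm _ _] [cx _].
  by have [_ _ /(_ ord0)] := main_triplesP cm; rewrite cx xg.
rewrite big_distrl [X in _ <= X]big_mkcond /=; apply: leq_sum => y _.
case: ifP => yB; last first.
  by rewrite emp // => c /FP[_ cB _] [_ cy]; move: cB; rewrite cy yB.
case: (boolP [&& o x y, e x (b last_ord) & e y (b ord0)]) => H; last first.
  rewrite mul0n emp // => c /FP[cm _ cb] [cx cy]; move/negP: H; apply.
  have [ct _ _] := main_triplesP cm; have [h1 h2 _ _ _] := triplesP ct.
  rewrite cx cy in h1; rewrite cy cb in h2; rewrite h1 -cx -cb last_source //=.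
  by case/andP: h2; rewrite cb.
rewrite mul1n; set G := [set c in F | _].
have GP c : c \in G -> [/\ c \in F, sources_of c ord0 = x & pass_of c = y].
  by rewrite inE => /andP[cF /eqP[-> ->]].
have inj : {in G &, injective sources_of}.
  move=> [[s1 w1] b1] [[s2 w2] b2] /GP[/FP[_ _ /= E1] _ /= E2] /GP[/FP[_ _ /= E3] _ /= E4] /= E5.
  by move: E1 E2 E3 E4 E5; rewrite /sinks_of /sources_of /pass_of /= => -> -> -> -> ->.
rewrite -(card_in_imset inj) /chain_codeg.
have -> : \prod_(j < m | j != ord0) codeg e B1 (b (ord_pred j)) (b j) =
    \prod_(j < m) (if j == ord0 then 1 else codeg e B1 (b (ord_pred j)) (b j)).
  by rewrite big_mkcond; apply: eq_bigr => j _; case: eqP.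
apply: (leq_card_family (S := fun j => if j == ord0 then [set x] else
    [set z in good | e z (b (ord_pred j)) && e z (b j)])).
  move=> s j /imsetP[c /GP[/FP[cm _ cb] cx _] ->]; case: eqP => [->|/eqP j0].
    by rewrite inE cx.
  by rewrite -cb; apply: codeg_source.
by move=> j; case: eqP => _; rewrite ?cards1.
Qed.

(** Now the pass vertex w is itself in [B1]. Source 0 becomes a common neighbour of the last sink
    and w, and the copy runs along a path of m + 1 members of [B1] with a direct edge from w back to
    the first sink. *)
Lemma card_type2 : #|[set c in main_triples | pass_of c \in B1]| <=
  \sum_(b | inside b) \sum_(w | (w \in B1) && [forall j, b j != w])
    o w (b ord0) * (codeg e B1 (b last_ord) w * chain_codeg b).
Proof.
rewrite (card_fibre_sum sinks_of) [X in _ <= X]big_mkcond; apply: leq_sum => b _.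
set F := [set c in _ | _].
have FP c : c \in F -> [/\ c \in main_triples, pass_of c \in B1 & sinks_of c = b].
  by case/setIdP=> /setIdP[h1 h2] /eqP h3.
clearbody F; case: (boolP (inside b)) => bi; last first.
  rewrite leqn0 cards_eq0; apply/eqP/setP => c; rewrite in_set0; apply/negP => /FP[cm _ cb].
  by move: bi; rewrite -cb; have [_ -> _] := main_triplesP cm.
rewrite (card_fibre_sum pass_of) [X in _ <= X]big_mkcond; apply: leq_sum => y _.
have emp : (forall c, c \in F -> pass_of c = y -> False) -> #|[set c in F | pass_of c == y]| = 0.
  move=> H; apply/eqP; rewrite cards_eq0; apply/eqP/setP => c; rewrite in_set0; apply/negP.
  by rewrite inE => /andP[cF /eqP]; apply: H.
case: ifP => yB; last first.
  rewrite emp // => c /FP[cm cB cb] cy; rewrite -cy cB /= in yB.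
  have [ct _ _] := main_triplesP cm; have [_ _ _ _ [_ h]] := triplesP ct.
  by move/negP: yB; apply; apply/forallP => j; rewrite -cb h.
case oy : (o y (b ord0)); last first.
  rewrite emp // => c /FP[cm _ cb] cy; have [ct _ _] := main_triplesP cm.
  by have [_ h _ _ _] := triplesP ct; rewrite cy cb oy in h.
rewrite mul1n; set G := [set c in F | _].
have GP c : c \in G -> c \in F /\ pass_of c = y.
  by rewrite inE => /andP[cF /eqP ->].
have inj : {in G &, injective sources_of}.
  move=> [[s1 w1] b1] [[s2 w2] b2] /GP[/FP[_ _ /= E1] /= E2] /GP[/FP[_ _ /= E3] /= E4] /= E5.
  by move: E1 E2 E3 E4 E5; rewrite /sinks_of /sources_of /pass_of /= => -> -> -> -> ->.
rewrite -(card_in_imset inj) /chain_codeg.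
have -> : codeg e B1 (b last_ord) y * \prod_(j < m | j != ord0) codeg e B1 (b (ord_pred j)) (b j) =
    \prod_(j < m) (if j == ord0 then codeg e B1 (b last_ord) y
                   else codeg e B1 (b (ord_pred j)) (b j)).
  rewrite [RHS](bigD1 ord0) //=; congr (_ * _); apply: eq_bigr => j; by case: eqP.
apply: (leq_card_family (S := fun j => if j == ord0 then
    [set z in good | e z (b last_ord) && e z y] else
    [set z in good | e z (b (ord_pred j)) && e z (b j)])).
  move=> s j /imsetP[c /GP[/FP[cm _ cb] cy] ->]; case: eqP => [->|/eqP j0]; last first.
    by rewrite -cb; apply: codeg_source.
  have [ct _ g] := main_triplesP cm; rewrite inE g -cb last_source //= -cy.
  by have [/andP[] ] := triplesP ct.
by move=> j; case: eqP.
Qed.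

Lemma card_triples_le D : (forall x, x \notin B0 -> #|[set y | e x y]| <= D) ->
  #|triples| <= m * (14 ^ m * (14 * (210 * D * #|T| ^ m.-1))) +
    m * (14 ^ m * (14 * (#|~: good| * #|T| ^ m.-1))) +
    (#|[set c in main_triples | pass_of c \notin B1]| +
     #|[set c in main_triples | pass_of c \in B1]|).
Proof.
move=> HD.
pose XB := \bigcup_(j < m) [set c in triples | sinks_of c j \notin B0].
pose XS := \bigcup_(j < m) [set c in triples | sources_of c j \in ~: good].
have cup (F : 'I_m -> {set triple}) N : (forall j, #|F j| <= N) -> #|\bigcup_(j < m) F j| <= m * N.
  move=> HF; apply: (@leq_trans (\sum_(j < m) N)); last by rewrite sum_nat_const card_ord.
  apply: (big_rec2 (fun (X : {set triple}) n => #|X| <= n)) => [|j X n _ IH]; first by rewrite cards0.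
  by apply: leq_trans (leq_card_setU _ _) _; apply: leq_add.
apply: (@leq_trans #|XB :|: XS :|: ([set c in main_triples | pass_of c \notin B1] :|:
     [set c in main_triples | pass_of c \in B1])|).
  apply: subset_leq_card; apply/subsetP => c ct.
  case: (boolP (c \in XB)) => cB; first by rewrite 2!in_setU cB.
  case: (boolP (c \in XS)) => cS; first by rewrite 2!in_setU cS orbT.
  rewrite in_setU; apply/orP; right.
  have cm : c \in main_triples.
    rewrite inE ct /=; apply/andP; split; apply/forallP => j.
      by apply: contraNT cB => h; apply/bigcupP; exists j; rewrite // inE ct.
    by apply: contraNT cS => h; apply/bigcupP; exists j; rewrite // inE ct inE.
  by rewrite in_setU; apply/orP; case: (boolP (pass_of c \in B1)) => h; [right|left]; apply/setIdP.
apply: leq_trans (leq_card_setU _ _) _; apply: leq_add; last exact: leq_card_setU.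
apply: leq_trans (leq_card_setU _ _) _; apply: leq_add; apply: cup => j.
  exact: card_sink_outside.
exact: card_source_in.
Qed.

End Triples.
End TriplesFacts.

(** * Cycle and path sums of a weight, and walks grown from an edge *)

Module PathSumsFacts.
From mathcomp Require Import all_boot all_order all_algebra.
From mathcomp Require Import ring lra zify.
Import Order.TTheory GRing.Theory Num.Theory.
Local Open Scope ring_scope.

Section SeqSum.
Variables (K : realFieldType) (T : finType).
Implicit Types (f g : seq T -> K) (n : nat) (s : seq T).

Fixpoint seqsum n f : K :=
  if n is n'.+1 then \sum_x seqsum n' (fun s => f (x :: s)) else f [::].

Lemma eq_seqsum n f g : (forall s, size s = n -> f s = g s) -> seqsum n f = seqsum n g.
Proof.
elim: n f g => [|n IH] f g H /=; first exact: H.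
by apply: eq_bigr => x _; apply: IH => s sn; apply: H; rewrite /= sn.
Qed.

Lemma ler_seqsum n f g : (forall s, size s = n -> f s <= g s) -> seqsum n f <= seqsum n g.
Proof.
elim: n f g => [|n IH] f g H /=; first exact: H.
by apply: ler_sum => x _; apply: IH => s sn; apply: H; rewrite /= sn.
Qed.

Lemma seqsumD n f g : seqsum n (fun s => f s + g s) = seqsum n f + seqsum n g.
Proof. by elim: n f g => [|n IH] f g //=; rewrite -big_split; apply: eq_bigr => x _; rewrite IH. Qed.

Lemma seqsumZ n c f : seqsum n (fun s => c * f s) = c * seqsum n f.
Proof. by elim: n f => [|n IH] f //=; rewrite big_distrr; apply: eq_bigr => x _; rewrite IH. Qed.

Lemma seqsum0 n : seqsum n (fun=> 0) = 0.
Proof. by elim: n => [|n IH] //=; rewrite big1. Qed.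

Lemma seqsum_sum n (I : finType) (P : pred I) (F : I -> seq T -> K) :
  seqsum n (fun s => \sum_(i | P i) F i s) = \sum_(i | P i) seqsum n (F i).
Proof.
elim: n F => [|n IH] F //=; rewrite exchange_big; apply: eq_bigr => x _.
exact: (IH (fun i s => F i (x :: s))).
Qed.

Lemma seqsum_exchange n m (F : seq T -> seq T -> K) :
  seqsum n (fun s => seqsum m (F s)) = seqsum m (fun s' => seqsum n (F^~ s')).
Proof.
elim: n F => [|n IH] F //=; rewrite seqsum_sum; apply: eq_bigr => x _.
exact: (IH (fun s => F (x :: s))).
Qed.

Lemma seqsum_rcons n f : seqsum n.+1 f = seqsum n (fun s => \sum_x f (rcons s x)).
Proof.
elim: n f => [|n IH] f //.
rewrite [LHS]/= ; apply: eq_bigr => x _; rewrite -[LHS]/(seqsum n.+1 (fun s => f (x :: s))).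
by rewrite IH.
Qed.

Lemma seqsum_rev n f : seqsum n f = seqsum n (fun s => f (rev s)).
Proof.
elim: n f => [|n IH] f //; rewrite seqsum_rcons /= IH seqsum_sum.
by apply: eq_bigr => x _; apply: eq_seqsum => s _; rewrite rev_cons.
Qed.

End SeqSum.

Section Functional.
Variables (K : realFieldType) (T : finType).
Implicit Types (M p : T -> T -> K) (x y z : T) (s U : seq T).

Fixpoint pw M x s : K := if s is y :: s' then M x y * pw M y s' else 1.
Fixpoint ecnt p x s : K := if s is y :: s' then p x y + ecnt p y s' else 0.

Definition ecnts p s : K := if s is x :: s' then ecnt p x s' else 0.
Definition closing p s : K := if s is x :: s' then p (last x s') x else 0.
Definition pws M s : K := if s is x :: s' then pw M x s' else 1.
Definition cws M s : K := if s is x :: s' then pw M x s' * M (last x s') x else 1.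

Definition path_sum n M := seqsum n.+1 (fun t => (uniq t)%:R * pws M t).
Definition cycle_sum n M := seqsum n.+1 (fun t => (uniq t)%:R * cws M t).

(** The two kinds of main copies with n + 1 sinks: cycles on n + 1 hubs and paths on n + 2 hubs. A
    path is read in two directions, but the edge between its ends is oriented in only one of them,
    hence the half. Both terms are homogeneous of degree n + 1. *)
Definition pc_sum n M := cycle_sum n M + path_sum n.+1 M / 2.

(** U lists the vertices already used. The last step closes up at the far end y or leaves to a new
    vertex; the ratio 2 to 1 is that of cycles to paths in [pc_sum]. *)
Fixpoint grow r x y U M : K :=
  if r is r'.+1 then \sum_(z | z \notin U) M x z * grow r' z y (z :: U) M
  else 2 * M x y + \sum_(z | z \notin U) M x z.

(** The x-end advances i steps before the y-end advances r; the call of [grow] swaps the ends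
    because the moving end comes first there. *)
Fixpoint grow2 i r x y U M : K :=
  if i is i'.+1 then \sum_(z | z \notin U) M x z * grow2 i' r z y (z :: U) M
  else grow r y x U M.

Lemma pw_rcons M x s y : pw M x (rcons s y) = pw M x s * M (last x s) y.
Proof. by elim: s x => [|z s IH] x /=; rewrite ?mul1r ?mulr1 // IH mulrA. Qed.

Lemma pw_cat M x s y s' : pw M x (s ++ y :: s') = pw M x s * M (last x s) y * pw M y s'.
Proof. by elim: s x => [|z s IH] x /=; rewrite ?mul1r // IH !mulrA. Qed.

Lemma pws_rcons M t y x : pws M (rcons (rcons t y) x) = pws M (rcons t y) * M y x.
Proof. by case: t => [|z t] /=; rewrite ?mul1r ?mulr1 // pw_rcons last_rcons. Qed.

Lemma pws_cat_rcons M t x s : pws M (rcons t x ++ s) = pws M (rcons t x) * pw M x s.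
Proof. by case: t => [|z t] /=; rewrite ?mul1r // cat_rcons pw_cat pw_rcons. Qed.

Lemma pws_rcons_rev M (M_sym : forall x y, M x y = M y x) x s :
  pws M (rcons (rev s) x) = pw M x s.
Proof.
elim: s x => [|y s IH] x //=.
by rewrite rev_cons pws_rcons IH mulrC M_sym.
Qed.

Lemma pws_rev M (M_sym : forall x y, M x y = M y x) t : pws M (rev t) = pws M t.
Proof. by case: t => [|x s] //; rewrite rev_cons pws_rcons_rev. Qed.

(** One edge of the word is marked and the word is cut there. The first piece is reversed later on,
    so that both pieces grow away from the marked edge. *)
Lemma ecnt_split n p (G : seq T -> K) :
  seqsum n.+1 (fun t => G t * ecnts p t) =
  \sum_(i < n) seqsum i (fun s1 => \sum_x \sum_y p x y *
     seqsum (n - i.+1) (fun s2 => G (s1 ++ x :: y :: s2))).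
Proof.
elim: n G => [|n IH] G /=.
  by rewrite big_ord0 big1 // => x _; rewrite mulr0.
rewrite big_ord_recl /= subSS subn0.
transitivity (\sum_x \sum_y p x y * seqsum n (fun s2 => G (x :: y :: s2)) +
   \sum_x seqsum n.+1 (fun t => G (x :: t) * ecnts p t)).
  rewrite -big_split; apply: eq_bigr => x _ /=; rewrite -big_split; apply: eq_bigr => y _ /=.
  by rewrite -seqsumZ -seqsumD; apply: eq_seqsum => s _; rewrite mulrDr [p x y * _]mulrC.
congr (_ + _).
transitivity (\sum_x \sum_(i < n) seqsum i (fun s1 => \sum_x1 \sum_y p x1 y *
     seqsum (n - i.+1) (fun s2 => G (x :: (s1 ++ x1 :: y :: s2))))).
  by apply: eq_bigr => x _; apply: (IH (fun t => G (x :: t))).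
by rewrite exchange_big; apply: eq_bigr => i _.
Qed.

Section Weighted.
Variables (M p : T -> T -> K).
Hypothesis M_sym : forall x y, M x y = M y x.
Hypothesis p_sym : forall x y, p x y = p y x.

Lemma pws_cat s1 x y s2 : pws M (rev s1 ++ x :: y :: s2) = pw M x s1 * M x y * pw M y s2.
Proof.
by rewrite -cat_rcons pws_cat_rcons pws_rcons_rev //= mulrA.
Qed.

Lemma cws_cat s1 x y s2 : cws M (rev s1 ++ x :: y :: s2) =
  pw M x s1 * M x y * pw M y s2 * M (last y s2) (last x s1).
Proof.
have := pws_cat s1 x y s2.
have hd : head x (rev s1 ++ x :: y :: s2) = last x s1.
  by case/lastP: s1 => [|s z] //; rewrite rev_rcons last_rcons.
have ls : last x (rev s1 ++ x :: y :: s2) = last y s2 by rewrite last_cat.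
have ne : rev s1 ++ x :: y :: s2 != [::] by case: (rev s1).
by case: (rev s1 ++ _) hd ls ne => [|z t] //= -> -> _ ->.
Qed.

Definition path_part i j := \sum_x \sum_y p x y * M x y *
  seqsum i (fun s1 => seqsum j (fun s2 => (uniq (catrev s1 (x :: y :: s2)))%:R *
     (pw M x s1 * pw M y s2))).
Definition cycle_part i j := \sum_x \sum_y p x y * M x y *
  seqsum i (fun s1 => seqsum j (fun s2 => (uniq (catrev s1 (x :: y :: s2)))%:R *
     (pw M x s1 * pw M y s2 * M (last y s2) (last x s1)))).

Lemma path_weighted n :
  seqsum n.+2 (fun t => ((uniq t)%:R * pws M t) * ecnts p t) =
  \sum_(i < n.+1) path_part i (n - i).
Proof.
rewrite (ecnt_split n.+1 p (fun t => (uniq t)%:R * pws M t)).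
apply: eq_bigr => i _; rewrite seqsum_rev /path_part seqsum_sum; apply: eq_bigr => x _.
rewrite seqsum_sum; apply: eq_bigr => y _; rewrite -seqsumZ; apply: eq_seqsum => s1 _.
rewrite subSS -!seqsumZ; apply: eq_seqsum => s2 _.
by rewrite catrevE pws_cat; ring.
Qed.

Lemma cycle_weighted n :
  seqsum n.+2 (fun t => ((uniq t)%:R * cws M t) * ecnts p t) =
  \sum_(i < n.+1) cycle_part i (n - i).
Proof.
rewrite (ecnt_split n.+1 p (fun t => (uniq t)%:R * cws M t)).
apply: eq_bigr => i _; rewrite seqsum_rev /cycle_part seqsum_sum; apply: eq_bigr => x _.
rewrite seqsum_sum; apply: eq_bigr => y _; rewrite -seqsumZ; apply: eq_seqsum => s1 _.
rewrite subSS -!seqsumZ; apply: eq_seqsum => s2 _.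
by rewrite catrevE cws_cat; ring.
Qed.

(** Rotating the word by one letter makes the closing edge the first edge, so it contributes once
    more the term with nothing before the marked edge. *)
Lemma cycle_closing n :
  seqsum n.+2 (fun t => ((uniq t)%:R * cws M t) * closing p t) =
  cycle_part 0 n.
Proof.
rewrite seqsum_rcons [LHS]/=; under eq_bigr do rewrite seqsum_sum.
rewrite exchange_big; apply: eq_bigr => x _; apply: eq_bigr => y _ /=.
rewrite -seqsumZ; apply: eq_seqsum => s _.
have /= -> : uniq (y :: rcons s x) = uniq (x :: y :: s) by rewrite -rcons_cons rcons_uniq.
rewrite last_rcons pw_rcons; ring.
Qed.

Lemma path_part_swap i j : path_part i j = path_part j i.
Proof.
rewrite /path_part exchange_big; apply: eq_bigr => x _; apply: eq_bigr => y _.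
rewrite p_sym M_sym seqsum_exchange; congr (_ * _).
apply: eq_seqsum => s1 _; apply: eq_seqsum => s2 _.
rewrite [pw M _ _ * _]mulrC; congr (_%:R * _).
rewrite !catrevE; congr nat_of_bool; apply: perm_uniq.
rewrite -[X in perm_eq _ X]revK perm_sym perm_rev rev_cat !rev_cons revK -!cats1 -!catA /=.
by rewrite perm_refl.
Qed.

Lemma grow_seqsum r x y U : uniq U -> grow r x y U M =
  seqsum r (fun s => (uniq (catrev s U))%:R * (pw M x s *
     (2 * M (last x s) y + \sum_(z | z \notin catrev s U) M (last x s) z))).
Proof.
elim: r x U => [|r IH] x U uU /=; first by rewrite uU !mul1r.
rewrite [LHS]big_mkcond; apply: eq_bigr => z _; case: ifP => zU.
  by rewrite IH /= ?zU // -seqsumZ; apply: eq_seqsum => s _; ring.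
rewrite -[LHS](@seqsum0 K T r); apply: eq_seqsum => s _.
by rewrite catrevE cat_uniq /= zU !andbF mul0r.
Qed.

Lemma grow2_seqsum i r x y U : uniq U -> grow2 i r x y U M =
  seqsum i (fun s1 => seqsum r (fun s2 => (uniq (catrev s2 (catrev s1 U)))%:R *
    (pw M x s1 * pw M y s2 * (2 * M (last y s2) (last x s1) +
      \sum_(z | z \notin catrev s2 (catrev s1 U)) M (last y s2) z)))).
Proof.
elim: i x U => [|i IH] x U uU /=.
  by rewrite grow_seqsum //; apply: eq_seqsum => s _; rewrite mul1r.
rewrite [LHS]big_mkcond; apply: eq_bigr => z _; case: ifP => zU.
  rewrite IH /= ?zU // -seqsumZ; apply: eq_seqsum => s1 _; rewrite -seqsumZ.
  by apply: eq_seqsum => s2 _; ring.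
rewrite -[LHS](@seqsum0 K T i); apply: eq_seqsum => s1 _.
rewrite -[LHS](@seqsum0 K T r); apply: eq_seqsum => s2 _.
by rewrite !catrevE !cat_uniq /= zU !andbF mul0r.
Qed.

(** The path part has one vertex more than the cycle part; its last letter on the y-side is the
    extra step of [grow], and the cycle supplies the closing term with factor 2. *)
Lemma parts_grow i r : (forall x, p x x = 0) ->
  cycle_part i r + path_part i r.+1 / 2 =
  (\sum_x \sum_y p x y * M x y * grow2 i r x y [:: x; y] M) / 2.
Proof.
move=> p0; suff <- : cycle_part i r * 2 + path_part i r.+1 =
  \sum_x \sum_y p x y * M x y * grow2 i r x y [:: x; y] M by field.
rewrite /cycle_part /path_part big_distrl -big_split; apply: eq_bigr => x _ /=.
rewrite big_distrl -big_split; apply: eq_bigr => y _ /=.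
have [->|xy] := eqVneq x y; first by rewrite p0 !mul0r addr0.
rewrite -mulrA -mulrDr grow2_seqsum /= ?inE ?xy //; congr (_ * _).
rewrite mulrC -seqsumZ -seqsumD; apply: eq_seqsum => s1 _.
rewrite -[X in _ + X]/(seqsum r.+1 (fun s2 =>
  (uniq (catrev s1 (x :: y :: s2)))%:R * (pw M x s1 * pw M y s2))).
rewrite -seqsumZ (seqsum_rcons r) -seqsumD; apply: eq_seqsum => s2 _.
have Eu : uniq (catrev s2 (catrev s1 [:: x; y])) = uniq (catrev s1 (x :: y :: s2)).
  rewrite !catrevE; apply: perm_uniq.
  by apply/permP => P; rewrite !count_cat /= !count_rev; lia.
rewrite Eu.
case: (boolP (uniq (catrev s1 (x :: y :: s2)))) => u; last first.
  rewrite !mul0r mulr0 add0r big1 // => z _.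
  suff /negbTE-> : ~~ uniq (catrev s1 (x :: y :: rcons s2 z)) by rewrite mul0r.
  move: u; rewrite !catrevE -!rcons_cons -rcons_cat rcons_uniq negb_and => ->.
  by rewrite orbT.
rewrite !mul1r mulrDr; congr (_ + _); first by ring.
rewrite [RHS]big_distrr [RHS]big_mkcond /=; apply: eq_bigr => z _.
rewrite catrevE -!rcons_cons -rcons_cat rcons_uniq -catrevE u andbT pw_rcons.
have -> : (z \notin catrev s1 [:: x, y & s2]) = (z \notin catrev s2 (catrev s1 [:: x; y])).
  by rewrite !catrevE !mem_cat !mem_rev !inE; congr (~~ _); case: (z == x) (z == y) (z \in s1) (z \in s2) => [] [] [] [].
by case: ifP; rewrite ?mul0r // mul1r mulrA.
Qed.
End Weighted.
End Functional.
End PathSumsFacts.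

(** * Optimality condition by thinning *)

Module PerturbationFacts.
From mathcomp Require Import all_boot all_order all_algebra.
From mathcomp Require Import ring lra zify.
Import PathSumsFacts.
Import Order.TTheory GRing.Theory Num.Theory.
Local Open Scope ring_scope.

Section Critical.
Variables (K : realFieldType) (T : finType).
Implicit Types (M p : T -> T -> K) (x y z : T) (s U : seq T).

Lemma expr_1sub_le (u : K) n : 0 <= u <= 1 ->
  (1 - u) ^+ n <= 1 - n%:R * u + n%:R ^+ 2 * u ^+ 2.
Proof.
move=> /andP[u0 u1]; elim: n => [|n IH]; first by rewrite expr0; lra.
rewrite exprSr; apply: le_trans (ler_wpM2r _ IH) _; first by lra.
rewrite -natr1; have n0 : 0 <= n%:R :> K by [].
have h1 := mulr_ge0 (mulr_ge0 n0 n0) (mulr_ge0 (mulr_ge0 u0 u0) u0).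
have h2 := mulr_ge0 n0 (mulr_ge0 u0 u0); have := mulr_ge0 u0 u0.
move: h1 h2; rewrite !expr2; nra.
Qed.

Lemma pw_ge0 M x s : (forall x y, 0 <= M x y) -> 0 <= pw M x s.
Proof. by move=> M0; elim: s x => [|y s IH] x //=; rewrite mulr_ge0. Qed.

Lemma ecnt_ge0 p x s : (forall x y, 0 <= p x y) -> 0 <= ecnt p x s.
Proof. by move=> p0; elim: s x => [|y s IH] x //=; rewrite addr_ge0. Qed.

Lemma ecnt_rcons p x s z : ecnt p x (rcons s z) = ecnt p x s + p (last x s) z.
Proof. by elim: s x => [|y s IH] x /=; rewrite ?addr0 ?add0r // IH addrA. Qed.

Definition feasible M :=
  [/\ forall x y, M x y = M y x, forall x y, 0 <= M x y & forall x, M x x = 0].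

Definition thin M p (d : K) x y := M x y * (1 - d * p x y).

Section Thin.
Variables (M p : T -> T -> K) (d : K).
Hypothesis M0 : forall x y, 0 <= M x y.
Hypothesis p0 : forall x y, 0 <= p x y <= 1.
Hypothesis d0 : 0 <= d <= 1.
Let p_ge0 x y : 0 <= p x y. Proof. by case/andP: (p0 x y). Qed.
Let dp x y : 0 <= d * p x y <= 1.
Proof. by case/andP: d0 (p0 x y) => ? ? /andP[? ?]; nra. Qed.

Lemma thin_ge0 x y : 0 <= thin M p d x y.
Proof. by rewrite mulr_ge0 //; have := dp x y; lra. Qed.

(** The Weierstrass inequality: a product of factors 1 - u is at least 1 minus the sum of the u. *)
Lemma pw_thin x s : pw M x s * (1 - d * ecnt p x s) <= pw (thin M p d) x s.
Proof.
elim: s x => [|y s IH] x /=; first by lra.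
have Ht := thin_ge0 x y.
apply: le_trans (ler_wpM2l Ht (IH y)).
rewrite /thin; have h : 0 <= M x y * pw M y s by rewrite mulr_ge0 ?pw_ge0.
have g : 0 <= d * p x y * (d * ecnt p y s).
  by case/andP: (dp x y) => ? _; rewrite mulr_ge0 // mulr_ge0 ?ecnt_ge0 //; case/andP: d0.
have := mulr_ge0 h g; lra.
Qed.

Lemma pws_thin t : pws M t * (1 - d * ecnts p t) <= pws (thin M p d) t.
Proof. by case: t => [|x s] /=; [lra | apply: pw_thin]. Qed.

Lemma cws_thin t : cws M t * (1 - d * (ecnts p t + closing p t)) <= cws (thin M p d) t.
Proof.
case: t => [|x s] /=; first by lra.
have := pw_thin x (rcons s x); rewrite !pw_rcons.
by rewrite ecnt_rcons.
Qed.
End Thin.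

Definition edge_count_sum n M p :=
  seqsum n.+2 (fun t => (uniq t)%:R * cws M t * (ecnts p t + closing p t)) +
  seqsum n.+3 (fun t => (uniq t)%:R * pws M t * ecnts p t) / 2.

Lemma pc_sum_thin n M p d : (forall x y, 0 <= M x y) -> (forall x y, 0 <= p x y <= 1) ->
  0 <= d <= 1 ->
  pc_sum n.+1 M - d * edge_count_sum n M p <= pc_sum n.+1 (thin M p d).
Proof.
move=> M0 p0 d0; rewrite /pc_sum /edge_count_sum /cycle_sum /path_sum.
have thin_sum k (f g h : seq T -> K) :
    (forall t, f t * (1 - d * g t) <= h t) ->
    seqsum k (fun t => (uniq t)%:R * f t) - d * seqsum k (fun t => (uniq t)%:R * f t * g t) <=
    seqsum k (fun t => (uniq t)%:R * h t).
  move=> H; rewrite -seqsumZ -mulN1r -seqsumZ -seqsumD; apply: ler_seqsum => t _.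
  by apply: le_trans (ler_wpM2l _ (H t)) => //; lra.
have := thin_sum n.+2 _ _ _ (cws_thin M0 p0 d0).
have := thin_sum n.+3 _ _ _ (pws_thin M0 p0 d0).
lra.
Qed.

Definition ssum M := \sum_x \sum_y M x y.

(** A one-sided optimality condition. Thinning by d loses at most d times the marked count G, while
    maximality and homogeneity bound the thinned value by F (1 - d P)^(n+2). Comparing the terms
    linear in d, as d tends to 0, gives the claim without a derivative. *)
Lemma edge_count_sum_ge n M p (F : K) : feasible M -> (forall x y, p x y = p y x) ->
  (forall x y, 0 <= p x y <= 1) -> ssum M = 2 ->
  (forall M', feasible M' -> pc_sum n.+1 M' <= F * (ssum M' / 2) ^+ n.+2) ->
  pc_sum n.+1 M = F -> 0 <= F ->
  n.+2%:R * F * (ssum (fun x y => p x y * M x y) / 2) <= edge_count_sum n M p.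
Proof.
move=> [Ms M0 Md] ps p0 M2 Fmax FM F0.
set P := ssum _ / 2; set G := edge_count_sum _ _ _.
have P01 : 0 <= P <= 1.
  apply/andP; split.
    rewrite divr_ge0 //; apply: sumr_ge0 => x _; apply: sumr_ge0 => y _.
    by rewrite mulr_ge0 //; case/andP: (p0 x y).
  rewrite ler_pdivrMr // mul1r -M2; apply: ler_sum => x _; apply: ler_sum => y _.
  by rewrite ler_piMl //; case/andP: (p0 x y).
have step d : 0 < d <= 1 -> n.+2%:R * F * P <= G + F * n.+2%:R ^+ 2 * d.
  move=> /andP[d0 d1]; have d01 : 0 <= d <= 1 by rewrite ltW.
  have ft : feasible (thin M p d).
    split=> [x y|x y|x]; rewrite /thin; first by rewrite Ms ps.
      exact: thin_ge0.
    by rewrite Md mul0r.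
  have := le_trans (pc_sum_thin n M0 p0 d01) (Fmax _ ft).
  have -> : ssum (thin M p d) / 2 = 1 - d * P.
    suff -> : ssum (thin M p d) = ssum M - d * ssum (fun x y => p x y * M x y).
      by rewrite M2 /P; lra.
    rewrite /ssum big_distrr -sumrB; apply: eq_bigr => x _ /=.
    rewrite big_distrr -sumrB; apply: eq_bigr => y _ /=; rewrite /thin; ring.
  have dP : 0 <= d * P <= 1 by case/andP: P01 => ? ?; nra.
  move/le_trans/(_ (ler_wpM2l F0 (expr_1sub_le n.+2 dP))).
  rewrite FM -/G => H.
  have hP : (d * P) ^+ 2 <= d ^+ 2.
    by rewrite exprMn ler_piMr ?sqr_ge0 // expr_le1 //; case/andP: P01.
  have h3 := ler_wpM2l (mulr_ge0 F0 (sqr_ge0 (n.+2%:R : K))) hP.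
  rewrite -(ler_pM2l d0); move: H h3; rewrite !expr2; move: (n.+2%:R) => N; lra.
rewrite leNgt; apply/negP => ltG.
set c := F * n.+2%:R ^+ 2 in step; have c0 : 0 <= c by rewrite mulr_ge0 ?sqr_ge0.
set e := n.+2%:R * F * P - G; have e0 : 0 < e by rewrite subr_gt0.
(* This d is at most 1 and makes the second-order error c d smaller than the supposed gap e. *)
have d01 : 0 < e / (2 * (e + c + 1)) <= 1.
  by rewrite divr_gt0 /= ?ler_pdivrMr ?mul1r; lra.
have := step _ d01; rewrite -/e.
have -> : n.+2%:R * F * P = e + G by rewrite subrK.
have : c * (e / (2 * (e + c + 1))) < e.
  rewrite mulrCA gtr_pMr // ltr_pdivrMr; lra.
lra.
Qed.

End Critical.
End PerturbationFacts.

(** * Thinning the heaviest edge *)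

Module HeaviestEdgeFacts.
From mathcomp Require Import all_boot all_order all_algebra.
From mathcomp Require Import ring lra zify.
Import PathSumsFacts PerturbationFacts.
Import Order.TTheory GRing.Theory Num.Theory.
Local Open Scope ring_scope.

Section MaxEdge.
Variables (K : realFieldType) (T : finType).
Implicit Types (M p : T -> T -> K) (x y z : T) (s U : seq T).

Lemma edge_count_sum_grow n M p : (forall x y, M x y = M y x) -> (forall x y, p x y = p y x) ->
  (forall x, p x x = 0) ->
  edge_count_sum n M p = (\sum_x \sum_y p x y * (M x y *
    (\sum_(i < n.+1) grow2 i (n - i) x y [:: x; y] M + grow2 0 n x y [:: x; y] M))) / 2.
Proof.
move=> Ms ps pd; rewrite /edge_count_sum path_weighted //.
under eq_seqsum do rewrite mulrDr.
rewrite seqsumD cycle_weighted // cycle_closing // [in X in _ + X]big_ord_recr /= subnn path_part_swap //.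
have -> (a b c d : K) : a + b + (c + d) / 2 = (a + c / 2) + (b + d / 2) by field.
rewrite parts_grow // mulr_suml -big_split /=.
under eq_bigr => i _.
  have -> : (n.+1 - i = (n - i).+1)%N by rewrite subSn // -ltnS.
  rewrite parts_grow //; over.
rewrite -mulr_suml -mulrDl; congr (_ / 2).
rewrite exchange_big -big_split; apply: eq_bigr => x _ /=.
rewrite exchange_big -big_split; apply: eq_bigr => y _ /=.
by rewrite -mulr_sumr -mulrDr mulrA.
Qed.

Definition edge_ind x0 y0 x y : K := (((x == x0) && (y == y0)) || ((x == y0) && (y == x0)))%:R.

Lemma delta_sum a b (G : T -> T -> K) :
  \sum_x \sum_y ((x == a) && (y == b))%:R * G x y = G a b.
Proof.
rewrite (bigD1 a) //= (bigD1 b) //= !eqxx mul1r [X in _ + X + _]big1 => [|y /negbTE->]; last first.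
  by rewrite mul0r.
by rewrite big1 => [|x /negbTE->]; rewrite ?addr0 // big1 // => y _; rewrite mul0r.
Qed.

Lemma edge_ind_sum x0 y0 (G : T -> T -> K) : x0 != y0 ->
  \sum_x \sum_y edge_ind x0 y0 x y * G x y = G x0 y0 + G y0 x0.
Proof.
move=> xy; rewrite -(delta_sum x0 y0) -(delta_sum y0 x0) -big_split; apply: eq_bigr => x _.
rewrite -big_split; apply: eq_bigr => y _ /=; rewrite -mulrDl -natrD /edge_ind.
have [->|/= _] := eqVneq x x0; rewrite ?add0n //.
by rewrite (negbTE xy) /= orbF addn0.
Qed.

Lemma ecnt_edge_ind x0 y0 x s : x0 != y0 ->
  ecnt (edge_ind x0 y0) x s <= (count (pred2 x0 y0) (x :: s)).-1%:R.
Proof.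
move=> xy; elim: s x => [|y s IH] x //=; apply: le_trans (lerD (lexx _) (IH y)) _ => /=.
rewrite /edge_ind -natrD ler_nat.
have [->|xx] := eqVneq x x0; have [->|yy] := eqVneq y y0; have [Ex|xy0] := eqVneq x y0;
  have [Ey|yx0] := eqVneq y x0; subst => //=; rewrite ?eqxx ?(negbTE xy) /=; lia.
Qed.

Lemma count_edge_ends x0 y0 t : uniq t -> (count (pred2 x0 y0) t <= 2)%N.
Proof.
move=> ut; rewrite -size_filter (@uniq_leq_size _ _ [:: x0; y0]) ?filter_uniq // => z.
by rewrite mem_filter !inE => /andP[].
Qed.

(** A cyclic word of at least three distinct letters passes a given edge at most once. With two
    letters the edge would coincide with the closing edge, hence the size condition. *)
Lemma cyclic_edge_ind x0 y0 t : x0 != y0 -> uniq t -> (2 < size t)%N ->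
  ecnts (edge_ind x0 y0) t + closing (edge_ind x0 y0) t <= 1.
Proof.
move=> xy; case: t => [|x s] // us s2; have cnt := count_edge_ends x0 y0 us.
have := ecnt_edge_ind x s xy; rewrite /= => He.
have [cl|/negbTE cl] := boolP (((last x s == x0) && (x == y0)) || ((last x s == y0) && (x == x0)));
    last first.
  rewrite {2}/edge_ind cl addr0 (le_trans He) // -[1]/(1%:R) ler_nat /=; move: cnt => /=; lia.
case/lastP: s => [|s z] // in us s2 cnt He cl *.
rewrite last_rcons in cl *; rewrite /edge_ind cl -/(edge_ind x0 y0) ecnt_rcons.
have hx : pred2 x0 y0 x by case/orP: cl => /andP[_ /eqP->]; rewrite /= eqxx ?orbT.
have hz : pred2 x0 y0 z by case/orP: cl => /andP[/eqP-> _]; rewrite /= eqxx ?orbT.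
have cs : count (pred2 x0 y0) s = 0%N.
  by move: cnt; rewrite /= -cats1 count_cat /= in hx hz *; rewrite hx hz; lia.
have := ecnt_edge_ind x s xy; rewrite /= in hx hz cs *; rewrite cs hx /= => e0.
suff -> : edge_ind x0 y0 (last x s) z = 0 by lra.
case/lastP: s s2 cs {us cnt He e0} => [|s w] // _; rewrite last_rcons -cats1 count_cat /= addn0.
move/eqP; rewrite addn_eq0 eqb0 negb_or /edge_ind => /and3P[_ /negbTE-> /negbTE->].
by [].
Qed.

(** One term for each of the n + 2 edges of a cycle or a path; the last place is folded back to i =
    0 by rotating the cycle and reversing the path. *)
Definition grow_sum n x y M :=
  \sum_(i < n.+1) grow2 i (n - i) x y [:: x; y] M + grow2 0 n x y [:: x; y] M.

Lemma max_edge n M (F : K) : feasible M -> ssum M = 2 ->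
  (forall M', feasible M' -> pc_sum n.+1 M' <= F * (ssum M' / 2) ^+ n.+2) ->
  pc_sum n.+1 M = F -> 0 < F ->
  exists x y, [/\ x != y, forall u v, M u v <= M x y, (0 < n)%N -> n.+2%:R * M x y <= 1 &
    n.+2%:R * F <= (grow_sum n x y M + grow_sum n y x M) / 2].
Proof.
move=> fM M2 Fmax FM F0; have [Ms M0 Md] := fM.
have [x0 _] : exists x0 : T, True.
  case: (pickP (fun _ : T => true)) => [x _|T0]; first by exists x.
  by move: M2; rewrite /ssum big_pred0 // => /eqP; rewrite eq_sym pnatr_eq0.
pose q := [arg max_(q > (x0, x0)) M q.1 q.2]%O.
have qP u v : M u v <= M q.1 q.2.
  by rewrite /q; case: arg_maxP => //= i _ /(_ (u, v)) ->.
have q0 : 0 < M q.1 q.2.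
  rewrite lt_neqAle M0 andbT eq_sym; apply/eqP => Mq.
  move: M2; rewrite /ssum big1 => [/eqP|x _]; first by rewrite eq_sym pnatr_eq0.
  by rewrite big1 // => y _; apply/le_anti; rewrite M0 -Mq qP.
have xy : q.1 != q.2 by apply/eqP => E; move: q0; rewrite E Md ltxx.
move: (q.1) (q.2) qP q0 xy => {q}x {x0}y qP q0 xy; exists x, y.
pose p := edge_ind x y.
have ps u v : p u v = p v u by rewrite /p /edge_ind; case: (u == x) (u == y) (v == x) (v == y) => [] [] [] [].
have p0 u v : 0 <= p u v <= 1 by rewrite /p /edge_ind; case: (_ || _); rewrite ?lexx ?ler01.
have pd u : p u u = 0.
  by rewrite /p /edge_ind; have [->|_] := eqVneq u x; rewrite ?(negbTE xy) /= ?andbF.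
have := edge_count_sum_ge fM ps p0 M2 Fmax FM (ltW F0).
have -> : ssum (fun u v => p u v * M u v) / 2 = M x y.
  by rewrite /ssum (edge_ind_sum M xy) (Ms y x); field.
move=> H.
split=> // [n0|].
  rewrite -(ler_pM2r F0) mul1r mulrAC (le_trans H) // -FM /edge_count_sum /pc_sum /cycle_sum /path_sum.
  have cut k (f g : seq T -> K) : (forall t, 0 <= f t) -> (forall t, uniq t -> size t = k -> g t <= 1) ->
      seqsum k (fun t => (uniq t)%:R * f t * g t) <= seqsum k (fun t => (uniq t)%:R * f t).
    move=> f0 g1; apply: ler_seqsum => t st; case: (boolP (uniq t)) => ut; last by rewrite !mul0r.
    by rewrite mul1r ler_piMr ?g1.
  apply: lerD.
    apply: (cut _ (cws M) (fun t => ecnts p t + closing p t)) => [[|z t] //=|t ut st].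
      by rewrite mulr_ge0 ?pw_ge0.
    by apply: cyclic_edge_ind => //; rewrite st.
  rewrite ler_pM2r ?invr_gt0 //; apply: (cut _ (pws M) (ecnts p)) => [[|z t] //=|t ut st].
    by rewrite pw_ge0.
  have := count_edge_ends x y ut; case: t {ut} st => [|z t] // _ ut.
  apply: le_trans (ecnt_edge_ind _ _ xy) _.
  rewrite -[1]/(1%:R) ler_nat; move: ut; move: (count _ _) => c; lia.
move: H; rewrite edge_count_sum_grow //.
rewrite (edge_ind_sum (fun u v => M u v * grow_sum n u v M)) // (Ms y x).
by rewrite -mulrDr [X in X <= _]mulrC -(mulrA (M x y)) ler_pM2l.
Qed.

End MaxEdge.
End HeaviestEdgeFacts.

(** * AM-GM bound for grown walks *)

Module GrowthFacts.
From mathcomp Require Import all_boot all_order all_algebra.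
From mathcomp Require Import ring lra zify.
Import PathSumsFacts PerturbationFacts HeaviestEdgeFacts.
Import Order.TTheory GRing.Theory Num.Theory.
Local Open Scope ring_scope.

Section GrowBound.
Variables (K : realFieldType) (T : finType).
Implicit Types (x y z : T) (s U : seq T).

Lemma mul_exp_le (a b : K) k : 0 <= a -> 0 <= b ->
  a * b ^+ k <= ((a + k%:R * b) / k.+1%:R) ^+ k.+1.
Proof.
move=> a0 b0; pose E (i : 'I_k.+1) := if i == ord0 then a else b.
have E0 : {in predT, forall i, 0 <= E i} by move=> i _; rewrite /E; case: ifP.
have [+ _] := leif_AGM E0; rewrite !big_ord_recl (_ : #|_| = k.+1); last by rewrite cardT size_enum_ord.
have EE (i : 'I_k) : true -> E (lift ord0 i) = b by [].
rewrite (eq_bigr _ EE) [X in _ + X](eq_bigr _ EE).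
by rewrite prodr_const sumr_const card_ord -[b *+ k]mulr_natl.
Qed.

Variable M : T -> T -> K.
Hypothesis fM : feasible M.
Let Ms x y : M x y = M y x. Proof. by case: fM. Qed.
Let M0 x y : 0 <= M x y. Proof. by case: fM. Qed.
Let Md x : M x x = 0. Proof. by case: fM. Qed.

Definition rest U x := \sum_(z | z \notin U) M x z.
Definition out U := (\sum_(a | a \notin U) rest U a) / 2.

Lemma rest_ge0 U x : 0 <= rest U x. Proof. exact: sumr_ge0. Qed.
Lemma out_ge0 U : 0 <= out U.
Proof. by rewrite divr_ge0 // sumr_ge0 // => z _; apply: rest_ge0. Qed.

Lemma rest_cons z U x : z \notin U -> rest (z :: U) x + M x z = rest U x.
Proof.
move=> zU; rewrite /rest [RHS](bigD1 z) //= addrC; congr (_ + _).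
by apply: eq_bigl => w; rewrite inE negb_or andbC.
Qed.

Lemma out_cons z U : z \notin U -> out (z :: U) + rest (z :: U) z = out U.
Proof.
move=> zU; rewrite /out [in RHS](bigD1 z) //=.
rewrite -(rest_cons z zU) Md addr0.
have -> : \sum_(a | (a \notin U) && (a != z)) rest U a =
    \sum_(a | a \notin z :: U) rest (z :: U) a + rest (z :: U) z.
  rewrite /rest [X in _ + X](eq_bigr (fun a => M a z)) => [|a _]; last exact: Ms.
  rewrite -big_split; apply: eq_big => [a|a /andP[aU _]]; first by rewrite inE negb_or andbC.
  by rewrite -/(rest U a) -(rest_cons a zU).
by field.
Qed.

Section Bound.
Variable t : K.
Hypothesis Mt : forall x y, M x y <= t.

(** The budget of a walk: the weight of the edges outside U together with those leaving U from the
    two current ends. *)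
Definition avail U x y := out U + rest U x + rest U y.

Lemma avail_cons z U x y : z \notin U ->
  avail (z :: U) z y + M z y = avail U x y - rest U x.
Proof.
by move=> zU; rewrite /avail -(out_cons zU) -(rest_cons y zU) [M z y]Ms; ring.
Qed.

Lemma t_ge0 x : 0 <= t. Proof. exact: le_trans (M0 x x) (Mt x x). Qed.

Lemma avail_ge0 U x y : 0 <= avail U x y.
Proof. by rewrite !addr_ge0 ?rest_ge0 ?out_ge0. Qed.

Lemma grow_ge0 r x y U : 0 <= grow r x y U M.
Proof.
elim: r x U => [|r IH] x U /=; first by rewrite addr_ge0 ?mulr_ge0 // sumr_ge0.
by apply: sumr_ge0 => z _; rewrite mulr_ge0.
Qed.

(** A step from x spends [rest U x] in total, and by [avail_cons] the budget after it, including the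
    chord from the new end to y, is smaller by exactly that amount. AM-GM of the spent part with r +
    1 copies of the rest restores the full budget. *)
Lemma sum_rest_le r (f : T -> K) U x y :
  (forall z, z \notin U -> f z <= ((avail (z :: U) z y + M z y + t) / r.+1%:R) ^+ r.+1) ->
  \sum_(z | z \notin U) M x z * f z <= ((avail U x y + t) / r.+2%:R) ^+ r.+2.
Proof.
move=> Hf; set b := (avail U x y - rest U x + t) / r.+1%:R.
have b0 : 0 <= b.
  by rewrite divr_ge0 // addr_ge0 ?(t_ge0 x) // /avail addrAC addrK addr_ge0 ?rest_ge0 ?out_ge0.
apply: (@le_trans _ _ (rest U x * b ^+ r.+1)).
  rewrite mulr_suml; apply: ler_sum => z zU; rewrite ler_wpM2l // (le_trans (Hf z zU)) //.
  by rewrite (avail_cons x y zU).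
apply: le_trans (mul_exp_le _ (rest_ge0 _ _) b0) _.
by rewrite /b [r.+1%:R * _]mulrC divfK ?pnatr_eq0 // addrA [rest U x + _]addrC subrK.
Qed.

Lemma grow_le r x y U : grow r x y U M <= ((avail U x y + M x y + t) / r.+1%:R) ^+ r.+1.
Proof.
elim: r x U => [|r IH] x U /=.
  have := Mt x y; have := out_ge0 U; have := rest_ge0 U y; rewrite /avail /rest expr1; lra.
have := @sum_rest_le r (fun z => grow r z y (z :: U) M) U x y (fun z _ => IH z (z :: U)).
move/le_trans; apply.
have := avail_ge0 U x y; have := M0 x y; have := t_ge0 x => h1 h2 h3.
by rewrite lerXn2r ?nnegrE ?divr_ge0 ?ler_pM2r ?invr_gt0 ?ltr0n //; lra.
Qed.

Lemma availC U x y : avail U x y = avail U y x.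
Proof. by rewrite /avail addrAC. Qed.

Lemma grow2_le i r x y U : grow2 i r x y U M <= ((avail U x y + M x y + t) / (i + r).+1%:R) ^+ (i + r).+1.
Proof.
elim: i x U => [|i IH] x U /=; first by rewrite availC Ms grow_le.
have := @sum_rest_le _ (fun z => grow2 i r z y (z :: U) M) U x y (fun z _ => IH z (z :: U)).
move/le_trans; apply.
have := avail_ge0 U x y; have := M0 x y; have := t_ge0 x => h1 h2 h3.
by rewrite lerXn2r ?nnegrE ?divr_ge0 ?ler_pM2r ?invr_gt0 ?ltr0n //; lra.
Qed.

(** After at least one step the chord between the ends is absorbed into the budget, so [M x y] no
    longer appears. For the heaviest edge the budget plus t is then half the total weight, by
    [avail2]. *)
Lemma grow2_lt i r x y U : (0 < i + r)%N ->
  grow2 i r x y U M <= ((avail U x y + t) / (i + r).+1%:R) ^+ (i + r).+1.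
Proof.
case: i => [|i] /= ir.
  case: r ir => // r _; rewrite availC; apply: sum_rest_le => // z zU; exact: grow_le.
by apply: sum_rest_le => // z zU; apply: grow2_le.
Qed.

End Bound.

Lemma avail2 x y : x != y -> avail [:: x; y] x y + M x y = ssum M / 2.
Proof.
move=> xy; have -> : ssum M / 2 = out [::].
  rewrite /ssum /out; congr (_ / 2); apply: eq_bigr => z _; rewrite /rest; exact: eq_bigl.
rewrite -(@out_cons y) // -(@out_cons x [:: y]) ?inE // /avail.
by rewrite -(@rest_cons x [:: y] y) ?inE // [M y x]Ms; ring.
Qed.

Lemma grow_sum_le n x y : (0 < n)%N -> x != y -> ssum M = 2 -> (forall u v, M u v <= M x y) ->
  grow_sum n x y M <= n.+2%:R * (n.+1%:R^-1) ^+ n.+1.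
Proof.
move=> n0 xy M2 Mt; have E : avail [:: x; y] x y + M x y = 1 by rewrite avail2 // M2 divff // pnatr_eq0.
have H i r : (i + r = n)%N -> grow2 i r x y [:: x; y] M <= (n.+1%:R^-1) ^+ n.+1.
  by move=> irn; have := @grow2_lt _ Mt i r x y [:: x; y]; rewrite E irn mul1r; apply.
rewrite /grow_sum -[n.+2%:R]natr1 mulrDl mul1r lerD ?H //.
apply: (@le_trans _ _ (\sum_(i < n.+1) (n.+1%:R^-1) ^+ n.+1)).
  by apply: ler_sum => i _; rewrite H // subnKC // -ltnS.
by rewrite sumr_const card_ord mulr_natl.
Qed.

End GrowBound.
End GrowthFacts.

(** * Exact walk sums for three and four hubs *)

Module ShortGrowthFacts.
From mathcomp Require Import all_boot all_order all_algebra.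
From mathcomp Require Import ring lra zify.
Import PathSumsFacts PerturbationFacts HeaviestEdgeFacts GrowthFacts.
Import Order.TTheory GRing.Theory Num.Theory.
Local Open Scope ring_scope.

Section Small.
Variables (K : realFieldType) (T : finType) (M : T -> T -> K).
Implicit Types (x y z : T) (s U : seq T).
Hypothesis fM : feasible M.
Let Ms x y : M x y = M y x. Proof. by case: fM. Qed.
Let M0 x y : 0 <= M x y. Proof. by case: fM. Qed.
Let Md x : M x x = 0. Proof. by case: fM. Qed.

Lemma grow_perm r x y U V : U =i V -> grow r x y U M = grow r x y V M.
Proof.
elim: r x U V => [|r IH] x U V UV /=.
  by congr (_ + _); apply: eq_bigl => z; rewrite UV.
apply: eq_big => [z|z _]; first by rewrite UV.
by congr (_ * _); apply: IH => w; rewrite !inE UV.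
Qed.

Lemma grow2_perm i r x y U V : U =i V -> grow2 i r x y U M = grow2 i r x y V M.
Proof.
elim: i x U V => [|i IH] x U V UV /=; first exact: grow_perm.
apply: eq_big => [z|z _]; first by rewrite UV.
by congr (_ * _); apply: IH => w; rewrite !inE UV.
Qed.

Variable U : seq T.
(** Extending the weights by zero on U turns sums over shrinking vertex sets into sums over the
    whole type, where they can be exchanged and compared. *)
Definition pr x z := if z \notin U then M x z else 0.
Definition mu z w := if z \notin U then pr z w else 0.
Definition row z := \sum_w mu z w.

Lemma pr_ge0 x z : 0 <= pr x z. Proof. by rewrite /pr; case: ifP. Qed.
Lemma mu_ge0 z w : 0 <= mu z w. Proof. by rewrite /mu; case: ifP; rewrite ?pr_ge0. Qed.
Lemma mu_sym z w : mu z w = mu w z.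
Proof. by rewrite /mu /pr Ms; case: (z \in U) (w \in U) => [] []. Qed.
Lemma mu_diag z : mu z z = 0. Proof. by rewrite /mu /pr Md !if_same. Qed.
Lemma row_ge0 z : 0 <= row z. Proof. by apply: sumr_ge0 => w _; apply: mu_ge0. Qed.

Lemma sum_pr x (f g : T -> K) : (forall z, z \notin U -> f z = g z) ->
  \sum_(z | z \notin U) M x z * f z = \sum_z pr x z * g z.
Proof.
move=> fg; rewrite big_mkcond; apply: eq_bigr => z _; rewrite /pr.
by case: ifP => zU; rewrite ?mul0r // fg // zU.
Qed.

Lemma sum_mu z (f g : T -> K) : z \notin U -> (forall w, w \notin z :: U -> f w = g w) ->
  \sum_(w | w \notin z :: U) M z w * f w = \sum_w mu z w * g w.
Proof.
move=> zU fg; rewrite big_mkcond; apply: eq_bigr => w _; rewrite /mu zU /pr.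
case: ifP => wU; first by rewrite fg //; move: wU; rewrite inE negb_or => /andP[_ ->].
case: ifP => [wU'|]; last by rewrite mul0r.
by move: wU; rewrite inE negb_or wU' andbT => /eqP->; rewrite Md mul0r.
Qed.

Lemma restE x : rest M U x = \sum_z pr x z.
Proof. by rewrite /rest big_mkcond. Qed.

Lemma rowE z : z \notin U -> row z = rest M U z.
Proof. by move=> zU; rewrite restE /row; apply: eq_bigr => w _; rewrite /mu zU. Qed.

Lemma outE : out M U = (\sum_z row z) / 2.
Proof.
rewrite /out big_mkcond; congr (_ / 2); apply: eq_bigr => z _.
case: ifP => zU; first by rewrite rowE.
by rewrite /row big1 // => w _; rewrite /mu zU.
Qed.

Lemma row_le_out z : row z <= out M U.
Proof.
have [zU|zU] := boolP (z \in U).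
  by rewrite /row big1 ?out_ge0 // => w _; rewrite /mu zU.
by rewrite rowE // -(rest_cons M z zU) Md addr0 -(out_cons fM zU) lerDr out_ge0.
Qed.

Lemma grow2_01 x y : grow2 0 1 x y U M = \sum_z pr y z * (2 * pr x z + row z).
Proof.
apply: sum_pr => z zU.
by rewrite rowE // -(rest_cons M z zU) Md addr0 /pr zU [M z x]Ms.
Qed.

Lemma grow2_10 x y : grow2 1 0 x y U M = \sum_z pr x z * (pr y z + \sum_w pr y w).
Proof.
apply: sum_pr => z zU /=; rewrite -restE -(rest_cons M y zU) /pr zU /rest; ring.
Qed.

Lemma rest_cons2 z w : z \notin U -> w \notin z :: U -> rest M (w :: z :: U) w = row w - mu z w.
Proof.
move=> zU wzU; have wU : w \notin U by move: wzU; rewrite inE negb_or => /andP[].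
rewrite rowE // -(rest_cons M w zU) -(rest_cons M w wzU) Md /mu /pr zU wU [M w z]Ms; ring.
Qed.

Lemma grow2_02 x y :
  grow2 0 2 x y U M = \sum_z pr y z * \sum_w mu z w * (2 * pr x w + row w - mu z w).
Proof.
apply: sum_pr => z zU; apply: sum_mu => // w wzU.
rewrite -/(rest M (w :: z :: U) w) rest_cons2 // /pr [M w x]Ms.
by move: wzU; rewrite inE negb_or => /andP[_ ->]; rewrite addrA.
Qed.

Lemma ler_sum_mu z y (f : T -> K) : z \notin U -> (forall w, 0 <= f w) ->
  \sum_(w | w \notin z :: U) M y w * f w <= \sum_w pr y w * f w.
Proof.
move=> zU f0; rewrite big_mkcond; apply: ler_sum => w _; rewrite /pr inE negb_or.
by case: eqVneq => //= _; rewrite ?mulr_ge0 //; case: ifP; rewrite ?mul0r.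
Qed.

(** Only an inequality: the exclusion of w = z is dropped, which adds nonnegative terms. *)
Lemma grow2_11_le x y :
  grow2 1 1 x y U M <= \sum_z pr x z * \sum_w pr y w * (mu z w + row w).
Proof.
rewrite /= -(@sum_pr x (fun z => \sum_w pr y w * (mu z w + row w))) //.
apply: ler_sum => z zU; rewrite ler_wpM2l //.
apply: le_trans (ler_sum_mu y zU _) => [|w]; last by rewrite addr_ge0 ?mu_ge0 ?row_ge0.
apply: ler_sum => w wzU; rewrite ler_wpM2l // -/(rest M (w :: z :: U) w) rest_cons2 //.
have wU : w \notin U by move: wzU; rewrite inE negb_or => /andP[].
by rewrite [M w z]Ms (_ : M z w = mu z w); [lra | rewrite /mu /pr zU wU].
Qed.

Lemma grow2_20_le x y :
  grow2 2 0 x y U M <= \sum_z pr x z * \sum_w mu z w * (pr y w + \sum_v pr y v).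
Proof.
rewrite /= -(@sum_pr x (fun z => \sum_w mu z w * (pr y w + \sum_v pr y v))) //.
apply: ler_sum => z zU; rewrite ler_wpM2l //.
rewrite -(@sum_mu z (fun w => pr y w + \sum_v pr y v)) //.
apply: ler_sum => w wzU; rewrite ler_wpM2l //.
have wU : w \notin U by move: wzU; rewrite inE negb_or => /andP[].
rewrite -/(rest M (w :: z :: U) y) -restE -(rest_cons M y zU) -(rest_cons M y wzU) /pr wU.
have := M0 y z; lra.
Qed.

End Small.

Section Three.
Variables (K : realFieldType) (T : finType) (M : T -> T -> K) (x y : T).
Hypothesis fM : feasible M.
Hypothesis xy : x != y.
Hypothesis M2 : ssum M = 2.
Hypothesis Mt : forall u v, M u v <= M x y.

(** Equality holds at the triangle a = b = t = 1/3, R = 0. With c = a + b the reduced quantity is c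
    (1 + 3t/2) - 3c^2/4; up to c = 2/3 the bound t <= 1/3 is used, beyond it t <= 1 - c. *)
Lemma three_arith (a b R t g sa sb : K) : 0 <= a -> 0 <= b -> 0 <= R -> 0 <= t ->
  a + b + R + t = 1 -> 3 * t <= 1 -> g <= t * a -> g <= t * b -> sa <= a * R -> sb <= b * R ->
  5 * g + a * b + (sa + sb) <= 2 / 3.
Proof.
move=> a0 b0 R0 t0 E t1 ga gb la lb.
suff : 5 / 2 * t * (a + b) + (a + b) ^+ 2 / 4 + (a + b) * R <= 2 / 3.
  have := sqr_ge0 (a - b); rewrite !expr2; nra.
have -> : R = 1 - t - (a + b) by lra.
have c1 : t + (a + b) <= 1 by lra.
have c0 : 0 <= a + b by lra.
move: (a + b) c0 c1 => c c0 c1; rewrite expr2.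
have [cl|cl] := lerP (3 * c) 2.
  have := mulr_ge0 c0 (_ : 0 <= 1 - 3 * t); nra.
nra.
Qed.

End Three.
End ShortGrowthFacts.

(** * Polynomial inequalities for four hubs *)

Module PolynomialsFacts.
From mathcomp Require Import all_boot all_order all_algebra.
From mathcomp Require Import ring lra zify.
Import Order.TTheory GRing.Theory Num.Theory.
Local Open Scope ring_scope.

Section FourArith.
Variable K : realFieldType.
Implicit Types (a b c R t : K).

Lemma far_arith c t : 0 <= c -> 0 <= t -> 4 * t <= 1 -> t <= 1 - 3 * c ->
  6 * t * c ^+ 2 + c * (1 - t - c) ^+ 2 / 2 <= 1 / 8.
Proof.
move=> c0 t0 t1 tc; rewrite !expr2.
have [cl|cl] := lerP (4 * c) 1.
  have c2 : c * c <= c / 4 by nra.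
  have c3 : c * c * c <= c / 16 by nra.
  have h1 : t * (c * c) <= c * c / 4 by nra.
  have [c7|c7] := lerP (7 * c) 1; first by nra.
  have := mulr_ge0 c0 (mulr_ge0 (_ : 0 <= 1 / 4 - t) (_ : 0 <= 7 * c - 1 + (1 / 4 + t) / 2)).
  by move/(_ ltac:(lra))/(_ ltac:(lra)); lra.
have h1 := mulr_ge0 (mulr_ge0 (_ : 0 <= c - 1 / 4) (_ : 0 <= c - 1 / 4)) (_ : 0 <= 16 * c + 2).
have h2 := mulr_ge0 c0 (mulr_ge0 (_ : 0 <= 1 - 3 * c - t) (_ : 0 <= 7 * c - 1 + (1 - 3 * c + t) / 2)).
move: (h1 ltac:(lra) ltac:(lra) ltac:(lra)) (h2 ltac:(lra) ltac:(lra)); lra.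
Qed.

Lemma near_arith c R t : 0 <= R -> 0 <= t -> 4 * t <= 1 -> R <= c -> 2 * c + R + t = 1 ->
  2 * c * R * (c + 3 * t) <= 1 / 8.
Proof.
move=> R0 t0 t1 Rc E; have -> : t = 1 - 2 * c - R by lra.
have c4 : 4 * c >= 1 by lra.
(* The left side is concave in R with vertex (3 - 5c)/6, which crosses the constraint R <= c at c =
   3/11: below it the worst case is R = c, above it the vertex. *)
have [cl|cl] := lerP (11 * c) 3.
  have h1 := mulr_ge0 (_ : 0 <= c) (mulr_ge0 (_ : 0 <= c - R) (_ : 0 <= 3 - 5 * c - 3 * (c + R))).
  have h2 := mulr_ge0 (mulr_ge0 (_ : 0 <= c - 1 / 4) (_ : 0 <= c - 1 / 4)) (_ : 0 <= 16 * c + 2).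
  move: (h1 ltac:(lra) ltac:(lra) ltac:(lra)) (h2 ltac:(lra) ltac:(lra) ltac:(lra)); lra.
have h1 := mulr_ge0 (_ : 0 <= c) (sqr_ge0 (6 * R - (3 - 5 * c))).
have h3 := mulr_ge0 (_ : 0 <= c - 3 / 11) (_ : 0 <= 1 / 2 - c).
have h4 := mulr_ge0 (_ : 0 <= c - 3 / 11) (_ : 0 <= - 25 * c * c + 255 / 11 * c - 324 / 121).
have h2 : c * (3 - 5 * c) * (3 - 5 * c) <= 3 / 4.
  move: (h3 ltac:(lra) ltac:(lra)) => {}h3; move: (h4 ltac:(lra) ltac:(lra)); lra.
move: (h1 ltac:(lra)); rewrite expr2; lra.
Qed.

Lemma skew_arith a b R : 0 <= a -> 0 <= b -> 0 <= R -> 2 * R <= a + b -> a + b + R <= 1 ->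
  a * R ^+ 2 + b * R * (a + R) <= 1 / 8.
Proof.
move=> a0 b0 R0 Rab ab1; rewrite expr2.
have h : a * b <= (1 - R) * (1 - R) / 4 by have := sqr_ge0 (a - b); rewrite expr2; nra.
have h1 := mulr_ge0 R0 (_ : 0 <= (1 - R) * (1 - R) / 4 - a * b).
have h2 := mulr_ge0 (mulr_ge0 R0 R0) (_ : 0 <= 1 - R - a - b).
have h3 : R / 4 + R * R / 2 - 3 / 4 * R * R * R <= 1 / 8 by nra.
move: (h1 ltac:(lra)) (h2 ltac:(lra)); lra.
Qed.

(** Equality holds at a = b = R = t = 1/4, the 4-cycle. The free parameter e is chosen so that e P1
    collects all terms in P1. If a + b <= 2R the quadratic bounds suffice, with T <= t a b.
    Otherwise T is traded for t (P1 + Q1)/2, and comparing R with b + 3t and with a + 3t decides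
    which bound to use for P and for Q. *)
Lemma four_arith a b R t T P1 P2 Q1 Q2 : 0 <= a -> 0 <= b -> 0 <= R -> 0 <= t ->
  a + b + R + t = 1 -> 4 * t <= 1 -> T <= t * (a * b) -> 2 * T <= t * (P1 + Q1) ->
  (forall e, e * P1 - P2 <= a * e ^+ 2 / 4) -> (forall e, e * Q1 - Q2 <= b * e ^+ 2 / 4) ->
  (forall e, 2 * R <= e -> e * P1 - P2 <= a * (R * (e - R))) ->
  (forall e, 2 * R <= e -> e * Q1 - Q2 <= b * (R * (e - R))) ->
  R * (P1 + Q1) - (P2 + Q2) + 6 * T + a * Q1 + b * P1 <= 1 / 8.
Proof.
move=> a0 b0 R0 t0 E t1 T1 T2 Pq Qq Pr Qr.
have [cR|Rc] := lerP (a + b) (2 * R).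
  have := Pq (R + b); have := Qq (R + a).
  have := @far_arith ((a + b) / 2) t; rewrite !expr2.
  move/(_ ltac:(lra) t0 t1 ltac:(lra)); have := sqr_ge0 (a - b); rewrite expr2.
  have -> : 1 - t - (a + b) / 2 = R + (a + b) / 2 by lra.
  move=> s0 h hQ hP.
  have h1 := mulr_ge0 t0 s0; have h2 := mulr_ge0 R0 s0; have h3 := mulr_ge0 (addr_ge0 a0 b0) s0.
  clear -s0 h hQ hP h1 h2 h3 T1; lra.
have near u v : 0 <= u -> 0 <= v -> u + v + R + t = 1 -> 2 * R < u + v -> v + 3 * t < R ->
    u * (R + v + 3 * t) ^+ 2 / 4 + v * (R * (u + 3 * t)) <= 1 / 8.
  move=> u0 v0 Euv Ruv vR; apply: le_trans (skew_arith u0 v0 R0 (ltW Ruv) _); last by lra.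
  have h1 := mulr_ge0 (mulr_ge0 u0 (_ : 0 <= 3 * R + v + 3 * t)) (_ : 0 <= R - (v + 3 * t)).
  have h2 := mulr_ge0 (mulr_ge0 v0 R0) (_ : 0 <= R - 3 * t).
  by move: (h1 ltac:(lra) ltac:(lra)) (h2 ltac:(lra)); rewrite !expr2; clear; lra.
have [bR|bR] := lerP R (b + 3 * t); have [aR|aR] := lerP R (a + 3 * t).
- have hP := Pr (R + b + 3 * t) ltac:(lra); have hQ := Qr (R + a + 3 * t) ltac:(lra).
  have := @near_arith ((a + b) / 2) R t R0 t0 t1 ltac:(lra) ltac:(lra).
  have := mulr_ge0 R0 (sqr_ge0 (a - b)); rewrite expr2; move: T2 hP hQ; clear; lra.
- have hP := Pr (R + b + 3 * t) ltac:(lra); have hQ := Qq (R + a + 3 * t).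
  have := near b a b0 a0 ltac:(lra) ltac:(lra) aR; move: T2 hP hQ; clear; rewrite !expr2; lra.
- have hP := Pq (R + b + 3 * t); have hQ := Qr (R + a + 3 * t) ltac:(lra).
  have := near a b a0 b0 E Rc bR; move: T2 hP hQ; clear; rewrite !expr2; lra.
lra.
Qed.
End FourArith.
End PolynomialsFacts.

(** * Sharp bounds for three and four hubs *)

Module ShortBoundsFacts.
From mathcomp Require Import all_boot all_order all_algebra.
From mathcomp Require Import ring lra zify.
Import PathSumsFacts PerturbationFacts HeaviestEdgeFacts GrowthFacts ShortGrowthFacts PolynomialsFacts.
Import Order.TTheory GRing.Theory Num.Theory.
Local Open Scope ring_scope.

Lemma grow_sum1 (K : realFieldType) (T : finType) (M : T -> T -> K) x y :
  grow_sum 1 x y M = grow2 0 1 x y [:: x; y] M + grow2 1 0 x y [:: x; y] M +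
    grow2 0 1 x y [:: x; y] M.
Proof. by rewrite /grow_sum !big_ord_recl big_ord0 addr0. Qed.

Lemma grow_sum2 (K : realFieldType) (T : finType) (M : T -> T -> K) x y :
  grow_sum 2 x y M = grow2 0 2 x y [:: x; y] M + (grow2 1 1 x y [:: x; y] M +
    grow2 2 0 x y [:: x; y] M) + grow2 0 2 x y [:: x; y] M.
Proof. by rewrite /grow_sum !big_ord_recl big_ord0 addr0. Qed.

Section SmallBounds.
Variables (K : realFieldType) (T : finType) (M : T -> T -> K) (x y : T).
Hypothesis fM : feasible M.
Hypothesis xy : x != y.
Hypothesis M2 : ssum M = 2.
Hypothesis Mt : forall u v, M u v <= M x y.
Let U := [:: x; y].
Let p := pr M U x.
Let q := pr M U y.
Let m := mu M U.
Let D := row M U.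
Let R := out M U.
Let t := M x y.
Let M0 u v : 0 <= M u v. Proof. by case: fM. Qed.
Let p0 z : 0 <= p z. Proof. exact: pr_ge0. Qed.
Let q0 z : 0 <= q z. Proof. exact: pr_ge0. Qed.
Let m0 z w : 0 <= m z w. Proof. exact: mu_ge0. Qed.
Let D0 z : 0 <= D z. Proof. exact: row_ge0. Qed.
Let DR z : D z <= R. Proof. exact: row_le_out. Qed.
Let pt z : p z <= t. Proof. by rewrite /p /pr; case: ifP => // _; apply: M0. Qed.
Let qt z : q z <= t. Proof. by rewrite /q /pr; case: ifP => // _; apply: M0. Qed.
Let mt z w : m z w <= t.
Proof. by rewrite /m /mu /pr; case: ifP => // _; [case: ifP => // _|]; apply: M0. Qed.
Let ms z w : m z w = m w z. Proof. exact: mu_sym. Qed.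
Let U_sym : [:: y; x] =i U. Proof. by move=> z; rewrite !inE orbC. Qed.
Let a := \sum_z p z.
Let b := \sum_z q z.
Let a0 : 0 <= a. Proof. exact: sumr_ge0. Qed.
Let b0 : 0 <= b. Proof. exact: sumr_ge0. Qed.
Let total : a + b + R + t = 1.
Proof.
have := avail2 fM xy; rewrite /avail !restE M2 -/p -/q -/a -/b -/R -/t -/U => E.
by rewrite -(divff (_ : 2 != 0 :> K)) ?pnatr_eq0 // -E; ring.
Qed.

Lemma three_bound : 3 * t <= 1 -> (grow_sum 1 x y M + grow_sum 1 y x M) / 2 <= 2 / 3.
Proof.
move=> t1; rewrite !grow_sum1 !(grow2_perm M _ _ _ _ U_sym) !grow2_01 // !grow2_10 //.
rewrite -/p -/q -/D -/a -/b.
pose g := \sum_z p z * q z; pose sa := \sum_z p z * D z; pose sb := \sum_z q z * D z.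
have step (f h : T -> K) : \sum_z f z * (2 * h z + D z) = 2 * (\sum_z f z * h z) + \sum_z f z * D z.
  by rewrite mulr_sumr -big_split; apply: eq_bigr => z _ /=; ring.
have step2 (f h : T -> K) c : \sum_z f z * (h z + c) = \sum_z f z * h z + (\sum_z f z) * c.
  by rewrite mulr_suml -big_split; apply: eq_bigr => z _ /=; ring.
rewrite !step !step2 -/a -/b -/sa -/sb -/g.
have -> : \sum_z q z * p z = g by apply: eq_bigr => z _; rewrite mulrC.
have ga : g <= t * a by rewrite mulrC /a mulr_suml; apply: ler_sum => z _; rewrite ler_wpM2l.
have gb : g <= t * b by rewrite /b mulr_sumr; apply: ler_sum => z _; rewrite ler_wpM2r.
have la : sa <= a * R by rewrite /a mulr_suml; apply: ler_sum => z _; rewrite ler_wpM2l.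
have lb : sb <= b * R by rewrite /b mulr_suml; apply: ler_sum => z _; rewrite ler_wpM2l.
have := three_arith a0 b0 (out_ge0 fM U) (M0 x y) total t1 ga gb la lb.
by lra.
Qed.

Lemma quad_sum_le (f : T -> K) e : (forall z, 0 <= f z) ->
  e * (\sum_z f z * D z) - \sum_z f z * D z ^+ 2 <= (\sum_z f z) * e ^+ 2 / 4.
Proof.
move=> f0; rewrite -mulrA mulr_suml mulr_sumr -sumrB; apply: ler_sum => z _.
have := mulr_ge0 (f0 z) (sqr_ge0 (e - 2 * D z)); rewrite !expr2; lra.
Qed.

(** For 2R <= e the parabola e D - D^2 increases on D <= R, so its largest value is at D = R;
    without that condition only the completed square of [quad_sum_le] is available. *)
Lemma quad_sum_le_edge (f : T -> K) e : (forall z, 0 <= f z) -> 2 * R <= e ->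
  e * (\sum_z f z * D z) - \sum_z f z * D z ^+ 2 <= (\sum_z f z) * (R * (e - R)).
Proof.
move=> f0 eR; rewrite mulr_suml mulr_sumr -sumrB; apply: ler_sum => z _.
have := mulr_ge0 (f0 z) (mulr_ge0 (_ : 0 <= R - D z) (_ : 0 <= e - R - D z)).
have := DR z => ?; move/(_ ltac:(lra))/(_ ltac:(lra)); rewrite expr2; lra.
Qed.

(** The edges at z and the edges at w other than zw are disjoint families outside U, so together
    they weigh at most R. *)
Lemma mu_row_le z w : m z w * (D w - m z w) <= m z w * (R - D z).
Proof.
have [->|zw] := eqVneq z w; first by rewrite /m mu_diag // !mul0r.
have [zU|zU] := boolP (z \in U); first by rewrite /m /mu zU !mul0r.
have [wU|wU] := boolP (w \in U); first by rewrite /m /mu /pr wU /= if_same !mul0r.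
have wzU : w \notin z :: U by rewrite inE negb_or eq_sym zw.
rewrite ler_wpM2l // /D /m -(rest_cons2 fM zU wzU).
have := row_le_out fM (z :: U) w; rewrite rowE // -(rest_cons M w wzU).
rewrite /R -(out_cons fM zU) (rowE M zU) -(rest_cons M z zU).
case: fM => _ _ Md; rewrite !Md; lra.
Qed.

(** All walks are expressed by the first and second moments of the row sums under p and q and by S,
    the weight of paths x, z, w, y joining the two ends. [St2] comes from the bound u v <= t (u +
    v)/2 for u, v <= t. *)
Lemma four_bound : 4 * t <= 1 -> (grow_sum 2 x y M + grow_sum 2 y x M) / 2 <= 1 / 8.
Proof.
move=> t1; pose P1 := \sum_z p z * D z; pose P2 := \sum_z p z * D z ^+ 2.
pose Q1 := \sum_z q z * D z; pose Q2 := \sum_z q z * D z ^+ 2.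
pose S := \sum_z \sum_w m z w * (p z * q w).
have S_sym : \sum_z \sum_w m z w * (q z * p w) = S.
  rewrite exchange_big; apply: eq_bigr => z _; apply: eq_bigr => w _.
  by rewrite ms [q _ * _]mulrC.
have St : S <= t * (a * b).
  rewrite /S /a mulr_suml mulr_sumr; apply: ler_sum => z _.
  rewrite /b mulr_sumr mulr_sumr; apply: ler_sum => w _.
  by rewrite ler_wpM2r ?mulr_ge0.
have St2 : 2 * S <= t * (P1 + Q1).
  have -> : 2 * S = \sum_z \sum_w m z w * (p z * q w + q z * p w).
    rewrite -[2]/(1 + 1) mulrDl mul1r -{2}S_sym -big_split; apply: eq_bigr => z _.
    by rewrite -big_split; apply: eq_bigr => w _; rewrite mulrDr.
  have -> : t * (P1 + Q1) = \sum_z \sum_w m z w * (t * (p z + q z + (p w + q w)) / 2).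
    pose F := \sum_z \sum_w m z w * (p z + q z).
    have EF : P1 + Q1 = F.
      rewrite -big_split; apply: eq_bigr => z _ /=; rewrite -mulrDl mulrC /D /row mulr_suml //.
    have EF' : F = \sum_z \sum_w m z w * (p w + q w).
      by rewrite exchange_big; apply: eq_bigr => z _; apply: eq_bigr => w _; rewrite ms.
    rewrite EF; transitivity (t / 2 * (F + F)); first by field.
    rewrite {2}EF' /F -big_split mulr_sumr; apply: eq_bigr => z _.
    by rewrite -big_split mulr_sumr; apply: eq_bigr => w _ /=; field.
  apply: ler_sum => z _; apply: ler_sum => w _; rewrite ler_wpM2l //.
  have h u v : 0 <= u -> 0 <= v -> u <= t -> v <= t -> u * v <= t * (u + v) / 2.
    by move=> u0 v0 ut vt; have := mulr_ge0 u0 (_ : 0 <= t - v); have := mulr_ge0 v0 (_ : 0 <= t - u); move/(_ ltac:(lra)) => h1 /(_ ltac:(lra)); lra.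
  have := h _ _ (p0 z) (q0 w) (pt z) (qt w); have := h _ _ (q0 z) (p0 w) (qt z) (pt w); lra.
have := four_arith a0 b0 (out_ge0 fM U) (M0 x y) total t1 St St2
  (fun e => quad_sum_le e p0) (fun e => quad_sum_le e q0)
  (fun e => @quad_sum_le_edge p e p0) (fun e => @quad_sum_le_edge q e q0).
apply: le_trans.
rewrite !grow_sum2 !(grow2_perm M _ _ _ _ U_sym) !grow2_02 //.
have := grow2_11_le fM U x y; have := grow2_11_le fM U y x.
have := grow2_20_le fM U x y; have := grow2_20_le fM U y x.
rewrite -/p -/q -/m -/D -/a -/b.
have e11 (f h : T -> K) : \sum_z f z * (\sum_w h w * (m z w + D w)) =
    \sum_z \sum_w m z w * (f z * h w) + (\sum_z f z) * (\sum_w h w * D w).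
  rewrite mulr_suml -big_split; apply: eq_bigr => z _ /=; rewrite !mulr_sumr -big_split.
  by apply: eq_bigr => w _ /=; ring.
have e20 (f h : T -> K) c : \sum_z f z * (\sum_w m z w * (h w + c)) =
    \sum_z \sum_w m z w * (f z * h w) + (\sum_z f z * D z) * c.
  rewrite mulr_suml -big_split; apply: eq_bigr => z _ /=; rewrite /D /row -/m -mulrA mulr_suml.
  by rewrite !mulr_sumr -big_split; apply: eq_bigr => w _ /=; ring.
have e02 (f h : T -> K) : (forall z, 0 <= f z) ->
    \sum_z f z * (\sum_w m z w * (2 * h w + D w - m z w)) <=
    2 * (\sum_z \sum_w m z w * (f z * h w)) + R * (\sum_z f z * D z) - \sum_z f z * D z ^+ 2.
  move=> f0; rewrite !mulr_sumr -big_split -sumrB; apply: ler_sum => z _ /=.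
  have -> : 2 * (\sum_w m z w * (f z * h w)) + R * (f z * D z) - f z * D z ^+ 2 =
      f z * (\sum_w (m z w * (2 * h w) + m z w * (R - D z))).
    rewrite big_split -mulr_suml -/(row M U z) -/D mulrDr -addrA; congr (_ + _); last by rewrite expr2; ring.
    by rewrite !mulr_sumr; apply: eq_bigr => w _; ring.
  rewrite ler_wpM2l //; apply: ler_sum => w _.
  by rewrite -addrA mulrDr lerD2l mu_row_le.
have := e02 _ q p0; have := e02 _ p q0.
rewrite !e11 !e20 S_sym -/S -/a -/b -/P1 -/P2 -/Q1 -/Q2.
rewrite -/U -/R; lra.
Qed.
End SmallBounds.
End ShortBoundsFacts.

(** * Existence of maximisers and the extremal constants *)

Module MaximisersFacts.
From mathcomp Require Import all_boot all_order all_algebra.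
From mathcomp Require Import all_classical all_reals topology normedtype derive.
From mathcomp Require Import ring lra zify.
Import PathSumsFacts PerturbationFacts HeaviestEdgeFacts GrowthFacts ShortGrowthFacts PolynomialsFacts ShortBoundsFacts.
Import Order.TTheory GRing.Theory Num.Theory numFieldNormedType.Exports.
Local Open Scope ring_scope.

Section Homogeneous.
Variables (K : realFieldType) (T : finType).
Implicit Types (M : T -> T -> K).

Lemma pw_scale c M x s : pw (fun x y => c * M x y) x s = c ^+ size s * pw M x s.
Proof.
elim: s x => [|y s IH] x /=; first by rewrite expr0 mulr1.
by rewrite IH exprS mulrACA.
Qed.

Lemma pc_sum_scale n c M : pc_sum n (fun x y => c * M x y) = c ^+ n.+1 * pc_sum n M.
Proof.
rewrite /pc_sum mulrDr mulrA /cycle_sum /path_sum -!seqsumZ; congr (_ + _ / 2).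
  apply: eq_seqsum => [[|x s]] // [sn] /=; rewrite pw_scale sn exprSr; ring.
by apply: eq_seqsum => [[|x s]] // [sn] /=; rewrite pw_scale sn mulrCA.
Qed.

Lemma ssum_scale c M : ssum (fun x y => c * M x y) = c * ssum M.
Proof. by rewrite /ssum mulr_sumr; apply: eq_bigr => x _; rewrite mulr_sumr. Qed.

Lemma feasible_scale c M : 0 <= c -> feasible M -> feasible (fun x y => c * M x y).
Proof.
by move=> c0 [Ms M0 Md]; split=> [x y|x y|x]; [rewrite Ms | rewrite mulr_ge0 | rewrite Md mulr0].
Qed.

Lemma ssum_ge0 M : feasible M -> 0 <= ssum M.
Proof. by move=> [_ M0 _]; apply: sumr_ge0 => x _; apply: sumr_ge0. Qed.

Lemma le_ssum M x y : feasible M -> M x y <= ssum M.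
Proof.
move=> [_ M0 _]; rewrite /ssum (bigD1 x) //= (bigD1 y) //= -addrA lerDl; apply: addr_ge0.
  by apply: sumr_ge0 => z _; apply: M0.
by apply: sumr_ge0 => z _; apply: sumr_ge0 => w _; apply: M0.
Qed.

End Homogeneous.

Section Maximiser.
Variables (R : realType) (T : finType).
Implicit Types (M : T -> T -> R).
Local Open Scope classical_set_scope.

Lemma continuousMr (V : topologicalType) (f g : V -> R) :
  continuous f -> continuous g -> continuous (fun v => f v * g v).
Proof. by move=> cf cg v; apply: cvgM; [apply: cf | apply: cg]. Qed.

Lemma continuousDr (V : topologicalType) (f g : V -> R) :
  continuous f -> continuous g -> continuous (fun v => f v + g v).
Proof. by move=> cf cg v; apply: cvgD; [apply: cf | apply: cg]. Qed.

Lemma continuous_sumr (V : topologicalType) (I : finType) (P : pred I) (F : I -> V -> R) :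
  (forall i, P i -> continuous (F i)) -> continuous (fun v => \sum_(i | P i) F i v).
Proof.
move=> cF; have -> : (fun v => \sum_(i | P i) F i v) = \sum_(i | P i) F i.
  by apply/funext => v; rewrite fct_sumE.
by elim/big_ind: _ => [|f g|]; [exact: cst_continuous | exact: continuousDr | exact: cF].
Qed.

Lemma continuous_seqsum (V : topologicalType) n (F : seq T -> V -> R) :
  (forall s, continuous (F s)) -> continuous (fun v => seqsum n (F^~ v)).
Proof.
elim: n F => [|n IH] F cF /=; first exact: cF.
by apply: continuous_sumr => x _; apply: (IH (fun s => F (x :: s))).
Qed.

Let N := #|{: T * T}|.
(** Row vectors carry the topology. Averaging the two orders of a pair and clearing the diagonal
    turns every vector into a symmetric weight, so the constraints reduce to a box and one closed
    equation. *)
Definition mx_of (v : 'rV[R]_N) x y : R :=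
  if x == y then 0 else (v ord0 (enum_rank (x, y)) + v ord0 (enum_rank (y, x))) / 2.
Definition of_mx M : 'rV[R]_N := \row_j M (enum_val j).1 (enum_val j).2.

Lemma of_mxK M : feasible M -> mx_of (of_mx M) = M.
Proof.
move=> [Ms _ Md]; apply/funext => x; apply/funext => y; rewrite /mx_of !mxE !enum_rankK /=.
by case: eqVneq => [->|_]; rewrite ?Md // (Ms y x); field.
Qed.

Lemma continuous_mx_of x y : continuous (fun v : 'rV[R]_N => mx_of v x y).
Proof.
rewrite /mx_of; case: eqVneq => _; first exact: cst_continuous.
apply: continuousMr; last exact: cst_continuous.
by apply: continuousDr; apply: coord_continuous.
Qed.

Lemma continuous_pw x s : continuous (fun v : 'rV[R]_N => pw (mx_of v) x s).
Proof.
elim: s x => [|y s IH] x /=; first exact: cst_continuous.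
by apply: continuousMr; [apply: continuous_mx_of | apply: IH].
Qed.

Lemma continuous_pc_sum n : continuous (fun v : 'rV[R]_N => pc_sum n (mx_of v)).
Proof.
apply: continuousDr; last apply: continuousMr; last exact: cst_continuous.
  apply: continuous_seqsum => s; apply: continuousMr; first exact: cst_continuous.
  case: s => [|x s]; first exact: cst_continuous.
  by apply: continuousMr; [apply: continuous_pw | apply: continuous_mx_of].
apply: continuous_seqsum => s; apply: continuousMr; first exact: cst_continuous.
by case: s => [|x s]; [exact: cst_continuous | exact: continuous_pw].
Qed.

Lemma maximiser n M0 : feasible M0 -> ssum M0 = 2 ->
  exists M, [/\ feasible M, ssum M = 2 &
    forall M', feasible M' -> ssum M' = 2 -> pc_sum n M' <= pc_sum n M].
Proof.
move=> fM0 M02.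
pose A := [set v : 'rV[R]_N | forall j, `[0, 2] (v ord0 j)] `&`
  [set v | ssum (mx_of v) = 2].
have A_of M : feasible M -> ssum M = 2 -> A (of_mx M).
  move=> fM M2; split; last by rewrite /= of_mxK.
  move=> j; rewrite /= in_itv /= mxE; case: (fM) => _ -> _ /=.
  by rewrite -M2 le_ssum.
have cA : compact A.
  apply: compact_closedI.
    by apply: (@rV_compact R N (fun=> `[0, 2]%classic)) => i; apply: segment_compact.
  apply: (@preimage_closed _ _ (fun v : 'rV[R]_N => ssum (mx_of v)) [set 2]).
    move=> v _; apply: continuous_sumr => x _; apply: continuous_sumr => y _.
    exact: continuous_mx_of.
  exact: closed_eq.
have A0 : A !=set0 by exists (of_mx M0); apply: A_of.
have [v vA vmax] := EVT_max_rV A0 cA (continuous_subspaceT (@continuous_pc_sum n)).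
have [v02 v2] : A v by rewrite inE in vA.
exists (mx_of v); split=> //.
  split=> [x y|x y|x]; rewrite /mx_of ?eqxx // 1?eq_sym; case: eqVneq => // _; first by rewrite addrC.
  rewrite divr_ge0 // addr_ge0 //.
    by have := v02 (enum_rank (x, y)); rewrite /= in_itv /= => /andP[].
  by have := v02 (enum_rank (y, x)); rewrite /= in_itv /= => /andP[].
by move=> M' fM' M'2; have := vmax (of_mx M'); rewrite of_mxK // inE; apply; apply: A_of.
Qed.

(** The constant for m = n + 2 hubs. The values 2/9 and 1/32 are 2m/m^m for m = 3 and 4. For m = 2
    the value 2 is attained with all weight on one pair, which serves as both edges of the
    2-cycle. *)
Definition pc_const n : R :=
  match n with 0 => 2 | 1 => 2 / 9 | 2 => 1 / 32 | _ => (n.+1%:R^-1) ^+ n.+1 end.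

Lemma pc_sum2_le M : feasible M -> pc_sum 1 M <= (ssum M) ^+ 2 / 2.
Proof.
move=> [Ms M0 Md]; rewrite /pc_sum /cycle_sum /path_sum /=.
set A := \sum_x _; set B := \sum_x _.
suff : A * 2 + B <= ssum M ^+ 2 by lra.
rewrite /A /B big_distrl -big_split expr2 {2}/ssum mulr_sumr; apply: ler_sum => x _ /=.
rewrite big_distrl -big_split mulr_sumr; apply: ler_sum => y _ /=.
have [->|xy] := eqVneq x y.
  by rewrite inE eqxx /= !mul0r big1 ?Md ?mulr0 ?addr0 // => z _; rewrite !inE eqxx mul0r.
rewrite inE xy /= mul1r mulr1.
have -> : \sum_x0 (uniq [:: x; y; x0])%:R * (M x y * (M y x0 * 1)) =
    M x y * \sum_(z | (z != x) && (z != y)) M y z.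
  rewrite mulr_sumr [RHS]big_mkcond; apply: eq_bigr => z _ /=.
  rewrite !inE (negbTE xy) /= andbT mulr1 ![_ == z]eq_sym.
  by case: (z == x) (z == y) => [] []; rewrite ?mul1r ?mul0r.
rewrite -mulrA -mulrDr mulrC ler_wpM2r // (Ms y x).
apply: (@le_trans _ _ (\sum_z M x z + \sum_z M y z)).
  have -> : \sum_z M x z = M x y + \sum_(z | z != y) M x z by rewrite (bigD1 y).
  have -> : \sum_z M y z = M x y + \sum_(z | (z != x) && (z != y)) M y z.
    by rewrite (bigD1 x) //= (bigD1 y) ?(eq_sym y) //= Md add0r (Ms y x).
  have : 0 <= \sum_(i | i != y) M x i by apply: sumr_ge0.
  lra.
rewrite /ssum [X in _ <= X](bigD1 x) //= lerD2l [X in _ <= X](bigD1 y) ?(eq_sym y) //= lerDl.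
by apply: sumr_ge0 => z _; apply: sumr_ge0.
Qed.

(** Homogeneity reduces to total weight 2, where a maximiser exists; the zero weight is set aside as
    it cannot be rescaled. The case n = 0 is direct, since the walk bounds need at least one
    step. *)
Lemma pc_sum_le n M : feasible M -> pc_sum n.+1 M <= pc_const n * (ssum M / 2) ^+ n.+2.
Proof.
move=> fM; have [n0|n0] := posnP n.
  by rewrite n0 (le_trans (pc_sum2_le fM)) //= expr_div_n; lra.
have zero M' : feasible M' -> ssum M' = 0 -> pc_sum n.+1 M' = 0.
  move=> fM' M'0; have -> : M' = (fun x y => 0 * M' x y).
    apply/funext => x; apply/funext => y; rewrite mul0r.
    by apply/eqP; rewrite eq_le; have := le_ssum x y fM'; rewrite M'0 => -> /=; case: fM'.
  by rewrite pc_sum_scale exprS !mul0r.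
have [M0|M0] := eqVneq (ssum M) 0; first by rewrite zero // M0 mul0r exprS mul0r mulr0.
have pos M' : feasible M' -> ssum M' != 0 -> 0 < ssum M'.
  by move=> fM' M'0; rewrite lt_neqAle eq_sym M'0 ssum_ge0.
have unit_scale M' : 0 < ssum M' -> ssum (fun x y => 2 / ssum M' * M' x y) = 2.
  by move=> M'p; rewrite ssum_scale divfK // gt_eqF.
have c0 M' : 0 < ssum M' -> 0 <= 2 / ssum M' by move=> h; rewrite divr_ge0 // ltW.
have Mp := pos _ fM M0.
have [M1 [fM1 M12 M1max]] := maximiser n.+1 (feasible_scale (c0 _ Mp) fM) (unit_scale _ Mp).
set F := pc_sum n.+1 M1 in M1max.
have Fmax M' : feasible M' -> pc_sum n.+1 M' <= F * (ssum M' / 2) ^+ n.+2.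
  move=> fM'; have [M'0|M'0] := eqVneq (ssum M') 0.
    by rewrite zero // M'0 mul0r exprS mul0r mulr0.
  have M'p := pos _ fM' M'0.
  have := M1max _ (feasible_scale (c0 _ M'p) fM') (unit_scale _ M'p).
  have h : 0 < (ssum M' / 2) ^+ n.+2 by rewrite exprn_gt0 // divr_gt0.
  rewrite pc_sum_scale -(ler_pM2r h) mulrAC -exprMn.
  have -> : 2 / ssum M' * (ssum M' / 2) = 1 by rewrite mulrA divfK // divff ?pnatr_eq0.
  by rewrite expr1n mul1r.
apply: le_trans (Fmax _ fM) _; apply: ler_wpM2r; first by rewrite exprn_ge0 // divr_ge0 // ltW.
have K0 : 0 <= pc_const n.
  by case: (n) => [|[|[|k]]] //=; rewrite ?divr_ge0 // exprn_ge0 // invr_ge0.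
have [F0|F0] := lerP F 0; first exact: le_trans K0.
have [x [y [xy Mt tle Fle]]] := max_edge fM1 M12 Fmax erefl F0.
have := grow_sum_le fM1 n0 xy M12 Mt.
have Mt' u v : M1 u v <= M1 y x by case: (fM1) => Ms _ _; rewrite (Ms y x).
have yx : y != x by rewrite eq_sym.
have := grow_sum_le fM1 n0 yx M12 Mt'.
move: tle Fle; rewrite -/F; clear -n0 F0 fM1 xy M12 Mt; clearbody F.
case: n n0 => [|[|[|k]]] // n0 /(_ n0) tle Fle h1 h2 /=.
- by have := three_bound fM1 xy M12 Mt tle; lra.
- by have := four_bound fM1 xy M12 Mt tle; lra.
have k0 : 0 < k.+3.+2%:R :> R by rewrite ltr0n.
rewrite -(ler_pM2l k0); move: (k.+3.+2%:R) (_ ^+ _) h1 h2 Fle => a c h1 h2 Fle.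
by rewrite (le_trans Fle) //; lra.
Qed.

End Maximiser.
End MaximisersFacts.

(** * From counted copies to cycle and path sums *)

Module WeightingFacts.
From mathcomp Require Import all_boot all_order all_algebra.
From mathcomp Require Import ring lra zify.
Import HalfPlaneFacts MinorsFacts DegeneracyFacts AttachmentFacts BundlesFacts FewNeighboursFacts WeightsFacts TotalWeightFacts ClosedWalksFacts CanonicalFacts TriplesFacts PathSumsFacts PerturbationFacts.
Import Order.TTheory GRing.Theory Num.Theory.
Local Open Scope ring_scope.

Section Lists.
Variables (K : realFieldType) (T : finType).

Lemma seqsum_ffun n (F : seq T -> K) :
  \sum_(b : {ffun 'I_n -> T}) F [seq b i | i <- enum 'I_n] = seqsum n F.
Proof.
elim: n F => [|n IH] F /=.
  rewrite (eq_bigr (fun=> F [::])) => [|b _].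
    by rewrite sumr_const card_ffun card_ord expn0.
  by congr F; apply: size0nil; rewrite size_map size_enum_ord.
pose h (c : T * {ffun 'I_n -> T}) := [ffun i : 'I_n.+1 => oapp c.2 c.1 (unlift ord0 i)].
rewrite (reindex h) /=; last first.
  exists (fun b => (b ord0, [ffun i => b (lift ord0 i)])) => [[x b] _|b _].
    rewrite /h !ffunE unlift_none /=; congr (_, _); apply/ffunP => i.
    by rewrite !ffunE liftK.
  by apply/ffunP => i; rewrite !ffunE; case: unliftP => [j|] ->; rewrite /= ?ffunE.
rewrite -(pair_bigA _ (fun x b => F [seq h (x, b) i | i <- enum 'I_n.+1])) /=.
apply: eq_bigr => x _; rewrite -(IH (fun s => F (x :: s))); apply: eq_bigr => b _.
rewrite enum_ordSl /= /h ffunE unlift_none /= -map_comp; congr (F (_ :: _)).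
by apply: eq_map => i /=; rewrite ffunE liftK.
Qed.

Lemma pw_nth (c : T -> T -> K) x s :
  pw c x s = \prod_(i < size s) c (nth x (x :: s) i) (nth x s i).
Proof.
elim: s x => [|y s IH] x /=; first by rewrite big_ord0.
rewrite big_ord_recl IH; congr (_ * _); apply: eq_bigr => i _.
rewrite -[lift ord0 i : nat]/(i.+1) -[nth x (x :: _) _]/(nth x (y :: s) i) -[nth x (y :: s) i.+1]/(nth x s i).
by congr (c _ _); apply: set_nth_default; [apply: leqW|]; apply: ltn_ord.
Qed.
End Lists.

Section Link.
Variables (R : realFieldType) (T : finType) (e : rel T).
Hypothesis e_sym : symmetric e.
Hypothesis e_irr : irreflexive e.
Hypothesis e_k33 : k33_minor_free e.
Variable rk : T -> nat.
Hypothesis out14 : forall x, (#|[set y | orient e rk x y]| <= 14)%N.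
Variables (B0 B1 : {set T}).
Hypothesis sB01 : B0 \subset B1.
Hypothesis few0 : forall x, x \notin B1 -> (#|nbrs e B0 x| <= 2)%N.
Variable m' : nat.
Local Notation m := m'.+2.

Definition half_weight u v : R := (weight e rk B0 B1 u v)%:R / 2.
Definition codegr u v : R := (codeg e B1 u v)%:R.

Lemma feasible_half_weight : feasible half_weight.
Proof.
split=> [x y|x y|x]; rewrite /half_weight; first by rewrite weightC.
  by rewrite divr_ge0.
by rewrite weight_diag mul0r.
Qed.

Lemma codegr_sym u v : codegr u v = codegr v u.
Proof. by rewrite /codegr /codeg; congr (_%:R); apply: eq_card => x; rewrite !inE [e x u && _]andbC. Qed.

Lemma codegr_ge0 u v : 0 <= codegr u v. Proof. exact: ler0n. Qed.

Lemma codegr_le u v : u \in B1 -> v \in B1 -> u != v -> codegr u v <= half_weight u v.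
Proof.
move=> uB vB uv; rewrite /codegr /half_weight ler_pdivlMr // -natrM ler_nat mulnC.
exact: codeg_weight.
Qed.

Lemma pw_codegr_le x s : all (mem B1) (x :: s) -> uniq (x :: s) ->
  pw codegr x s <= pw half_weight x s.
Proof.
elim: s x => [|y s IH] x //= /and3P[xB yB sB] /andP[xs us].
apply: ler_pM; [exact: codegr_ge0 | by apply: pw_ge0 => u v; exact: codegr_ge0 | |].
  by apply: codegr_le => //; move: xs; rewrite inE negb_or => /andP[].
by apply: IH; rewrite /= ?yB.
Qed.

Lemma pws_codegr_le t : all (mem B1) t -> uniq t -> pws codegr t <= pws half_weight t.
Proof. by case: t => [|x s] //; apply: pw_codegr_le. Qed.

Lemma pws_codegr_ge0 t : 0 <= pws codegr t.
Proof. by case: t => [|x s] /=; [exact: ler01 | apply: pw_ge0 => u v; exact: codegr_ge0]. Qed.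

Definition head_last (f : T -> T -> R) t := if t is x :: s then f (last x s) x else 0.

Lemma head_last_rev f t : head_last f (rev t) = head_last (fun x y => f y x) t.
Proof.
case: t => [|x s] //; rewrite rev_cons; case: (lastP s) => [|s' z] //.
by rewrite rev_rcons /= !last_rcons.
Qed.

Lemma sum_reversal k (f : seq T -> R) : seqsum k f = seqsum k (fun t => (f t + f (rev t)) / 2).
Proof.
rewrite -[LHS](_ : (seqsum k f + seqsum k f) / 2 = _); last by field.
rewrite {2}seqsum_rev -seqsumD mulrC -seqsumZ; apply: eq_seqsum => t _; exact: mulrC.
Qed.

Lemma chain_codegE (b : {ffun 'I_m -> T}) :
  (chain_codeg e B1 b)%:R = pws codegr [seq b i | i <- enum 'I_m].
Proof.
rewrite /chain_codeg natr_prod big_mkcond big_ord_recl /= mul1r.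
rewrite enum_ordSl [RHS]/= pw_nth 2!size_map size_enum_ord; apply: eq_bigr => j _.
congr (codegr _ _); last first.
  by rewrite -map_comp (nth_map j) ?size_enum_ord //= nth_ord_enum.
rewrite -[b ord0 :: _]/[seq b i | i <- ord0 :: [seq lift ord0 i | i <- enum 'I_m'.+1]] -enum_ordSl.
have jm : (j < m)%N by apply: ltnW; rewrite ltnS.
rewrite (nth_map ord0) ?size_enum_ord //; congr (b _); apply: val_inj.
by rewrite /= nth_enum_ord // add0n modnDr modn_small.
Qed.

Lemma last_enum (b : {ffun 'I_m -> T}) x : last x [seq b i | i <- enum 'I_m] = b (last_ord m').
Proof. by rewrite enum_ordSr map_rcons last_rcons. Qed.

(** Reading the hubs backwards swaps the two directions of the ladder, so the ladder factor may be
    replaced by the mean of both, and [ladders_weight] bounds this mean by the half weight. *)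
Lemma type1_le : (\sum_(b | inside B0 b) ladders e rk B1 (b (last_ord m')) (b ord0) * chain_codeg e B1 b)%N%:R
  <= cycle_sum m'.+1 half_weight.
Proof.
pose ins t := (uniq t && all (mem B0) t : bool).
pose f t : R := (ins t)%:R * (head_last (fun u v => (ladders e rk B1 u v)%:R) t * pws codegr t).
have -> : (\sum_(b | inside B0 b) ladders e rk B1 (b (last_ord m')) (b ord0) * chain_codeg e B1 b)%N%:R =
    seqsum m f.
  rewrite -seqsum_ffun natr_sum big_mkcond; apply: eq_bigr => b _; rewrite /f.
  have -> : ins [seq b i | i <- enum 'I_m] = inside B0 b.
    rewrite /ins /inside; congr (_ && _).
    apply/allP/forallP => [h j|h y /mapP[j _ ->]]; last exact: h.
    by apply: h; apply: map_f; rewrite mem_enum.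
  rewrite -chain_codegE; case: inside; rewrite ?mul0r // mul1r natrM; congr (_ * _).
  by rewrite [in RHS]enum_ordSl /= -(last_enum b (b ord0)) enum_ordSl.
rewrite sum_reversal; apply: ler_seqsum => t tm; rewrite /f.
have -> : ins (rev t) = ins t by rewrite /ins rev_uniq all_rev.
rewrite head_last_rev pws_rev; last exact: codegr_sym.
case: (boolP (ins t)) => [/andP[ut tB]|_]; last by rewrite !mul0r addr0 mul0r mulr_ge0 //;
  case: (t) => [|x s] //=; rewrite mulr_ge0 ?pw_ge0 //; case: feasible_half_weight.
rewrite ut !mul1r -mulrDl mulrAC.
have tB1 : all (mem B1) t by apply: sub_all tB => x; apply: (subsetP sB01).
case: t tm ut tB tB1 => [|x s] //= [sm] ut tB tB1; rewrite mulrC.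
have hp := pw_codegr_le tB1 ut.
apply: ler_pM => //; first by apply: pw_ge0; exact: codegr_ge0.
  by rewrite divr_ge0 ?addr_ge0.
rewrite /half_weight -natrD ler_pM2r ?invr_gt0 // ler_nat.
apply: ladders_weight => //.
case/lastP: s sm ut tB {tB1 hp} => [|s z] // _ ut tB; rewrite last_rcons /dist.
move: tB; rewrite all_rcons => /and3P[/= -> -> _] /=.
by move: ut; rewrite mem_rcons inE negb_or eq_sym => /andP[/andP[]].
Qed.

(** Reversal again: between the two ends of a hub path at most one orientation holds, so the
    orientation factor averages to at most 1/2. *)
Lemma type2_le : (\sum_(b | inside B0 b) \sum_(w | (w \in B1) && [forall j, b j != w])
    orient e rk w (b ord0) * (codeg e B1 (b (last_ord m')) w * chain_codeg e B1 b))%N%:R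
  <= path_sum m half_weight / 2.
Proof.
pose ins t := (uniq t && all (mem B1) t : bool).
pose f t : R := (ins t)%:R * (head_last (fun u v => (orient e rk u v)%:R) t * pws codegr t).
apply: (@le_trans _ _ (seqsum m.+1 f)).
  rewrite seqsum_rcons -seqsum_ffun natr_sum big_mkcond; apply: ler_sum => b _.
  have f0 t : 0 <= f t.
    by rewrite /f mulr_ge0 // mulr_ge0 ?pws_codegr_ge0 //; case: t => [|x s] //=; apply: ler0n.
  case: ifP => [/andP[bi bB]|_]; last by apply: sumr_ge0.
  rewrite natr_sum big_mkcond; apply: ler_sum => w _; case: ifP => [/andP[wB bw]|_] //.
  rewrite /f (_ : ins _); last first.
    rewrite /ins rcons_uniq all_rcons /= wB andTb -andbA; apply/and3P; split.
    - by apply/mapP => [[j _ Ew]]; move/forallP/(_ j): bw; rewrite Ew eqxx.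
    - exact: bi.
    apply/allP => y /mapP[j _ ->]; exact/(subsetP sB01)/(forallP bB).
  rewrite mul1r !natrM chain_codegE; set t := [seq b i | i <- enum 'I_m].
  have -> : head_last (fun u v => (orient e rk u v)%:R) (rcons t w) = (orient e rk w (b ord0))%:R.
    by rewrite /t enum_ordSl /= last_rcons.
  have -> : pws codegr (rcons t w) = pws codegr t * codegr (b (last_ord m')) w.
    by rewrite -(last_enum b (b ord0)) /t enum_ordSl /= pw_rcons.
  by rewrite [X in _ * X <= _]mulrC.
rewrite sum_reversal /path_sum mulrC -seqsumZ; apply: ler_seqsum => t tm; rewrite /f mulrC.
rewrite ler_pM2l ?invr_gt0 //.
have -> : ins (rev t) = ins t by rewrite /ins rev_uniq all_rev.
rewrite head_last_rev pws_rev; last exact: codegr_sym.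
case: (boolP (ins t)) => [/andP[ut tB]|_]; last by rewrite !mul0r addr0 mulr_ge0 //;
  case: (t) => [|x s] //=; rewrite pw_ge0 //; case: feasible_half_weight.
rewrite ut !mul1r -mulrDl; apply: le_trans (pws_codegr_le tB ut).
rewrite ler_piMl ?pws_codegr_ge0 //; case: (t) => [|x s] /=; first by lra.
rewrite -natrD.
rewrite -[1]/(1%:R) ler_nat /orient /= (e_sym x); case: (e _ _) => //=.
by case: ssrnat.ltngtP.
Qed.

End Link.
End WeightingFacts.

(** * The two hub sets *)

Module HubSetsFacts.
From mathcomp Require Import all_boot all_order all_algebra.
From mathcomp Require Import ring lra zify.
Import HalfPlaneFacts MinorsFacts DegeneracyFacts AttachmentFacts BundlesFacts FewNeighboursFacts WeightsFacts TotalWeightFacts ClosedWalksFacts CanonicalFacts TriplesFacts.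
Import Order.TTheory GRing.Theory Num.Theory.
Local Open Scope nat_scope.

Section Hubs.
Variables (T : finType) (e : rel T) (D : nat).
Hypothesis e_sym : symmetric e.
Hypothesis e_irr : irreflexive e.
Hypothesis e_k33 : k33_minor_free e.

Definition hubs := [set x | D <= #|[set y | e x y]|].
(** Vertices with three or more hub neighbours are moved to the hub side, so that everybody outside
    sees at most two hubs; [three_neighbours_le] keeps the enlarged set linear in the number of
    hubs. *)
Definition hubs1 := hubs :|: [set x | (x \notin hubs) && (2 < #|nbrs e hubs x|)].

Lemma card_hubs : #|hubs| * D <= 14 * #|T|.
Proof.
rewrite -cardsT; apply: leq_trans (edges2_le e_sym e_irr e_k33 [set: T]).
rewrite -sum_nat_const /edges2 big_mkcond [X in _ <= X]big_mkcond; apply: leq_sum => x _ /=.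
rewrite in_setT inE; case: ifP => // xh; rewrite (leq_trans xh) // /degin -sum1_card big_mkcond.
rewrite [X in _ <= X]big_mkcond; apply: leq_sum => y _ /=; rewrite !inE; by case: ifP.
Qed.

Lemma card_hubs1 : #|hubs1| <= 400 * #|hubs|.
Proof.
apply: leq_trans (leq_of_leqif (leq_card_setU _ _)) _.
have := three_neighbours_le e_sym e_k33 hubs; rewrite /nbrs.
by move=> h; rewrite -[400]/(1 + 399) mulnDl mul1n leq_add2l.
Qed.

Lemma few_hubs x : x \notin hubs1 -> #|nbrs e hubs x| <= 2.
Proof.
by rewrite in_setU inE negb_or negb_and => /andP[/negbTE->] /=; rewrite -leqNgt.
Qed.

Lemma card_bad : #|~: good e hubs1| <= #|hubs1| + 2 * #|hubs1| ^ 3.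
Proof.
have sub : ~: good e hubs1 \subset
    hubs1 :|: [set x | (x \notin hubs1) && (2 < #|nbrs e hubs1 x|)].
  apply/subsetP => x; rewrite in_setC in_set in_setU in_set negb_and negbK -ltnNge.
  by case: (x \in hubs1).
apply: leq_trans (subset_leq_card sub) _; apply: leq_trans (leq_of_leqif (leq_card_setU _ _)) _.
by rewrite leq_add2l (many_nbrs_le e_sym e_irr e_k33).
Qed.

Lemma few_hub_degree x : x \notin hubs -> #|[set y | e x y]| <= D.
Proof. by rewrite inE -ltnNge => /ltnW. Qed.

End Hubs.
End HubSetsFacts.

(** * A planar drawing yields a winding certificate *)

Module CertificateFacts.
From mathcomp Require Import all_boot all_order all_algebra.
From mathcomp Require Import all_classical all_reals.
From mathcomp Require Import topology normedtype exp.
From mathcomp Require Import Rstruct Rstruct_topology.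
From mathcomp Require Import ring lra zify.
Import HalfPlaneFacts ArcsFacts TurnsFacts MinorsFacts.
Delimit Scope nat_scope with N.
Import Order.TTheory GRing.Theory Num.Theory.
Local Notation RR := Rdefinitions.R.
Local Open Scope ring_scope.

(** Gives one mesh for all pairs of edges, so that the turns of an edge around a vertex are the same
    number in every equation. *)
Lemma eventually_common (I : finType) (P : I -> nat -> Prop) :
  (forall i, exists N0, forall N, (N0 <= N)%N -> P i N) -> exists N, forall i, P i N.
Proof.
move=> /choice[f Hf]; exists (\max_i f i)%N => i; apply: Hf.
exact: (leq_bigmax i).
Qed.

(* [Defs] reads [0], [1] and [<] in Stdlib's [R_scope]; this is the MathComp form. *)
Lemma planarP n (E : {set {set 'I_n}}) : planar E <->
  exists (p : 'I_n -> (RR * RR)%type) (c : {set 'I_n} -> RR -> (RR * RR)%type),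
    injective p /\
    (forall e, e \in E ->
       exists x y : 'I_n, [/\ x != y, e = [set x; y]%SET,
         c e (0 : RR) = p x, c e (1 : RR) = p y &
         [/\ ({within `[(0 : RR), (1 : RR)], continuous (c e)})%classic,
             ({in `[(0 : RR), (1 : RR)]%classic &, injective (c e)})%classic &
             forall t : RR, (0 < t < 1) -> forall v, c e t <> p v]]) /\
    (forall e e', e \in E -> e' \in E -> e != e' ->
       forall t s : RR, (0 < t < 1) -> (0 < s < 1) -> c e t <> c e' s).
Proof.
have lt01 (t : RR) : (0 < t < 1) <->
    (Rdefinitions.Rlt (Rdefinitions.IZR BinNums.Z0) t /\ Rdefinitions.Rlt t (Rdefinitions.IZR (BinNums.Zpos BinNums.xH))).
  by split=> [/andP[/RltP ? /RltP ?]|[/RltP ? /RltP ?]]; [split|apply/andP; split].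
split=> -[p [c [pinj [HE Hd]]]]; exists p, c; split=> //; split.
- move=> e /HE[x [y [h1 h2 h3 h4 [h5 h6 h7]]]]; exists x, y; split=> //; split=> //.
  by move=> t /lt01; exact: h7.
- by move=> e e' eE e'E ee' t s /lt01 t01 /lt01 s01; exact: Hd.
- move=> e /HE[x [y [h1 h2 h3 h4 [h5 h6 h7]]]]; exists x, y; split=> //; split=> //.
  by move=> t /lt01; exact: h7.
- by move=> e e' eE e'E ee' t s /lt01 t01 /lt01 s01; exact: Hd.
Qed.

Lemma planar_certificate n (E : {set {set 'I_n}}) : planar E ->
  winding_certificate (fun x y => [set x; y]%SET \in E).
Proof.
move=> /planarP[p [c [pinj [HE Hdisj]]]].
have ori x y : [set x; y]%SET \in E -> x != y /\
   (c [set x; y]%SET 0 = p x /\ c [set x; y]%SET 1 = p y \/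
    c [set x; y]%SET 0 = p y /\ c [set x; y]%SET 1 = p x).
  move=> /[dup] xyE /HE[a [b [ab eq c0 c1 _]]].
  have /andP[] : (x \in [set a; b]%SET) && (y \in [set a; b]%SET).
    by rewrite -eq !inE !eqxx orbT.
  have /andP[] : (a \in [set x; y]%SET) && (b \in [set x; y]%SET).
    by rewrite eq !inE !eqxx orbT.
  rewrite !inE; move: ab c0 c1; set g := c _.
  case: (eqVneq x y) => [<-|xy].
    by rewrite !orbb => /eqP ne _ _ /eqP ax /eqP bx; case: ne; rewrite ax bx.
  move=> ne c0 c1 _ _ /orP[]/eqP xa /orP[]/eqP yb; split=> //.
  - by case/eqP: xy; rewrite xa yb.
  - by left; rewrite c0 c1 xa yb.
  - by right; rewrite c0 c1 xa yb.
  - by case/eqP: xy; rewrite xa yb.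
have cont e : e \in E -> arc_continuous (c e).
  by move=> /HE[a [b [_ _ _ _ [h _ _]]]]; apply: within_arc_continuous.
have avoid e t v : e \in E -> 0 <= t <= 1 -> v \notin e -> c e t != p v.
  move=> /HE[a [b [_ -> c0 c1 [_ _ H]]]] /andP[t0 t1].
  rewrite !inE negb_or => /andP[va vb].
  move: t0 t1; rewrite !le_eqVlt => /orP[/eqP <- _|t0].
    by rewrite c0; apply: contraNneq va => /pinj ->.
  move=> /orP[/eqP ->|t1]; first by rewrite c1; apply: contraNneq vb => /pinj ->.
  by apply/eqP; apply: H; rewrite t0 t1.
have disj e e' t s : e \in E -> e' \in E -> [disjoint e & e']%B ->
    0 <= t <= 1 -> 0 <= s <= 1 -> c e t != c e' s.
  move=> eE e'E dis t01 s01.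
  have out v : v \in e -> v \notin e' by move=> ve; rewrite (disjointFr dis ve).
  have out' v : v \in e' -> v \notin e by move=> ve; rewrite (disjointFl dis ve).
  have [a [b [_ eq c0 c1 _]]] := HE _ eE.
  have [a' [b' [_ eq' c0' c1' _]]] := HE _ e'E.
  have [ae be] : a \in e /\ b \in e by rewrite eq !inE !eqxx orbT.
  have [ae' be'] : a' \in e' /\ b' \in e' by rewrite eq' !inE !eqxx orbT.
  case/andP: (t01); rewrite !le_eqVlt => /orP[/eqP <- _|t0].
    by rewrite c0 eq_sym avoid // out.
  move=> /orP[/eqP ->|t1]; first by rewrite c1 eq_sym avoid // out.
  case/andP: (s01); rewrite !le_eqVlt => /orP[/eqP <- _|s0].
    by rewrite c0' avoid // out'.
  move=> /orP[/eqP ->|s1]; first by rewrite c1' avoid // out'.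
  apply/eqP; apply: Hdisj; rewrite ?t0 ?s0 //.
  by apply/eqP => ee'; move: (out _ ae); rewrite -ee' ae.
have [|N HN] := @eventually_common ({set 'I_n} * {set 'I_n})%type (fun q N =>
    q.1 \in E -> q.2 \in E -> [disjoint q.1 & q.2]%B ->
    turns N (c q.1) (c q.2 0) + turns N (c q.2) (c q.1 1) =
    turns N (c q.2) (c q.1 0) + turns N (c q.1) (c q.2 1)).
  move=> [e e'] /=.
  case: (boolP [&& e \in E, e' \in E & [disjoint e & e']%B]); last first.
    by move=> H; exists 0%N => N _ h1 h2 h3; move: H; rewrite h1 h2 h3.
  move=> /and3P[eE e'E dis].
  have [|N0 HN0] := uniformly_close (cont _ eE) (cont _ e'E).
    by move=> t s t01 s01; apply: disj.
  by exists N0 => N hN _ _ _; apply: turns_square; apply: HN0.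
(* A drawn arc has its own direction; the sign corrects for the traversal from its second end to its
   first. *)
pose w x y v := let g := c [set x; y]%SET in
  if g 0 == p x then turns N g (p v) else - turns N g (p v).
pose h x v : int := (upper (p x - p v))%:Z.
exists w, h; split.
- move=> x y v /ori[xy]; rewrite /w [[set y; x]%SET]finset.setUC; case=> -[-> _].
    by rewrite eqxx (inj_eq pinj) (negbTE xy).
  by rewrite eqxx (inj_eq pinj) eq_sym (negbTE xy) opprK.
- move=> x y v xyE vx vy; have [xy o] := ori _ _ xyE.
  have [k Hk] := turns_parity N (c [set x; y]%SET) (p v).
  rewrite /w /h; case: o Hk => -[-> ->] Hk.
    by exists k; rewrite eqxx Hk.
  exists (- k - (upper (p y - p v))%:Z + (upper (p x - p v))%:Z + (upper (p y - p v))%:Z - (upper (p x - p v))%:Z).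
  by rewrite (inj_eq pinj) eq_sym (negbTE xy) Hk; ring.
- move=> x v xv; rewrite /h -(opprB (p x)) upperN; first by case: (upper _).
  by rewrite subr_eq0 (inj_eq pinj).
- move=> a b x d abE cdE /= /and4P[]; rewrite !inE !negb_or.
  move=> /and3P[ab ac ad] /andP[bc bd] cd _.
  have dis : [disjoint [set a; b]%SET & [set x; d]%SET]%B.
    rewrite -setI_eq0; apply/eqP/setP => z; rewrite !inE.
    apply/negP => /andP[/orP[]/eqP-> /orP[]/eqP ee]; move: ac ad bc bd;
      by rewrite ee eqxx.
  have := HN ([set a; b]%SET, [set x; d]%SET) abE cdE dis => /=.
  have [_ o1] := ori _ _ abE; have [_ o2] := ori _ _ cdE.
  rewrite /w; case: o1 => -[-> ->]; case: o2 => -[-> ->] H;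
    rewrite ?eqxx ?(inj_eq pinj) 1?[b == a]eq_sym 1?[d == x]eq_sym ?(negbTE ab) ?(negbTE cd); lia.
Qed.
End CertificateFacts.

(** * From copies to embeddings *)

Module CopyCountFacts.
From mathcomp Require Import all_boot all_order all_algebra.
From mathcomp Require Import ring lra zify.
Import HalfPlaneFacts MinorsFacts DegeneracyFacts AttachmentFacts BundlesFacts FewNeighboursFacts WeightsFacts ClosedWalksFacts CanonicalFacts TriplesFacts.
Import GRing.Theory.

Section Copies.
Variables (n : nat) (E : {set {set 'I_n}}).
Hypothesis simpleE : simple_graph E.

Definition adj : rel 'I_n := fun x y => [set x; y] \in E.

Lemma adj_sym : symmetric adj.
Proof. by move=> x y; rewrite /adj setUC. Qed.

Lemma adj_irr : irreflexive adj.
Proof.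
move=> x; apply/negP => xE; have /forall_inP/(_ _ xE) := simpleE.
by rewrite setUid cards1.
Qed.

(** For copies with m sources only a canonical embedding is counted, not all symmetries of the
    cycle; this keeps the leading constant. For the others any embedding will do. *)
Lemma ncopies_le (rk : 'I_n -> nat) (m' : nat) : injective rk ->
  ncopies E (cycle_edges m'.+2.*2.+1) <= #|few_sources adj rk m'| + #|triples adj rk m'|.
Proof.
move=> rk_inj; set k := m'.+2.*2.+1.
pose copy (f : {ffun 'I_k -> 'I_n}) : {set 'I_n} * {set {set 'I_n}} :=
  (f @: [set: 'I_k], [set f @: (e : {set 'I_k}) | e in cycle_edges k]).
have copyE f : copy f = (f @: [set: 'I_k], edge_image f).
  congr (_, _); apply/setP => x; apply/imsetP/imsetP.
    case=> _ /imsetP[i _ ->] ->; exists i => //.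
    by rewrite imsetU !imset_set1 ordSE.
  case=> i _ ->; exists [set i; ordS i]; first by apply/imsetP; exists i.
  by rewrite imsetU !imset_set1 ordSE.
apply: (@leq_trans (#|few_sources adj rk m'| +
    #|[set g : {ffun 'I_k -> 'I_n} | embedding adj g && canonical adj rk g]|)); last first.
  by rewrite leq_add2l card_canonical.
apply: (@leq_trans #|copy @: (few_sources adj rk m' :|:
    [set g : {ffun 'I_k -> 'I_n} | embedding adj g && canonical adj rk g])|); last first.
  by apply: leq_trans (leq_imset_card _ _) _; exact: leq_card_setU.
apply: subset_leq_card; apply/subsetP => -[V F]; rewrite inE /= => /andP[FE].
case/existsP=> f /and3P[f_inj /eqP Vf /eqP Ff].
have VF : (V, F) = copy f by rewrite Vf Ff.
have ef : embedding adj f.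
  apply/andP; split=> //; apply/forallP => i; apply: (subsetP FE).
  have [_ ->] : V = (copy f).1 /\ F = (copy f).2 by rewrite -VF.
  by rewrite copyE; apply/imsetP; exists i.
have [few|many] := ltnP #|sources adj rk f| m'.+2.
  apply/imsetP; exists f => //; apply/setUP; left; rewrite /few_sources in_set ef /=; exact: few.
have Qm : #|sources adj rk f| = m'.+2.
  by apply/eqP; rewrite eqn_leq many card_sources //; exact: adj_sym.
have [g [eg h1 h2 cg]] := canonical_exists adj_sym rk_inj ef Qm.
apply/imsetP; exists g; first by rewrite in_setU [X in _ || X]inE eg cg orbT.
by rewrite VF !copyE h1 h2.
Qed.

End Copies.
End CopyCountFacts.

(** * The upper bound for a single graph *)

Module GraphUpperFacts.
From mathcomp Require Import all_boot all_order all_algebra.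
From mathcomp Require Import all_classical all_reals.
From mathcomp Require Import ring lra zify.
Import HalfPlaneFacts MinorsFacts CertificateFacts DegeneracyFacts AttachmentFacts BundlesFacts FewNeighboursFacts WeightsFacts TotalWeightFacts ClosedWalksFacts CanonicalFacts TriplesFacts CopyCountFacts PathSumsFacts PerturbationFacts HeaviestEdgeFacts GrowthFacts ShortGrowthFacts PolynomialsFacts ShortBoundsFacts MaximisersFacts WeightingFacts HubSetsFacts.
Import Order.TTheory GRing.Theory Num.Theory.
Local Open Scope nat_scope.

(** From r + 1 <= 2r one gets n < 32 r^5, and 14 * 32 = 448. *)
Lemma fifth_root_hubs n r b : 0 < r -> n < r.+1 ^ 5 -> b * r ^ 4 <= 14 * n -> b <= 448 * r.
Proof.
move=> r0 nr h; have r4 : 0 < r ^ 4 by rewrite expn_gt0 r0.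
rewrite -(leq_pmul2r r4) (leq_trans h) // -[448]/(14 * 32) -!mulnA leq_mul2l /=.
apply: (leq_trans (ltnW nr)); rewrite -expnS -[32]/(2 ^ 5) -expnMn leq_exp2r //; lia.
Qed.

Lemma bad_bound r c b x : 0 < r -> 0 < c -> b <= c * r -> x <= b + 2 * b ^ 3 -> x <= 3 * c ^ 3 * r ^ 4.
Proof.
move=> r0 c0 bc xb; have b3 : b ^ 3 <= c ^ 3 * r ^ 4.
  apply: (@leq_trans ((c * r) ^ 3)); first by rewrite leq_exp2r.
  by rewrite expnMn leq_mul2l leq_pexp2l ?orbT.
have b1 : b <= c ^ 3 * r ^ 4.
  apply: leq_trans bc _; apply: leq_mul; first by rewrite -{1}(expn1 c) leq_pexp2l.
  by rewrite -{1}(expn1 r) leq_pexp2l.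
move: b1 b3 xb; move: (b ^ 3) (c ^ 3 * r ^ 4) (3 * c ^ 3 * r ^ 4) (mulnA 3 (c ^ 3) (r ^ 4)) => u v w E; lia.
Qed.

Lemma weight_bound n r c b x : 0 < r -> 0 < c -> b <= c * r -> x <= 4 * n + 38 * b ^ 3 * (4 * b + 120) ->
  x <= 4 * n + 4 * (1178 * c ^ 4) * r ^ 4.
Proof.
move=> r0 c0 bc xb; apply: leq_trans xb _; rewrite leq_add2l.
apply: (@leq_trans (38 * (c * r) ^ 3 * (4 * (c * r) + 120 * (c * r)))).
  apply: leq_mul; first by rewrite leq_mul2l leq_exp2r.
  have : 0 < c * r by rewrite muln_gt0 c0. 
  move: (c * r) bc => y; lia.
apply: eq_leq; rewrite !expnMn; ring.
Qed.
Lemma copies_arith m f N u bad h few tri t a b :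
  few <= a * (b * N) -> tri <= m * (f * (14 * (210 * u * N))) + m * (f * (14 * (bad * N))) + t ->
  bad <= 3 * h * u -> 0 < u ->
  few + tri <= (a * b + m * (f * (14 * 210)) + m * (f * (14 * (3 * h)))) * (N * u) + t.
Proof.
move=> hf ht hb u0; apply: leq_trans (leq_add hf ht) _; rewrite addnA leq_add2r addnA.
rewrite 2!mulnDl; apply: leq_add; first apply: leq_add.
- by rewrite -mulnA leq_mul2l leq_mul2l leq_pmulr ?orbT.
- by apply: eq_leq; ring.
apply: (@leq_trans (m * (f * (14 * (3 * h * u * N))))); last by apply: eq_leq; ring.
by rewrite !leq_mul2l leq_mul2r hb !orbT.
Qed.

Local Open Scope ring_scope.

Section GraphBound.
Variable R : realType.

Lemma expr_add_le (a x : R) k : 0 <= a -> 0 <= x ->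
  (a + x) ^+ k.+1 <= a ^+ k.+1 + k.+1%:R * x * (a + x) ^+ k.
Proof.
move=> a0 x0; elim: k => [|k IH]; first by rewrite !expr1 expr0 mulr1 mul1r.
have h : a ^+ k.+1 <= (a + x) ^+ k.+1 by rewrite lerXn2r ?nnegrE ?addr_ge0 ?lerDl.
rewrite [(a + x) ^+ k.+2]exprSr; apply: le_trans (ler_wpM2r _ IH) _; first exact: addr_ge0.
have -> : k.+2%:R = k.+1%:R + 1 :> R by rewrite natr1.
rewrite [a ^+ k.+2]exprSr; have := ler_wpM2r x0 h; rewrite [(a + x) ^+ k.+1]exprSr.
move: (a ^+ k.+1) ((a + x) ^+ k) (k.+1%:R) => u v N; lra.
Qed.

Lemma pc_const_ge0 n : 0 <= pc_const R n.
Proof. by case: n => [|[|[|k]]] //=; rewrite ?divr_ge0 // exprn_ge0 // invr_ge0. Qed.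

Lemma ncopies_bound m' : exists C : R, 0 <= C /\ forall n (E : {set {set 'I_n}}) r,
  simple_graph E -> planar E -> (0 < r)%N -> (r ^ 5 <= n)%N -> (n < r.+1 ^ 5)%N ->
  (ncopies E (cycle_edges m'.+2.*2.+1))%:R <=
    pc_const R m' * n%:R ^+ m'.+2 + C * (n%:R ^+ m'.+1 * r%:R ^+ 4).
Proof.
pose m := m'.+2; pose k := m.*2.+1.
(* The factor 400 is that of [card_hubs1] and 448 that of [fifth_root_hubs]; c stays abstract so
   that the product is never unfolded. *)
have [c c0 cE] : exists2 c, (0 < c)%N & c = (400 * 448)%N by exists (400 * 448)%N.
pose C1 := (2 ^ k * 14 ^ k + m * (14 ^ m * (14 * 210)) + m * (14 ^ m * (14 * (3 * c ^ 3))))%N.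
pose C2 := (1178 * c ^ 4)%N.
exists (C1%:R + pc_const R m' * (m%:R * C2%:R * (1 + C2%:R) ^+ m'.+1)).
have K0 := pc_const_ge0 m'; split.
  by rewrite addr_ge0 // !mulr_ge0 // exprn_ge0 // addr_ge0.
move=> n E r sE pE r0 rn nr; pose e := adj E.
have e_sym : symmetric e := adj_sym E.
have e_irr : irreflexive e := adj_irr sE.
have e_k33 : k33_minor_free e.
  apply: certificate_k33_minor_free => //; exact: planar_certificate.
have [rk [rk_inj out14]] := degenerate_rank e_sym e_irr e_k33.
(* With n about r^5 this threshold leaves O(r) hubs, hence O(r^3) bad vertices and O(r^4) excess
   weight, level with D itself. *)
pose D := (r ^ 4)%N; pose B0 := hubs e D; pose B1 := hubs1 e D.
have sB : B0 \subset B1 by apply: finset.subsetUl.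
have few0 := @few_hubs _ e D.
have hb0 : (#|B0| <= 448 * r)%N.
  by apply: (fifth_root_hubs r0 nr); have := card_hubs D e_sym e_irr e_k33; rewrite card_ord.
have hb1 : (#|B1| <= c * r)%N.
  apply: leq_trans (card_hubs1 D e_sym e_k33) _; rewrite -/B0; apply: leq_trans (leq_mul (leqnn _) hb0) _.
  by rewrite cE mulnA.
have hbad := bad_bound r0 c0 hb1 (card_bad D e_sym e_irr e_k33).
have hw := weight_sum_le e_sym e_irr e_k33 out14 sB few0; rewrite card_ord in hw.
have {}hw := weight_bound r0 c0 hb1 hw.
have ht := card_triples_le m' e_sym out14 B1 (@few_hub_degree _ e D).
rewrite card_ord -/m in ht.
have hf := card_few_sources m' e_sym rk_inj out14; rewrite card_ord -/m -/k in hf.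
have hc := ncopies_le E m' rk_inj.
set t1 := #|[set c in main_triples e rk m' B0 B1 | pass_of c \notin B1]| in ht.
set t2 := #|[set c in main_triples e rk m' B0 B1 | pass_of c \in B1]| in ht.
have nat_part : (ncopies E (cycle_edges m'.+2.*2.+1) <= C1 * (n ^ m'.+1 * r ^ 4) + (t1 + t2))%N.
  by apply: leq_trans hc _; apply: copies_arith hf ht hbad _; rewrite expn_gt0 r0.
have t12 : (t1 + t2)%:R <= pc_sum m'.+1 (half_weight R e rk B0 B1).
  rewrite /pc_sum natrD; apply: lerD.
    apply: le_trans (type1_le R e_sym e_irr e_k33 rk sB few0 m'); rewrite ler_nat.
    exact: card_type1.
  apply: le_trans (type2_le R e_sym rk sB few0 m'); rewrite ler_nat.
  exact: card_type2.
have fM : feasible (half_weight R e rk B0 B1) by apply: feasible_half_weight.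
have sM : ssum (half_weight R e rk B0 B1) / 2 <= n%:R + C2%:R * r%:R ^+ 4.
  have -> : ssum (half_weight R e rk B0 B1) = (\sum_u \sum_v weight e rk B0 B1 u v)%N%:R / 2.
    rewrite /ssum natr_sum mulr_suml; apply: eq_bigr => u _.
    by rewrite natr_sum mulr_suml.
  have : (\sum_u \sum_v weight e rk B0 B1 u v)%N%:R <= 4 * n%:R + 4 * C2%:R * r%:R ^+ 4 :> R.
    by rewrite -natrX -!natrM -natrD ler_nat.
  by move: (_%:R) (C2%:R) => x y; lra.
have sM0 : 0 <= ssum (half_weight R e rk B0 B1) / 2 by rewrite divr_ge0 // ssum_ge0.
have rn4 : r%:R ^+ 4 <= n%:R :> R.
  by rewrite -natrX ler_nat; apply: leq_trans rn; rewrite leq_pexp2l.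
have C20 : 0 <= C2%:R :> R by [].
have n0 : 0 <= n%:R :> R by [].
have r40 : 0 <= r%:R ^+ 4 :> R by rewrite exprn_ge0.
have pcb : pc_sum m'.+1 (half_weight R e rk B0 B1) <=
    pc_const R m' * (n%:R ^+ m + m%:R * C2%:R * (1 + C2%:R) ^+ m'.+1 * (n%:R ^+ m'.+1 * r%:R ^+ 4)).
  apply: le_trans (pc_sum_le m' fM) _; apply: ler_wpM2l => //.
  apply: (@le_trans _ _ ((n%:R + C2%:R * r%:R ^+ 4) ^+ m)).
    by rewrite lerXn2r ?nnegrE // addr_ge0 // mulr_ge0.
  apply: le_trans (expr_add_le _ n0 (mulr_ge0 C20 r40)) _; rewrite lerD2l -/m.
  have h : (n%:R + C2%:R * r%:R ^+ 4) ^+ m'.+1 <= (1 + C2%:R) ^+ m'.+1 * n%:R ^+ m'.+1 :> R.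
    rewrite -exprMn lerXn2r ?nnegrE ?addr_ge0 ?mulr_ge0 // ?addr_ge0 //.
    by rewrite mulrDl mul1r lerD2l ler_wpM2l.
  have := ler_wpM2l (mulr_ge0 (ler0n R m) (mulr_ge0 C20 r40)) h.
  by move: (m%:R) (r%:R ^+ 4) (_ ^+ m'.+1) (_ ^+ m'.+1) => *; lra.
have := le_trans t12 pcb; have : (ncopies E (cycle_edges m'.+2.*2.+1))%:R <=
    C1%:R * (n%:R ^+ m'.+1 * r%:R ^+ 4) + (t1 + t2)%:R :> R.
  by rewrite -!natrX -!natrM -natrD ler_nat.
lra.
Qed.
End GraphBound.
End GraphUpperFacts.

(** * The upper bound in terms of n *)

Module UpperFacts.
From mathcomp Require Import all_boot all_order all_algebra.
From mathcomp Require Import all_classical all_reals.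
From mathcomp Require Import topology normedtype exp.
From mathcomp Require Import ring lra zify.
Import MaximisersFacts GraphUpperFacts.
Import Order.TTheory GRing.Theory Num.Theory.
Local Open Scope ring_scope.

Section Upper.
Variable R : realType.

Lemma fifth_root n : (0 < n)%N -> exists r, [/\ (0 < r)%N, (r ^ 5 <= n)%N & (n < r.+1 ^ 5)%N].
Proof.
move=> n0; have ex1 : exists i, (i ^ 5 <= n)%N by exists 0%N.
have bnd i : (i ^ 5 <= n)%N -> (i <= n)%N.
  by apply: leq_trans; case: i => [|i] //; rewrite -{1}(expn1 i.+1) leq_pexp2l.
exists (ex_maxn ex1 bnd); case: ex_maxnP => r rn rmax; split=> //.
  by apply: rmax; rewrite exp1n.
by rewrite ltnNge; apply/negP => /rmax; rewrite ltnn.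
Qed.

Lemma powR_shift (a : R) m : 0 < a -> a `^ (m.+1%:R - 5^-1) = a ^+ m * a `^ (4 / 5).
Proof.
move=> a0; rewrite -powR_mulrn ?ltW // -powRD; last by apply/implyP => _; rewrite gt_eqF.
by congr (_ `^ _); rewrite -natr1; field.
Qed.

(** The exponent m + 1 - 1/5 is m + 4/5, and r^4 = (r^5)^(4/5). *)
Lemma error_le n m r : (0 < n)%N -> (r ^ 5 <= n)%N ->
  n%:R ^+ m * r%:R ^+ 4 <= n%:R `^ (m.+1%:R - 5^-1) :> R.
Proof.
move=> n0 rn; rewrite powR_shift ?ltr0n // ler_wpM2l ?exprn_ge0 //.
have -> : r%:R ^+ 4 = (r ^ 5)%:R `^ (4 / 5) :> R.
  rewrite natrX -!powR_mulrn // -powRrM; congr (_ `^ _); by field.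
by rewrite ge0_ler_powR ?nnegrE ?divr_ge0 ?ler_nat.
Qed.

Lemma power_le_error n m : (0 < n)%N -> n%:R ^+ m <= n%:R `^ (m.+1%:R - 5^-1) :> R.
Proof.
by move=> n0; have := @error_le n m 1 n0; rewrite expr1n mulr1 exp1n; apply.
Qed.

Lemma NP_upper m' : exists C : R, 0 <= C /\ forall n, (0 < n)%N ->
  (NP n (cycle_edges m'.+2.*2.+1))%:R <=
    pc_const R m' * n%:R ^+ m'.+2 + C * n%:R `^ (m'.+2%:R - 5^-1).
Proof.
have [C [C0 H]] := ncopies_bound R m'; exists C; split=> // n n0.
have [r [r0 rn nr]] := fifth_root n0.
have bound : 0 <= pc_const R m' * n%:R ^+ m'.+2 + C * n%:R `^ (m'.+2%:R - 5^-1).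
  by rewrite addr_ge0 // mulr_ge0 ?pc_const_ge0 ?exprn_ge0 ?powR_ge0.
rewrite /NP; elim/big_ind: _ => [//|x y hx hy|E /andP[sE /asboolP pE]].
  by rewrite /maxn; case: ifP.
apply: le_trans (H n E r sE pE r0 rn nr) _; rewrite lerD2l ler_wpM2l //; exact: error_le.
Qed.

Lemma expr_1add_le n k : (0 < n)%N -> (k <= n)%N ->
  (1 + n%:R^-1) ^+ k <= 1 + k%:R / n%:R + (k%:R / n%:R) ^+ 2 :> R.
Proof.
move=> n0; elim: k => [|k IH] kn; first by rewrite expr0 mul0r expr0n /= !addr0.
have x0 : 0 < n%:R^-1 :> R by rewrite invr_gt0 ltr0n.
rewrite exprSr; apply: le_trans (ler_wpM2r _ (IH (ltnW kn))) _; first by rewrite addr_ge0 // ltW.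
have kx : k%:R * n%:R^-1 <= 1 :> R by rewrite ler_pdivrMr ?ltr0n // mul1r ler_nat ltnW.
rewrite -natr1; move: (n%:R^-1) x0 kx => x x0 kx; have k0 : 0 <= k%:R :> R by [].
have := mulr_ge0 (mulr_ge0 (mulr_ge0 k0 (ltW x0)) (ltW x0)) (_ : 0 <= 1 - k%:R * x).
have := mulr_ge0 (ltW x0) (ltW x0); rewrite !expr2.
move: (k%:R) k0 kx => y k0 kx h1 /(_ ltac:(lra)); lra.
Qed.

(** With n = m - 1 the claim is (1 + 1/n)^n <= 3, the case k = n of [expr_1add_le]. *)
Lemma pc_const_le m : (5 <= m)%N -> pc_const R m.-2 <= 3 * m%:R / m%:R ^+ m.
Proof.
case: m => [|[|[|[|[|m]]]]] // _; rewrite [_.-2]/= [pc_const _ _]/=.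
set n := m.+4; have n0 : (0 < n)%N by [].
have np : 0 < n%:R :> R by rewrite ltr0n.
have sp : 0 < n.+1%:R :> R by rewrite ltr0n.
have := @expr_1add_le n n n0 (leqnn n); rewrite divff ?gt_eqF // expr1n.
have -> : 1 + n%:R^-1 = n.+1%:R / n%:R :> R by rewrite -natr1 mulrDl divff ?gt_eqF // mul1r.
rewrite expr_div_n ler_pdivrMr ?exprn_gt0 // => h.
rewrite exprS invfM mulrA mulfK ?gt_eqF // exprVn -[(_ ^+ n)^-1]mul1r ler_pdivrMr ?exprn_gt0 //.
by rewrite mulrAC ler_pdivlMr ?exprn_gt0 // mul1r; lra.
Qed.

End Upper.
End UpperFacts.

(** * Copies in a blown-up cycle of hubs *)

Module BlowupsFacts.
From mathcomp Require Import all_boot all_order all_algebra.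
From mathcomp Require Import ring lra zify.
Import CanonicalFacts.
Import GRing.Theory.
Local Open Scope nat_scope.

Lemma set2_eq (T : finType) (a b a' b' : T) : [set a; b] = [set a'; b'] ->
  (a = a' /\ b = b') \/ (a = b' /\ b = a').
Proof.
move=> E; have := set21 a b; have := set22 a b; have := set21 a' b'; have := set22 a' b'.
rewrite -{1 2}E {3 4}E !inE => /orP[/eqP-> | /eqP->] /orP[/eqP-> | /eqP->] /orP[/eqP e1|/eqP e1] /orP[/eqP e2|/eqP e2];
  subst; tauto.
Qed.

Section LowerCopies.
Variables (n m'' : nat) (E : {set {set 'I_n}}).
Local Notation m := m''.+2.
Local Notation k := m.*2.+1.
Variables (P : finType) (d : P -> 'I_m) (X : P -> 'I_m -> 'I_n) (y : P -> 'I_n).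
Variables (h : 'I_m -> 'I_n) (hub : pred 'I_n).
Hypothesis hub_h : forall c, hub (h c).
Hypothesis h_inj : injective h.
Hypothesis nX : forall p c, ~~ hub (X p c).
Hypothesis ny : forall p, ~~ hub (y p).
Hypothesis X_inj : forall p, injective (X p).
Hypothesis yX : forall p c, y p != X p c.
Hypothesis lt_y : forall p, X p (d p) < y p.
Hypothesis E1 : forall p c, [set h c; X p c] \in E.
Hypothesis E2 : forall p c, [set X p c; h (c + 1)%R] \in E.
Hypothesis E3 : forall p, [set X p (d p); y p] \in E.
Hypothesis E4 : forall p, [set h (d p); y p] \in E.
Hypothesis E5 : forall p, [set y p; h (d p + 1)%R] \in E.
Hypothesis dU : forall p q, X p (d p) = X q (d q) -> d p = d q.
Hypothesis cU : forall p q c c', d p = d q -> c != d p -> c' != d p -> X p c = X q c' -> c = c'.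
Hypothesis pU : forall p q, d p = d q -> (forall c, X p c = X q c) -> y p = y q -> p = q.

Definition step_a (c : P * bool) := if c.2 then X c.1 (d c.1) else y c.1.
Definition step_b (c : P * bool) := if c.2 then y c.1 else X c.1 (d c.1).
Definition shift c (j : nat) : 'I_m := (d c + inZp j)%R.
(** Position 0 is the first hub of the doubled cone; 1 and 2 are the two vertices of that cone, in
    the order given by the Boolean. From there on hubs occupy 3, 5, ..., 2m - 1 and the single
    vertices of the other cones 4, 6, ..., 2m. *)
Definition walk (c : P * bool) (i : nat) : 'I_n :=
  if i == 1 then step_a c else if i == 2 then step_b c else
  if (i == 0) || odd i then h (shift c.1 i./2) else X c.1 (shift c.1 i./2.-1).

Lemma shift0 p : shift p 0 = d p.
Proof. by rewrite /shift (_ : inZp 0 = 0%R) ?addr0 //; apply: val_inj. Qed.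

Lemma shiftS p j : shift p j.+1 = (shift p j + 1)%R.
Proof. by rewrite /shift -addrA; congr (_ + _)%R; apply: val_inj; rewrite /= modnDml modnDmr addn1. Qed.

Lemma shift_inj p i j : i < m -> j < m -> shift p i = shift p j -> i = j.
Proof. by move=> im jm /addrI/(congr1 val) /=; rewrite !modn_small. Qed.

Lemma shift_m p : shift p m = d p.
Proof. by rewrite -[RHS]shift0 /shift; congr (_ + _)%R; apply: val_inj; rewrite /= modnn mod0n. Qed.

Lemma shift_surj p c : c != d p -> exists j, [/\ 0 < j, j < m & shift p j = c].
Proof.
move=> cd; exists (c - d p)%R; rewrite ltn_ord; split=> //.
  by rewrite lt0n; apply: contra cd => /eqP j0; rewrite -subr_eq0; apply/eqP/val_inj.
by rewrite /shift valZpK addrC subrK.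
Qed.

Definition hub_pos i := (i == 0) || ((2 < i) && odd i).

Lemma hub_walk c i : hub (walk c i) = hub_pos i.
Proof.
rewrite /walk /hub_pos; case: i => [|[|[|i]]] //=.
- exact: hub_h.
- by rewrite /step_a; case: c.2; apply/negbTE.
- by rewrite /step_b; case: c.2; apply/negbTE.
by case: ifP => _; [apply: hub_h | apply/negbTE].
Qed.

Lemma walk_hub c i : hub_pos i -> walk c i = h (shift c.1 i./2).
Proof. by case: i => [|[|[|i]]] //; rewrite /hub_pos /walk /= => ->. Qed.

Lemma walk_far c i : 3 < i -> ~~ odd i -> walk c i = X c.1 (shift c.1 i./2.-1).
Proof. by case: i => [|[|[|[|i]]]] // _ /negbTE oi; rewrite /walk /= in oi *; rewrite oi. Qed.

Lemma pos_cases i : hub_pos i \/ [\/ i = 1, i = 2 | 3 < i /\ ~~ odd i].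
Proof.
rewrite /hub_pos; case: i => [|[|[|[|i]]]]; rewrite ?orbT; [by left | by right; constructor 1
  | by right; constructor 2 | by left | ].
by case: (odd i.+4); [left | right; constructor 3].
Qed.

Lemma half_lt i : i < k -> hub_pos i -> i./2 < m.
Proof.
rewrite /hub_pos => ik /orP[/eqP->//|/andP[_ oi]].
by have := odd_double_half i; rewrite oi; move: ik; rewrite -!muln2; move: (i./2) => j; lia.
Qed.

Lemma far_half i : i < k -> 3 < i -> ~~ odd i -> [/\ 0 < i./2.-1, i./2.-1 < m & i./2.-1.+1.*2 = i].
Proof.
move=> ik i3 /negbTE oi; have := odd_double_half i; rewrite oi add0n; move: ik i3; rewrite -!muln2.
by move: (i./2) => j ik i3 ij; split; lia.
Qed.

Lemma far_neq (c : P * bool) i : i < k -> 3 < i -> ~~ odd i -> shift c.1 i./2.-1 != d c.1.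
Proof.
move=> ik i3 oi; have [j0 jm _] := far_half ik i3 oi; apply/eqP; rewrite -[RHS]shift0.
by move/(shift_inj jm (isT : 0 < m)) => j00; rewrite j00 in j0.
Qed.

Lemma step_neq_X c p' e : (step_a c = X c.1 e \/ step_b c = X c.1 e) -> p' = tt -> e = d c.1.
Proof.
rewrite /step_a /step_b; case: c.2 => [] [] H _; first exact: esym (X_inj H).
- by move/eqP: H; rewrite (negbTE (yX _ _)).
- by move/eqP: H; rewrite (negbTE (yX _ _)).
exact: esym (X_inj H).
Qed.

Lemma step_neq c : step_a c != step_b c.
Proof. by rewrite /step_a /step_b; case: c.2; rewrite ?yX // eq_sym yX. Qed.

Lemma walk_inj c i j : i < k -> j < k -> walk c i = walk c j -> i = j.
Proof.
move=> ik jk Ew; have := hub_walk c i; rewrite Ew hub_walk => Eh.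
case: (pos_cases i) => [hi|hi].
  have hj : hub_pos j by rewrite Eh.
  have := Ew; rewrite !walk_hub // => /h_inj/(shift_inj (half_lt ik hi) (half_lt jk hj)) Eij.
  have := odd_double_half i; have := odd_double_half j; rewrite -Eij.
  move: hi hj; rewrite /hub_pos => /orP[/eqP i0|/andP[i2 ->]] /orP[/eqP j0|/andP[j2 ->]].
  - by rewrite i0 j0.
  - by rewrite i0 /= => Ej; rewrite -Ej in j2.
  - by move=> _; rewrite Eij j0 /= => Ei; rewrite -Ei in i2.
  by move=> -> ->.
case: (pos_cases j) => [hj|hj].
  by case: hi Eh hj => [->|->|[i3 oi]] -> //; rewrite /hub_pos (negbTE oi) andbF; case: (i) i3.
have ab : walk c 1 <> walk c 2 by apply/eqP; exact: step_neq.
have far x : x < k -> 3 < x -> ~~ odd x -> walk c 1 <> walk c x /\ walk c 2 <> walk c x.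
  move=> xk x3 ox; rewrite (walk_far c x3 ox); have /eqP ne := far_neq c xk x3 ox.
  by split=> H; apply: ne; apply: (@step_neq_X c tt) => //; [left|right].
case: hi Ew => [->|->|[i3 oi]]; case: hj => [->|->|[j3 oj]] Ew //.
- by case: (far j jk j3 oj).
- by case: ab.
- by case: (far j jk j3 oj).
- by case: (far i ik i3 oi) => /nesym.
- by case: (far i ik i3 oi) => _ /nesym.
move: Ew; rewrite !walk_far // => /X_inj.
have [i0 im ei] := far_half ik i3 oi; have [j0 jm ej] := far_half jk j3 oj.
by move/(shift_inj im jm) => Eij; rewrite -ei -ej Eij.
Qed.

Lemma walk_edge c i : i < k -> [set walk c i; walk c (i.+1 %% k)] \in E.
Proof.
move=> ik; case: (pos_cases i) => [hi|[->|->|[i3 oi]]].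
- have him := half_lt ik hi; have ik1 : i.+1 < k.
    rewrite ltn_neqAle ik andbT; apply/eqP => /succn_inj im; move: hi; rewrite /hub_pos im odd_double.
    by rewrite andbF orbF.
  rewrite modn_small // walk_hub //; case/orP: hi => [/eqP->|/andP[i2 oi]].
    by rewrite shift0 /walk /= /step_a; case: c.2; rewrite ?E1 ?E4.
  have e2 : i.+1./2 = i./2.+1 by rewrite -[i.+1./2]/(uphalf i) uphalf_half oi.
  rewrite walk_far ?ltnS //; last by rewrite /= oi.
  by rewrite e2; apply: E1.
- by rewrite modn_small // /walk /= /step_a /step_b; case: c.2; rewrite ?E3 // setUC E3.
- rewrite modn_small // [walk c 3]walk_hub // shiftS shift0 /walk /= /step_b.
  by case: c.2; rewrite ?E2 ?E5.
have [j0 jm ij] := far_half ik i3 oi; rewrite walk_far //; move: (i./2.-1) j0 jm ij => j j0 jm ij.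
have [jlt|jge] := ltnP j.+1 m.
  rewrite modn_small -?ij; last by rewrite ltnS ltn_double.
  have hh : (j.+1.*2).+1./2 = j.+1 by rewrite -uphalfE uphalf_double.
  rewrite [walk c (_.+1)]walk_hub; last by rewrite /hub_pos /= ?odd_double.
  by rewrite hh shiftS; apply: E2.
have jm1 : j.+1 = m by apply/eqP; rewrite eqn_leq jm jge.
by rewrite -ij jm1 modnn walk_hub // shift0 -[d c.1](shift_m c.1) -jm1 shiftS E2.
Qed.

Definition walkf c : {ffun 'I_k -> 'I_n} := [ffun i : 'I_k => walk c i].
Definition copy_of c : {set 'I_n} * {set {set 'I_n}} :=
  (walkf c @: [set: 'I_k], [set walkf c @: (e : {set 'I_k}) | e in cycle_edges k]).

Lemma walkf_edge c (i : 'I_k) : walkf c @: [set i; ordS i] = [set walk c i; walk c (i.+1 %% k)].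
Proof. by rewrite imsetU !imset_set1 !ffunE. Qed.

Lemma copy_edgeP c e : reflect (exists2 i : nat, i < k & e = [set walk c i; walk c (i.+1 %% k)])
  (e \in (copy_of c).2).
Proof.
apply: (iffP imsetP) => [[u /imsetP[i _ ->] ->]|[i ik ->]].
  by exists i; rewrite ?walkf_edge.
exists [set Ordinal ik; ordS (Ordinal ik)]; last by rewrite walkf_edge.
by apply/imsetP; exists (Ordinal ik).
Qed.

Lemma copy_vertexP c v : reflect (exists2 i : nat, i < k & v = walk c i) (v \in (copy_of c).1).
Proof.
apply: (iffP imsetP) => [[i _ ->]|[i ik ->]]; first by exists i; rewrite ?ffunE.
by exists (Ordinal ik); rewrite ?ffunE ?inE.
Qed.

Lemma edge_nonhub i : i < k -> ~~ hub_pos i -> ~~ hub_pos (i.+1 %% k) -> i = 1.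
Proof.
move=> ik hi; case: (pos_cases i) => [h'|[//|->|[i3 oi]]]; [by rewrite h' in hi | by rewrite modn_small | ].
have [ik1|ik1] := ltnP i.+1 k; first by rewrite modn_small // /hub_pos /= oi andbT; case: (i) i3 => [|[]].
by rewrite (_ : i.+1 = k) ?modnn //; apply/eqP; rewrite eqn_leq ik ik1.
Qed.

(** Decoding a copy: its only edge without a hub joins positions 1 and 2. [lt_y] tells the two ends
    apart and [dU] finds the doubled cone; the end met by the hub at position 0 gives the Boolean.
    The other non-hubs are assigned to their cones by [cU], and [pU] concludes. *)
Lemma copy_inj : injective copy_of.
Proof.
move=> c c' Ec.
have S1 : [set step_a c; step_b c] = [set step_a c'; step_b c'].
  have : [set step_a c; step_b c] \in (copy_of c).2.
    by apply/copy_edgeP; exists 1; rewrite // modn_small.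
  rewrite Ec => /copy_edgeP[i ik Ei]; suff i1 : i = 1 by rewrite Ei i1 modn_small.
  have nh v : v \in [set step_a c; step_b c] -> ~~ hub v.
    by rewrite !inE /step_a /step_b => /orP[] /eqP->; case: c.2.
  apply: edge_nonhub => //; rewrite -(hub_walk c'); apply: nh; rewrite Ei ?set21 ?set22 //.
have [EX Ey] : X c.1 (d c.1) = X c'.1 (d c'.1) /\ y c.1 = y c'.1.
  have : [set X c.1 (d c.1); y c.1] = [set X c'.1 (d c'.1); y c'.1].
    have ab e : [set step_a e; step_b e] = [set X e.1 (d e.1); y e.1].
      by rewrite /step_a /step_b; case: e.2; rewrite // setUC.
    by move: S1; rewrite !ab.
  case/set2_eq => // -[h1 h2]; have := lt_y c.1; have := lt_y c'.1.
  by rewrite h1 h2 => l1 l2; have := ltn_trans l1 l2; rewrite ltnn.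
have Ed := dU EX.
have Ea : step_a c = step_a c'.
  have : [set walk c 0; walk c 1] \in (copy_of c).2.
    by apply/copy_edgeP; exists 0; rewrite // modn_small.
  have w0 : walk c 0 = walk c' 0 by rewrite !walk_hub // !shift0 Ed.
  rewrite Ec w0 => /copy_edgeP[i ik Ei].
  have : walk c' 0 \in [set walk c' i; walk c' (i.+1 %% k)] by rewrite -Ei set21.
  rewrite !inE => /orP[] /eqP /walk_inj Hi.
    rewrite -(Hi isT ik) modn_small // in Ei; case: (set2_eq Ei) => [[_ Hw]|[H _]]; first exact: Hw.
    by have := walk_inj (isT : 0 < k) (isT : 1 < k) H.
  (* Position 0 is reached from behind, so i is the last position 2m. Its vertex belongs to another
     cone, whereas [walk c 1] lies in the doubled one. *)
  have i2m : i.+1 = k.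
    apply/eqP; rewrite eqn_leq ik leqNgt; apply/negP => ik1.
    by have := Hi isT (ltn_pmod i.+1 (isT : 0 < k)); rewrite modn_small.
  rewrite i2m modnn in Ei.
  have Ew : walk c 1 = walk c' i.
    case: (set2_eq Ei) => [[h1 h2]|[_ h2]] //; rewrite h2 h1.
    by move: Ei; rewrite -h1 h2 => _.
  have i3 : 3 < i by move/succn_inj: i2m => ->.
  have oi : ~~ odd i by move/succn_inj: i2m => ->; rewrite odd_double.
  move: Ew; rewrite (walk_far c' i3 oi) => Ew.
  have /eqP[] := far_neq c' ik i3 oi; apply: (@step_neq_X c' tt) => //.
  have : walk c 1 \in [set step_a c'; step_b c'] by rewrite -S1 set21.
  by rewrite Ew !inE => /orP[] /eqP->; [left|right].
have Eo : c.2 = c'.2.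
  have := yX c.1 (d c.1); move: Ea; rewrite /step_a EX Ey; case: c.2 c'.2 => [] [] // ->; by rewrite eqxx.
have EXc e : X c.1 e = X c'.1 e.
  have [->|ed] := eqVneq e (d c.1); first by rewrite {2}Ed.
  have [j [j0 jm je]] := shift_surj ed.
  have : X c.1 e \in (copy_of c).1.
    apply/copy_vertexP; exists j.+1.*2; first by rewrite ltnS leq_double.
    rewrite walk_far ?odd_double //; last by rewrite -muln2; lia.
    by rewrite doubleK /= je.
  rewrite Ec => /copy_vertexP[i ik Ei].
  have nab : X c.1 e \notin [set step_a c'; step_b c'].
    rewrite -S1 !inE negb_or /step_a /step_b; apply/andP.
    by case: c.2; split; rewrite 1?eq_sym ?yX // (inj_eq (@X_inj _)) eq_sym.
  case: (pos_cases i) => [hi|[i1|i2|[i3 oi]]].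
  - by have := nX c.1 e; rewrite Ei hub_walk hi.
  - by rewrite Ei i1 set21 in nab.
  - by rewrite Ei i2 set22 in nab.
  rewrite walk_far // in Ei; have ne := far_neq c' ik i3 oi; rewrite -Ed in ne.
  by rewrite Ei; congr X; symmetry; apply: (cU Ed ed ne Ei).
case: c c' Ed Ey Eo EXc {Ec S1 EX Ea} => [p o] [p' o'] /= Ed Ey <- EXc.
by rewrite (pU Ed EXc Ey).
Qed.

Lemma ncopies_ge : 2 * #|P| <= ncopies E (cycle_edges k).
Proof.
have -> : 2 * #|P| = #|copy_of @: [set: P * bool]|.
  by rewrite card_imset ?cardsT ?card_prod ?card_bool 1?mulnC //; exact: copy_inj.
apply: subset_leq_card; apply/subsetP => _ /imsetP[c _ ->]; rewrite inE; apply/andP; split.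
  by apply/subsetP => e /copy_edgeP[i ik ->]; apply: walk_edge.
apply/existsP; exists (walkf c); rewrite !eqxx !andbT.
by apply/injectiveP => i j; rewrite !ffunE => /walk_inj H; apply: val_inj; apply: H.
Qed.

End LowerCopies.
End BlowupsFacts.

(** * A straight-line drawing in disjoint cones *)

Module DrawingsFacts.
From mathcomp Require Import all_boot all_order all_algebra.
From mathcomp Require Import all_classical all_reals.
From mathcomp Require Import topology normedtype exp.
From mathcomp Require Import Rstruct Rstruct_topology.
From mathcomp Require Import ring lra zify.
Import HalfPlaneFacts ArcsFacts TurnsFacts CertificateFacts MaximisersFacts.
Delimit Scope nat_scope with N.
Import Order.TTheory GRing.Theory Num.Theory numFieldNormedType.Exports.
Local Notation RR := Rdefinitions.R.
Local Open Scope ring_scope.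

Section Drawing.
Variables (m q : nat) (hv : nat -> (RR * RR)%type).
Definition next_hub c := (c.+1 %% m)%N.
Definition cone_pt c (u v : RR) : (RR * RR)%type :=
  (u * (hv c).1 + v * (hv (next_hub c)).1, u * (hv c).2 + v * (hv (next_hub c)).2).
Hypothesis q0 : (0 < q)%N.
Hypothesis cone_inj : forall c c' (u v u' v' : RR), (c < q)%N -> (c' < q)%N ->
  0 < u -> 0 < v -> 0 < u' -> 0 < v' -> cone_pt c u v = cone_pt c' u' v' ->
  [/\ c = c', u = u' & v = v'].
Hypothesis hub_out : forall c e (u v : RR), (c < q)%N -> (e < m)%N ->
  0 < u -> 0 < v -> cone_pt c u v <> hv e.
Hypothesis hv_inj : forall c e, (c < m)%N -> (e < m)%N -> hv c = hv e -> c = e.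

(** The labels m, m + 1, ... are dealt to the q cones in turn. Levels start at 1 and place the
    members of a cone on its bisector, consecutive members having labels that differ by q. *)
Definition cluster v := ((v - m) %% q)%N.
Definition level v := ((v - m) %/ q).+1.
Definition place v := if (v < m)%N then hv v else cone_pt (cluster v) (level v)%:R (level v)%:R.
Definition arc x y : bool := (m <= y)%N &&
  (if (x < m)%N then (x == cluster y) || (x == next_hub (cluster y)) else y == (x + q)%N).
Definition segment x y (t : RR) : (RR * RR)%type :=
  ((1 - t) * (place x).1 + t * (place y).1, (1 - t) * (place x).2 + t * (place y).2).
Definition coords x y (t : RR) : (RR * RR)%type :=
  let J : RR := (level y)%:R in
  if (x < m)%N then if x == cluster y then (1 - t + t * J, t * J) else (t * J, 1 - t + t * J)
  else (J - 1 + t, J - 1 + t).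

Lemma cluster_lt v : (cluster v < q)%N. Proof. by rewrite ltn_pmod. Qed.

Lemma level_cluster_inj y z : (m <= y)%N -> (m <= z)%N -> level y = level z ->
  cluster y = cluster z -> y = z.
Proof.
move=> my mz [h1] h2; rewrite -(subnK my) -(subnK mz); congr (_ + m)%N.
by rewrite (divn_eq (y - m) q) (divn_eq (z - m) q) h1 -/(cluster y) -/(cluster z) h2.
Qed.

Lemma levelD x : (m <= x)%N -> level (x + q)%N = (level x).+1 /\ cluster (x + q)%N = cluster x.
Proof.
move=> mx; rewrite /level /cluster -addnBAC // modnDr; split=> //.
by rewrite divnDr // divnn q0 addn1.
Qed.

Lemma level_ge1 y : 1 <= (level y)%:R :> RR.
Proof. by rewrite -[1]/(1%:R) ler_nat. Qed.

Lemma segment_coords x y t : arc x y ->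
  segment x y t = cone_pt (cluster y) (coords x y t).1 (coords x y t).2.
Proof.
rewrite /arc => /andP[my]; rewrite /segment /coords /place (ltnNge y) my /=.
case: ifP => xm.
  case: eqP => [<- _|_ /= /eqP ->]; rewrite /cone_pt /=; congr pair; ring.
have mx : (m <= x)%N by rewrite leqNgt xm.
move=> /eqP->; have [-> ->] := levelD mx.
by rewrite -natr1 /cone_pt /=; congr pair; ring.
Qed.

Lemma coords_gt0 x y t : 0 < t < 1 -> 0 < (coords x y t).1 /\ 0 < (coords x y t).2.
Proof.
move=> /andP[t0 t1]; have J1 := level_ge1 y; rewrite /coords.
have tJ : 0 < t * (level y)%:R by rewrite mulr_gt0 // (lt_le_trans _ J1).
by case: ifP => _; [case: ifP => _|]; split => /=; lra.
Qed.

Lemma nat_frac_inj a b (t s : RR) : 0 < t < 1 -> 0 <= s < 1 -> a%:R + t = b%:R + s -> a = b.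
Proof.
move=> /andP[t0 t1] /andP[s0 s1] E; case: (ssrnat.ltngtP a b) => // h; exfalso.
  have : a.+1%:R <= b%:R :> RR by rewrite ler_nat.
  by rewrite -natr1; lra.
have : b.+1%:R <= a%:R :> RR by rewrite ler_nat.
by rewrite -natr1; lra.
Qed.

(** In cone coordinates u - v equals 1 - t on segments from the first hub, t - 1 on those from the
    next hub, and 0 on those along the bisector. So the sign of u - v separates the three kinds. On
    hub segments its value gives t, and a coordinate t J then gives the level J; on the bisector the
    level is an integer part. *)
Lemma segment_disjoint x y x' y' t s : arc x y -> arc x' y' -> 0 < t < 1 -> 0 < s < 1 ->
  segment x y t = segment x' y' s -> x = x' /\ y = y'.
Proof.
move=> a a' t01 s01; rewrite !segment_coords //.
have [u0 v0] := coords_gt0 x y t01; have [u0' v0'] := coords_gt0 x' y' s01.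
move/(cone_inj (cluster_lt _) (cluster_lt _) u0 v0 u0' v0') => [Ec Eu Ev].
have /andP[my ax] := a; have /andP[my' ax'] := a'.
have /andP[t0 t1] := t01; have /andP[s0 s1] := s01.
have lev (J J' : nat) : t = s -> t * J%:R = s * J'%:R -> J = J'.
  by move=> <- /(mulfI (lt0r_neq0 t0)) /eqP; rewrite eqr_nat => /eqP.
have yy : level y = level y' -> y = y' by move=> h; apply: level_cluster_inj.
move: Eu Ev; rewrite /coords; move: ax ax'; case: ifP => xm; case: ifP => xm'.
- case: eqP => [xc _|_ /= /eqP xc]; case: eqP => [xc' _|_ /= /eqP xc'] /= h1 h2; try (exfalso; lra).
    by rewrite xc xc' Ec; split=> //; apply/yy/lev => //; lra.
  by rewrite xc xc' Ec; split=> //; apply/yy/lev => //; lra.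
- by move=> _ _; case: ifP => _ /= h1 h2; exfalso; lra.
- by move=> _ _; case: ifP => _ /= h1 h2; exfalso; lra.
move=> /eqP yx /eqP yx' /= h _.
have Ey : y = y'.
  apply: yy; apply: (nat_frac_inj t01 (_ : 0 <= s < 1)); last by lra.
  by rewrite s1 ltW.
by split=> //; apply: (@addIn q); rewrite -yx -yx'.
Qed.

Lemma segment_place x y t v : arc x y -> 0 < t < 1 -> segment x y t <> place v.
Proof.
move=> a t01; rewrite segment_coords // /place.
have [u0 v0] := coords_gt0 x y t01.
case: ifP => vm; first by apply: hub_out => //; apply: cluster_lt.
have J0 : 0 < (level v)%:R :> RR by rewrite (lt_le_trans _ (level_ge1 v)).
move/(cone_inj (cluster_lt _) (cluster_lt _) u0 v0 J0 J0) => [_].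
have /andP[t0 t1] := t01; rewrite /coords; case: ifP => _.
  by case: ifP => _ /= h1 h2; lra.
move=> /= h _; have E : (level y).-1%:R + t = (level v)%:R + 0 :> RR.
  by rewrite -h /level /= -natr1; lra.
have Ev := nat_frac_inj t01 (_ : 0 <= 0 < 1) E.
by move: E; rewrite Ev ?lexx ?ltr01 //; lra.
Qed.

Lemma place_inj x y : place x = place y -> x = y.
Proof.
rewrite /place; case: ifP => xm; case: ifP => ym.
- exact: hv_inj.
- by move/esym/hub_out => H; case: (H _ xm); rewrite ?cluster_lt ?(lt_le_trans _ (level_ge1 y)).
- by move/hub_out => H; case: (H _ ym); rewrite ?cluster_lt ?(lt_le_trans _ (level_ge1 x)).
have J0 v : 0 < (level v)%:R :> RR by rewrite (lt_le_trans _ (level_ge1 v)).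
move/(cone_inj (cluster_lt _) (cluster_lt _) (J0 _) (J0 _) (J0 _) (J0 _)) => [Ec /eqP].
rewrite eqr_nat => /eqP El _; apply: level_cluster_inj => //; by rewrite leqNgt ?xm ?ym.
Qed.

Variable n : nat.
Definition drawn_edges : {set {set 'I_n}} :=
  [set e | [exists x : 'I_n, exists y : 'I_n, arc x y && (e == [set x; y])]]%SET.

Lemma drawn_edgeP (e : {set 'I_n}) : reflect (exists x y : 'I_n, arc x y /\ e = [set x; y]%SET)
  (e \in drawn_edges).
Proof.
rewrite inE; apply: (iffP existsP) => [[x /existsP[y /andP[a /eqP->]]]|[x [y [a ->]]]].
  by exists x, y.
by exists x; apply/existsP; exists y; rewrite a eqxx.
Qed.

Lemma arc_neq x y : arc x y -> x <> y.
Proof.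
move=> /andP[my]; case: ifP => [xm _|_ /eqP->]; first by move=> E; rewrite E ltnNge my in xm.
move=> E; have := congr1 (subn^~ x) E; rewrite /= subnn addKn => q00.
by move: q0; rewrite -q00.
Qed.

Lemma drawn_simple : simple_graph drawn_edges.
Proof.
apply/forall_inP => e /drawn_edgeP[x [y [a ->]]]; rewrite cards2.
by case: (x =P y) => // xy; case: (arc_neq a); rewrite xy.
Qed.

Lemma segment_continuous x y : continuous (segment x y).
Proof.
have aff (a b : RR) : continuous (fun t : RR => (1 - t) * a + t * b).
  have c1 : continuous (fun t : RR => 1 - t).
    by apply: (@continuousDr _ _ (fun _ : RR => 1 : RR) (fun t : RR => - t)); [exact: cst_continuous | move=> t; apply: cvgN; exact: cvg_id].
  apply: (@continuousDr _ _ (fun t : RR => (1 - t) * a) (fun t : RR => t * b)).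
    by apply: (@continuousMr _ _ (fun t : RR => 1 - t) (fun _ : RR => a)); [exact: c1 | exact: cst_continuous].
  by apply: (@continuousMr _ _ (fun t : RR => t) (fun _ : RR => b)); [move=> ?; exact: cvg_id | exact: cst_continuous].
by move=> t; exact: (cvg_pair (aff (place x).1 (place y).1 t) (aff (place x).2 (place y).2 t)).
Qed.

Lemma drawn_planar : planar drawn_edges.
Proof.
apply/planarP.
pose ends (e : {set 'I_n}) (c : 'I_n * 'I_n) := arc c.1 c.2 && (e == [set c.1; c.2]%SET).
pose cv (e : {set 'I_n}) (t : RR) : (RR * RR)%type :=
  if [pick c | ends e c] is Some c then segment c.1 c.2 t else (0, 0).
have cvE e : e \in drawn_edges -> exists x y : 'I_n,
    [/\ arc x y, e = [set x; y]%SET & cv e = segment x y].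
  move=> /drawn_edgeP[x [y [a Ee]]]; rewrite /cv; case: pickP => [[x' y'] /andP[/= a' /eqP E']|H].
    by exists x', y'.
  by have := H (x, y); rewrite /ends /= a Ee eqxx.
exists (fun v : 'I_n => place v), cv; split; last split.
- by move=> v w /place_inj/val_inj.
- move=> e /cvE[x [y [a Ee ->]]]; exists x, y; split=> //.
  + by apply/eqP => E; case: (arc_neq a); rewrite E.
  + by rewrite /segment subr0 !mul1r !mul0r !addr0 -surjective_pairing.
  + by rewrite /segment subrr !mul0r !mul1r !add0r -surjective_pairing.
  split; first exact/continuous_subspaceT/segment_continuous.
    move=> t s _ _ E; apply/eqP; rewrite -subr_eq0; apply/negPn/negP => ts.
    case: (arc_neq a); apply: place_inj; case: E => e1 e2.
    rewrite [LHS]surjective_pairing [RHS]surjective_pairing; congr pair; apply: (mulfI ts); lra.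
  by move=> t t01 v; apply: segment_place.
move=> e e' /cvE[x [y [a Ee ->]]] /cvE[x' [y' [a' Ee' ->]]] ne t s t01 s01.
by move/(segment_disjoint a a' t01 s01) => [/val_inj Ex /val_inj Ey]; move: ne; rewrite Ee Ee' Ex Ey eqxx.
Qed.

End Drawing.
End DrawingsFacts.

(** * Concrete hubs and families of copies *)

Module FamiliesFacts.
From mathcomp Require Import all_boot all_order all_algebra.
From mathcomp Require Import all_classical all_reals.
From mathcomp Require Import topology normedtype exp.
From mathcomp Require Import Rstruct Rstruct_topology.
From mathcomp Require Import ring lra zify.
Import DrawingsFacts BlowupsFacts.
Delimit Scope nat_scope with N.
Delimit Scope ring_scope with RR.
Import Order.TTheory GRing.Theory Num.Theory.
Local Open Scope nat_scope.
Local Notation RR := Rdefinitions.R.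

(** Here q is the number of cones. It equals m for three and four hubs, whose cones fill the plane,
    but two hubs span only one cone and then q = 1. *)
Definition separated_cones (m q : nat) (hv : nat -> (RR * RR)%type) :=
  [/\ forall c c' (u v u' v' : RR), c < q -> c' < q ->
        (0 < u)%R -> (0 < v)%R -> (0 < u')%R -> (0 < v')%R ->
        cone_pt m hv c u v = cone_pt m hv c' u' v' -> [/\ c = c', u = u' & v = v'],
      forall c e (u v : RR), c < q -> e < m -> (0 < u)%R -> (0 < v)%R -> cone_pt m hv c u v <> hv e &
      forall c e, c < m -> e < m -> hv c = hv e -> c = e].

Definition hubs_of (s : seq (RR * RR)%type) (c : nat) : (RR * RR)%type := nth (0%R, 0%R) s c.
Definition hubs4 : seq (RR * RR)%type := [:: (1, 0); (0, 1); (-1, 0); (0, -1)]%R.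
Definition hubs3 : seq (RR * RR)%type := [:: (1, 0); (0, 1); (-1, -1)]%R.
Definition hubs2 : seq (RR * RR)%type := [:: (1, 0); (0, 1)]%R.

Lemma separated4 : separated_cones 4 4 (hubs_of hubs4).
Proof.
have e0 : next_hub 4 0 = 1 by []. have e1 : next_hub 4 1 = 2 by [].
have e2 : next_hub 4 2 = 3 by []. have e3 : next_hub 4 3 = 0 by [].
split.
- move=> [|[|[|[|c]]]] [|[|[|[|c']]]] u v u' v' // _ _ u0 v0 u0' v0';
  rewrite /cone_pt ?e0 ?e1 ?e2 ?e3 /hubs_of /= => -[h1 h2]; clear e0 e1 e2 e3; first [by exfalso; lra | by split=> //; lra].
- move=> [|[|[|[|c]]]] [|[|[|[|e]]]] u v // _ _ u0 v0;
  rewrite /cone_pt ?e0 ?e1 ?e2 ?e3 /hubs_of /= => -[h1 h2]; clear e0 e1 e2 e3; lra.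
clear e0 e1 e2 e3; move=> [|[|[|[|c]]]] [|[|[|[|e]]]] // _ _; rewrite /hubs_of /= => E;
  have h1 := congr1 fst E; have h2 := congr1 snd E; rewrite /= in h1 h2; clear E; exfalso; lra.
Qed.

Lemma separated3 : separated_cones 3 3 (hubs_of hubs3).
Proof.
have e0 : next_hub 3 0 = 1 by []. have e1 : next_hub 3 1 = 2 by [].
have e2 : next_hub 3 2 = 0 by [].
split.
- move=> [|[|[|c]]] [|[|[|c']]] u v u' v' // _ _ u0 v0 u0' v0';
  rewrite /cone_pt ?e0 ?e1 ?e2 /hubs_of /= => -[h1 h2]; clear e0 e1 e2; first [by exfalso; lra | by split=> //; lra].
- move=> [|[|[|c]]] [|[|[|e]]] u v // _ _ u0 v0;
  rewrite /cone_pt ?e0 ?e1 ?e2 /hubs_of /= => -[h1 h2]; clear e0 e1 e2; lra.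
clear e0 e1 e2; by move=> [|[|[|c]]] [|[|[|e]]] // _ _; rewrite /hubs_of /= => -[h1 h2]; exfalso; lra.
Qed.

Lemma separated2 : separated_cones 2 1 (hubs_of hubs2).
Proof.
have e0 : next_hub 2 0 = 1 by [].
split.
- move=> [|c] [|c'] u v u' v' // _ _ u0 v0 u0' v0';
  rewrite /cone_pt ?e0 /hubs_of /= => -[h1 h2]; clear e0; by split=> //; lra.
- move=> [|c] [|[|e]] u v // _ _ u0 v0;
  rewrite /cone_pt ?e0 /hubs_of /= => -[h1 h2]; clear e0; lra.
clear e0; by move=> [|[|c]] [|[|e]] // _ _; rewrite /hubs_of /= => -[h1 h2]; exfalso; lra.
Qed.

Lemma NP_ge_ncopies m q hv n k (EH : {set {set 'I_k}}) : 0 < q -> separated_cones m q hv ->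
  ncopies (drawn_edges m q n) EH <= NP n EH.
Proof.
move=> q0 [h1 h2 h3]; rewrite /NP; apply: (leq_bigmax_cond (F := fun E => ncopies E EH)).
rewrite drawn_simple //; apply/asboolP.
by apply: (@drawn_planar m q hv).
Qed.

Lemma drawn_edge m q n (x y : 'I_n) : arc m q x y -> [set x; y]%SET \in drawn_edges m q n.
Proof. by move=> a; apply/drawn_edgeP; exists x, y. Qed.

Lemma drawn_edgeC m q n (x y : 'I_n) : arc m q x y -> [set y; x]%SET \in drawn_edges m q n.
Proof. by move=> a; rewrite finset.setUC; apply: drawn_edge. Qed.

Section Cyclic.
Variables (m'' n' K : nat).
Local Notation m := m''.+2.
Local Notation n := n'.+1.
Hypothesis nK : m * K.+2 <= n.
Let P := ('I_m * {ffun 'I_m -> 'I_K})%type.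
Let X (p : P) (c : 'I_m) : 'I_n := inord (m + (c + m * p.2 c)).
Let y (p : P) : 'I_n := inord (m + (p.1 + m * (p.2 p.1).+1)).
Let h (c : 'I_m) : 'I_n := inord c.

Let X_bound (c : 'I_m) (j : 'I_K) : m + (c + m * j.+1) < n.
Proof.
apply: leq_trans nK; rewrite -addnS; have := leq_mul (leqnn m) (ltn_ord j).
rewrite !mulnS; have := ltn_ord c; move: (m * j) (m * K) => a b; lia.
Qed.

Let Xv p c : X p c = m + (c + m * p.2 c) :> nat.
Proof.
rewrite inordK //; apply: leq_ltn_trans (X_bound c (p.2 c)).
by rewrite !leq_add2l leq_mul2l leqnSn orbT.
Qed.
Let yv p : y p = m + (p.1 + m * (p.2 p.1).+1) :> nat.
Proof. by rewrite inordK. Qed.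
Let hv' (c : 'I_m) : h c = c :> nat.
Proof. by rewrite inordK //; apply: leq_trans nK; rewrite mulnS; apply: leq_trans (ltn_ord c) (leq_addr _ _). Qed.

Let cl (c : 'I_m) j : cluster m m (m + (c + m * j)) = c.
Proof. by rewrite /cluster addKn addnC mulnC modnMDl modn_small. Qed.

Let Ehub (c : 'I_m) v (e : 'I_n) : e = m + (c + m * v) :> nat -> arc m m (h c) e.
Proof. by move=> ev; rewrite /arc hv' ltn_ord ev cl leq_addr eqxx. Qed.
Let Enext (c : 'I_m) v (e : 'I_n) : e = m + (c + m * v) :> nat -> arc m m (h (c + 1)%R) e.
Proof.
by move=> ev; rewrite /arc hv' ltn_ord ev cl leq_addr /= /next_hub modnDmr addn1 eqxx orbT.
Qed.

Let Xeq p q c c' : X p c = X q c' -> c = c' /\ p.2 c = q.2 c'.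
Proof.
move=> E; have Ev : m + (c + m * p.2 c) = m + (c' + m * q.2 c') by rewrite -!Xv E.
have cc : c = c' by apply: val_inj; rewrite /= -(cl c (p.2 c)) Ev cl.
split=> //; apply: val_inj; move: Ev; rewrite cc => /addnI/addnI/eqP.
by rewrite eqn_mul2l => /eqP.
Qed.

(** One of m cones is doubled and a level below K is chosen in each cone; the doubled vertex takes
    the level above the chosen one. Together with the row of hubs this needs K + 2 rows of m
    labels. *)
Lemma cyclic_copies : 2 * (m * K ^ m) <= ncopies (drawn_edges m m n) (cycle_edges m.*2.+1).
Proof.
have cP : #|{: P}| = m * K ^ m by rewrite card_prod card_ffun !card_ord.
rewrite -cP; apply: (@ncopies_ge n m'' _ P (fun p => p.1) X y h (fun v => v < m)).
- by move=> c; rewrite hv'.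
- by move=> c c' /(congr1 val); rewrite /= !hv' => /val_inj.
- by move=> p c; rewrite Xv -leqNgt leq_addr.
- by move=> p; rewrite yv -leqNgt leq_addr.
- by move=> p c c' /Xeq[].
- move=> p c; apply/eqP => /(congr1 val); rewrite /= yv Xv => E.
  have pc : p.1 = c by apply: val_inj; rewrite /= -(cl p.1 (p.2 p.1).+1) E cl.
  by move: E; rewrite pc => /addnI/addnI/eqP; rewrite eqn_mul2l /= => /eqP /esym/n_Sn.
- by move=> p; rewrite Xv yv !ltn_add2l ltn_mul2l ltnSn.
- by move=> p c; apply: drawn_edge; apply: Ehub; exact: Xv.
- by move=> p c; apply: drawn_edgeC; apply: Enext; exact: Xv.
- move=> p; apply: drawn_edge; rewrite /arc yv Xv leq_addr ltnNge leq_addr /=.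
  by rewrite mulnS; apply/eqP; lia.
- by move=> p; apply: drawn_edge; apply: Ehub; exact: yv.
- by move=> p; apply: drawn_edgeC; apply: Enext; exact: yv.
- by move=> p q /Xeq[].
- by move=> p q c c' _ _ _ /Xeq[].
move=> [p1 p2] [q1 q2] /= -> H _; congr pair; apply/ffunP => c.
by have /Xeq[] := H c.
Qed.
End Cyclic.

Section Pentagon.
Variable K : nat.
Local Notation n := K.+3.
(** All K + 1 non-hubs hang on both hubs and form a path. A choice is a path edge, given by its
    lower end, and a further vertex off that edge; both hub-to-hub links draw on the same vertices,
    which is why the pentagon constant is larger than the general pattern. *)
Let P := {c : 'I_K * 'I_K | (c.2 != c.1) && (c.2 != c.1.+1 :> nat)}.
Let X (p : P) (c : 'I_2) : 'I_n := inord (2 + (if c == ord0 then (val p).1 else (val p).2)).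
Let y (p : P) : 'I_n := inord (2 + (val p).1.+1).
Let h (c : 'I_2) : 'I_n := inord c.

Let Xv p c : X p c = 2 + (if c == ord0 then (val p).1 else (val p).2) :> nat.
Proof. by rewrite inordK // !ltnS; case: ifP => _; apply: ltnW. Qed.
Let yv p : y p = 2 + (val p).1.+1 :> nat. Proof. by rewrite inordK // !ltnS. Qed.
Let hv' (c : 'I_2) : h c = c :> nat.
Proof. by rewrite inordK //; apply: leq_trans (ltn_ord c) _. Qed.

Let Ehub (c : 'I_2) (e : 'I_n) : 2 <= e -> arc 2 1 (h c) e.
Proof.
move=> e2; rewrite /arc e2 hv' ltn_ord /cluster modn1.
by case: c => [[|[|c]] hc].
Qed.

Lemma pentagon_pairs : K ^ 2 <= #|{: P}| + 2 * K.
Proof.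
rewrite card_sig; pose B1 := [set c : 'I_K * 'I_K | c.2 == c.1]%SET.
pose B2 := [set c : 'I_K * 'I_K | c.2 == c.1.+1 :> nat]%SET.
have inj1 (B : {set 'I_K * 'I_K}) : {in B &, injective (@fst 'I_K 'I_K)} -> #|B| <= K.
  by move=> inj; rewrite -(card_in_imset inj) -[X in _ <= X]card_ord max_card.
have b1 : #|B1| <= K.
  by apply: inj1 => -[a b] [a' b']; rewrite !inE /= => /eqP-> /eqP-> ->.
have b2 : #|B2| <= K.
  apply: inj1 => -[a b] [a' b']; rewrite !inE /= => /eqP e1 /eqP e2 e3; rewrite e3 in e1 *.
  by congr pair; apply: val_inj; rewrite /= e1 e2.
have -> : K ^ 2 = #|{: 'I_K * 'I_K}| by rewrite card_prod card_ord mulnn.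
rewrite -(cardC [pred c : 'I_K * 'I_K | (c.2 != c.1) && (c.2 != c.1.+1 :> nat)]) leq_add2l.
apply: (@leq_trans #|B1 :|: B2|%SET).
  apply: subset_leq_card; apply/fintype.subsetP => c; rewrite !inE negb_and !negbK; exact: id.
by apply: leq_trans (leq_of_leqif (leq_card_setU _ _)) _; rewrite mul2n -addnn leq_add.
Qed.

Lemma pentagon_copies : 2 * K ^ 2 <= ncopies (drawn_edges 2 1 n) (cycle_edges 5) + 4 * K.
Proof.
suff H : 2 * #|{: P}| <= ncopies (drawn_edges 2 1 n) (cycle_edges 5).
  have := pentagon_pairs; move: H; move: #|_| (ncopies _ _) (K ^ 2) => a b c; lia.
have nz (c : 'I_2) : c != ord0 -> c = lift ord0 ord0.
  by case: c => [[|[|c]] hc] // _; apply: val_inj.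
apply: (@ncopies_ge n 0 _ P (fun=> ord0) X y h (fun v => v < 2)).
- by move=> c; rewrite hv'.
- by move=> c c' /(congr1 val); rewrite /= !hv' => /val_inj.
- by move=> p c; rewrite Xv.
- by move=> p; rewrite yv.
- move=> p c c' /(congr1 val); rewrite /= !Xv => /addnI.
  have /andP[ne _] := valP p.
  case: (eqVneq c ord0) => [->|/nz->]; case: (eqVneq c' ord0) => [->|/nz->] //.
    by move/val_inj/eqP; rewrite eq_sym (negbTE ne).
  by move/val_inj/eqP; rewrite (negbTE ne).
- move=> p c; apply/eqP => /(congr1 val); rewrite /= yv Xv => /addnI.
  have /andP[_ ne] := valP p; case: ifP => _ E; first by move: (esym E) => /n_Sn.
  by move/eqP: ne; rewrite E.
- by move=> p; rewrite Xv yv eqxx.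
- by move=> p c; apply: drawn_edge; apply: Ehub; rewrite Xv.
- by move=> p c; apply: drawn_edgeC; apply: Ehub; rewrite Xv.
- by move=> p; apply: drawn_edge; rewrite /arc yv Xv eqxx /= !addSn add0n addn1.
- by move=> p; apply: drawn_edge; apply: Ehub; rewrite yv.
- by move=> p; apply: drawn_edgeC; apply: Ehub; rewrite yv.
- by [].
- by move=> p q c c' _ /nz-> /nz->.
move=> p q _ H _; apply: val_inj; have := H ord0; have := H (lift ord0 ord0).
move=> /(congr1 val); rewrite /= !Xv => /addnI/val_inj e2 /(congr1 val); rewrite /= !Xv => /addnI/val_inj e1.
by rewrite [LHS]surjective_pairing [RHS]surjective_pairing e1 e2.
Qed.
End Pentagon.
End FamiliesFacts.

(* Matching lower bounds and conclusion *)
From mathcomp Require Import all_boot all_order all_algebra.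
From mathcomp Require Import all_classical all_reals.
From mathcomp Require Import topology normedtype exp.
From mathcomp Require Import Rstruct Rstruct_topology.
From mathcomp Require Import ring lra zify.
Import MaximisersFacts GraphUpperFacts UpperFacts DrawingsFacts BlowupsFacts FamiliesFacts.
Delimit Scope nat_scope with N.
Delimit Scope ring_scope with RR.
Import Order.TTheory GRing.Theory Num.Theory.
Local Notation RR := Rdefinitions.R.
Local Open Scope ring_scope.

Lemma lower_arith (a b c d e f g : RR) : 2 * (g * b) <= a ->
  g * 2 * (g * 3) * d <= g * 2 * (g * 3) * (e * f) -> g * 2 * c <= g * 2 * (b + g * 3 * d) ->
  g * 2 * c <= a + g * 2 * (g * 3 * e) * f.
Proof. by move=> *; lra. Qed.

Lemma NP_lower m'' hv (m := m''.+2) : separated_cones m m hv ->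
  exists C : RR, 0 <= C /\ forall n, (m * 3 <= n)%N ->
    m%:R * 2 * (n%:R / m%:R) ^+ m <= (NP n (cycle_edges m.*2.+1))%:R + C * n%:R ^+ m''.+1.
Proof.
move=> sep; exists (m%:R * 2 * (m%:R * 3 * 4 ^+ m''.+1)); split.
  by rewrite !mulr_ge0 // exprn_ge0.
case=> [|n'] // n3; set n := n'.+1 in n3 *.
have q3 : (3 <= n %/ m)%N by rewrite leq_divRL // mulnC.
(* Of the rows of m labels, one is taken by the hubs and one is kept for the doubled vertex at the
   top level. *)
pose K := (n %/ m - 2)%N; have K2 : K.+2 = (n %/ m)%N by rewrite /K; lia.
have nK : (m * K.+2 <= n)%N by rewrite K2 mulnC leq_trunc_div.
have m0 : (0 < m)%N by [].
have := leq_trans (cyclic_copies nK) (NP_ge_ncopies n (cycle_edges m.*2.+1) m0 sep).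
rewrite -(ler_nat RR) natrM [(m * K ^ m)%N%:R]natrM natrX => H.
have mp : 0 < m%:R :> RR by rewrite ltr0n.
have nm : n%:R / m%:R <= K%:R + 3 :> RR.
  rewrite ler_pdivrMr // -natrD -natrM ler_nat.
  by have := ltn_ceil n m0; rewrite -K2 => /ltnW; rewrite addn3.
have nm0 : 0 <= n%:R / m%:R :> RR by rewrite divr_ge0.
have Kn : K%:R + 3 <= 4 * n%:R :> RR.
  have k1 : K%:R <= n%:R :> RR by rewrite ler_nat /K; apply: leq_trans (leq_subr _ _) (leq_div _ _).
  have n1 : 1 <= n%:R :> RR by rewrite -[1]/(1%:R) ler_nat.
  lra.
have K0 : 0 <= K%:R :> RR by [].
have h1 : (n%:R / m%:R) ^+ m <= K%:R ^+ m + m%:R * 3 * (K%:R + 3) ^+ m''.+1 :> RR.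
  apply: le_trans (expr_add_le _ K0 _) => //.
  by rewrite lerXn2r ?nnegrE // addr_ge0.
have h2 : (K%:R + 3) ^+ m''.+1 <= 4 ^+ m''.+1 * n%:R ^+ m''.+1 :> RR.
  by rewrite -exprMn lerXn2r ?nnegrE ?addr_ge0 ?mulr_ge0.
have h3 := ler_wpM2l (_ : 0 <= m%:R * 2 * (m%:R * 3) :> RR) h2.
have h4 := ler_wpM2l (_ : 0 <= m%:R * 2 :> RR) h1.
exact: (lower_arith H (h3 ltac:(by rewrite !mulr_ge0)) (h4 ltac:(by rewrite mulr_ge0))).
Qed.

Lemma NP_lower5 n : (3 <= n)%N -> 2 * n%:R ^+ 2 <= (NP n (cycle_edges 5))%:R + 16 * n%:R :> RR.
Proof.
case: n => [|[|[|K]]] // _.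
have := leq_trans (pentagon_copies K) (leq_add (@NP_ge_ncopies 2 1 (hubs_of hubs2) K.+3 5 (cycle_edges 5) isT separated2) (leqnn _)).
rewrite -(ler_nat RR) natrD [(2 * K ^ 2)%N%:R]natrM [(4 * K)%N%:R]natrM natrX.
have -> : K.+3%:R = K%:R + 3 :> RR by rewrite -natrD addn3.
by move: (NP _ _)%:R => a; have : 0 <= K%:R :> RR by []; rewrite !expr2; lra.
Qed.

Lemma dist_le (a b u v e : RR) : a <= b + u * e -> b <= a + v * e -> 0 <= u -> 0 <= v -> 0 <= e ->
  `|a - b| <= (u + v) * e.
Proof.
move=> h1 h2 u0 v0 e0; have := mulr_ge0 u0 e0; have := mulr_ge0 v0 e0.
by rewrite ler_norml => *; apply/andP; split; lra.
Qed.

Lemma mul_div_swap (a x y : RR) : a * (x / y) = a / y * x.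
Proof. by rewrite mulrA mulrAC. Qed.

(** The hypothesis on [pc_const] says that the extremal constant is the one reached by blowing up
    the m-cycle evenly, so the upper and lower leading terms coincide. *)
Lemma NP_asymptotic m'' hv (m := m''.+2) : separated_cones m m hv ->
  pc_const RR m'' = m%:R * 2 / m%:R ^+ m -> exists (C : RR) (N0 : nat), forall n, (N0 <= n)%N ->
    `| (NP n (cycle_edges m.*2.+1))%:R - m%:R * 2 * (n%:R / m%:R) ^+ m |
       <= C * powR n%:R (m%:R - 5^-1).
Proof.
move=> sep Em; have [C1 [C10 H1]] := NP_upper RR m''; have [C2 [C20 H2]] := NP_lower sep.
exists (C1 + C2), (m * 3)%N => n n3; have n0 : (0 < n)%N by apply: leq_trans n3.
apply: dist_le => //; last exact: powR_ge0.
  apply: le_trans (H1 n n0) _; rewrite Em expr_div_n lerD2r.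
  by rewrite mul_div_swap.
apply: le_trans (H2 n n3) _; rewrite lerD2l ler_wpM2l //; exact: power_le_error.
Qed.

From Stdlib Require Import Rdefinitions.

Theorem theorem1p1 :
  (exists (C : R) (N0 : nat), forall n : nat, leq N0 n ->
     `| (NP n (cycle_edges 5))%:R - 2 * (n%:R) ^+ 2 |
       <= C * powR (n%:R) (2 - 5^-1)) /\
  (forall m : nat, m = 3%nat \/ m = 4%nat ->
     exists (C : R) (N0 : nat), forall n : nat, leq N0 n ->
       `| (NP n (cycle_edges m.*2.+1))%:R
          - m%:R * 2 * (n%:R / m%:R) ^+ m |
         <= C * powR (n%:R) (m%:R - 5^-1)) /\
  (forall m : nat, leq 5 m ->
     exists (C : R) (N0 : nat), forall n : nat, leq N0 n ->
       (NP n (cycle_edges m.*2.+1))%:R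
         <= 3 * m%:R * (n%:R / m%:R) ^+ m + C * powR (n%:R) (m%:R - 5^-1)).
Proof.
split; [|split].
- have [C [C0 H]] := NP_upper R 0; exists (C + 16), 3%nat => n n3.
  have n0 : leq 1 n by apply: leq_trans n3.
  apply: dist_le => //; [exact: (H n n0) | | exact: powR_ge0].
  apply: le_trans (NP_lower5 n3) _; rewrite lerD2l ler_wpM2l //.
  by have := @power_le_error R n 1 n0; rewrite expr1.
- move=> m [->|->].
    by apply: (NP_asymptotic separated3); rewrite /=; field.
  by apply: (NP_asymptotic separated4); rewrite /=; field.
case=> [|[|m]] // m5; have [C [C0 H]] := NP_upper R m; exists C, 1%nat => n n0.
apply: le_trans (H n n0) _; rewrite lerD2r expr_div_n mul_div_swap ler_wpM2r ?exprn_ge0 //.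
exact: (pc_const_le R m5).
Qed.
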